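(* For all integers $n\ge 272$, $B(q(n-1),q(n),q(n+1),q(n+2),q(n+3))>0$, where $B(a_0,a_1,a_2,a_3,a_4)=-a_0a_2a_4+a_2^3+a_0a_3^2+a_1^2a_4-2a_1a_2a_3$; that is, $$-q(n-1)q(n+1)q(n+3)+q(n+1)^3+q(n-1)q(n+2)^2+q(n)^2q(n+3)-2q(n)q(n+1)q(n+2)>0.$$
   Context: $q(n)$ denotes the number of partitions of $n$ into distinct parts. *)

(* Defs.v *)
From mathcomp Require Import all_boot all_order all_algebra.
Set Implicit Arguments.
Unset Strict Implicit.
Unset Printing Implicit Defensive.
Import Order.TTheory GRing.Theory Num.Theory.

(* A partition of n into distinct parts is a finite set of positive integers
   with sum n; its parts are at most n, and i : 'I_n stands for the part i.+1. *)
Definition q (n : nat) : nat :=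
  #|[set A : {set 'I_n} | (\sum_(i in A) i.+1)%N == n]|.

Local Open Scope ring_scope.

Definition B (a0 a1 a2 a3 a4 : int) : int :=
  - (a0 * a2 * a4) + a2 ^+ 3 + a0 * a3 ^+ 2 + a1 ^+ 2 * a4
  - 2 * a1 * a2 * a3.

(* Main.v *)
(* [B] is the determinant of the 3x3 Toeplitz matrix [q (n + 1 + i - j)].  By Euler's theorem
   [sum q(m) x^m = prod_(l odd) 1 / (1 - x^l)], so for [x = e^{-s + i t}] the rescaled numbers
   [q(n + 1 + j) e^{-(n + 1 + j) s}] are, up to a common positive factor, the integrals of
   [w(t) cos (psi(t) - j t)] over [-pi, pi], with a weight [0 < w <= 1] and an odd phase [psi].
   The symmetric part of the rescaled Toeplitz matrix has entries [int w cos psi cos (j t)];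
   if it is positive definite, the determinant is positive.  On trigonometric polynomials this
   reads [T0 T2 > T1^2] for the moments [Tk = int w (cos psi) (1 - cos t)^k] together with
   [int w (cos psi) sin^2 > 0], and both inequalities only need a lower bound of [w cos psi],
   hence no asymptotic expansion of [q].

   With [s] chosen as the exact saddle point (the mean of the tilted law is [n + 1]), the second
   cumulant gives [w >= exp (- 0.85 v^2)] for [t = s^(3/2) v], the third one bounds the
   phase, so [w cos psi] is at least an explicit step function for [v <= 5/2]; the fourth
   cumulant, and further out the closed form of [sum_(l odd) e^{-l s} (1 - cos (l t))], show that
   the remaining range contributes little.  This works for [n >= 10000].

   For [n < 10000] the values of [q] are computed from
   [sum q(m) x^m = 1 + x/(1-x) (1 + x^2/(1-x^2) (1 + x^3/(1-x^3) (...)))], which counts partitions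
   by their number of parts, and [B > 0] is tested on 50-bit truncations through the
   Desnanot-Jacobi identity. *)

(* [B] is smaller than its terms by a factor of order [s^9], that is [n^(-9/2)], so an expansion of
   [q] would be needed to many orders with explicit errors. In integral form the cancellation is
   exact: what remains is a comparison of moments of sizes [s^(3/2)], [s^(9/2)], [s^(15/2)]. For a
   Gaussian weight [T0 T2 / T1^2] would be 3; ten steps and crude tail bounds use up part of this
   factor and still leave about 1.5.

   Euler's product is cut after [J] odd factors, with [J >= 10000 / s^2]. This keeps every sum
   finite, does not change the coefficients in use, and makes the truncation terms negligible.

   The limit 10000 comes from the first cumulant: it is at most [0.85 / s^2], so for a mean of at
   least 10001 there is a saddle point with [s <= 1/108]. Most later constants are worst cases at
   [s = 1/108].

   The two numerical arguments know [q] only through recurrences, as arguments [o], [T] and [Y];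
   polynomials modulo ['X^M] supply these recurrences at the end. *)
From Stdlib Require Import Reals Ranalysis5 Lra Lia ZArith List Bool.
From Coquelicot Require Import Coquelicot.
Import ListNotations.

Local Open Scope Z_scope.

(** * The range below 10000 *)

(* [lag_sum f q1 q2] outputs [f i + prev i], where [prev] is the queue [q1 ++ rev q2]
   followed by the output itself. *)
Fixpoint lag_sum (f q1 q2 : list Z) : list Z :=
  match f with
  | [] => []
  | b :: f' =>
    match q1 with
    | a :: q1' => let s := a + b in s :: lag_sum f' q1' (s :: q2)
    | [] => match rev_append q2 [] with
            | [] => []
            | a :: q1' => let s := a + b in s :: lag_sum f' q1' [s]
            end
    end
  end.

(** The list of [1 + x^k/(1 - x^k) f]: [lag_sum] started on [k] zeros divides by [1 - x^k]. From [L]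
    coefficients of [f] it yields [L + k], so early passes stay short. *)
Definition pass (k : nat) (f : list Z) : list Z :=
  1 :: repeat 0 (pred k) ++ lag_sum f (repeat 0 k) [].

Fixpoint passes (k : nat) (f : list Z) : list Z :=
  match k with O => f | S k' => passes k' (pass k f) end.

(* Bounds for the minors [b^2 - a c] of numbers whose integer parts are [a], [b], [c]. *)
Fixpoint minors2 (F : list Z) : list (Z * Z) :=
  match F with
  | a :: ((b :: c :: _) as t) =>
    let d := b * b - a * c in (d - (a + c + 1), d + (2 * b + 1)) :: minors2 t
  | _ => []
  end.

(** Interval form of [u1 * u3 < u2^2] for consecutive minors. Lower ends must be nonnegative so that
    products of ends bound products of minors. *)
Fixpoint minors3_pos (V : list (Z * Z)) : bool :=
  match V with
  | (l0, h0) :: (((l1, _) :: (l2, h2) :: _) as t) =>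
    if (0 <=? l0) && (0 <=? l1) && (0 <=? l2) && (h0 * h2 <? l1 * l1) then minors3_pos t else false
  | _ => true
  end.

(** 64 windows share one truncation: [s] keeps about 49 bits of the first entry, [e] about 28 bits
    of the first minor. 68 entries are read because a window spans five. The shifts only influence
    whether the test succeeds; [block_sound] holds for all nonnegative [s] and [e]. *)
Fixpoint blocks (fuel : nat) (l : list Z) : bool :=
  match fuel with
  | O => true
  | S fuel' =>
    match l with
    | [] => true
    | a :: _ =>
      let s := Z.max 0 (Z.log2 a - 48) in
      let V := minors2 (map (fun x => Z.shiftr x s) (firstn 68 l)) in
      match V with
      | [] => true
      | (l0, _) :: _ =>
        let e := Z.max 0 (Z.log2 l0 - 27) in
        if minors3_pos (map (fun p => (Z.shiftr (fst p) e, Z.shiftr (snd p) e + 1)) V)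
        then blocks fuel' (skipn 64 l) else false
      end
    end
  end.

Definition BZ (a0 a1 a2 a3 a4 : Z) : Z :=
  - (a0 * a2 * a4) + a2 * a2 * a2 + a0 * (a3 * a3) + a1 * a1 * a4 - 2 * a1 * a2 * a3.

Fixpoint exact_check (n : nat) (l : list Z) : bool :=
  match n with
  | O => true
  | S n' =>
    match l with
    | a0 :: ((a1 :: a2 :: a3 :: a4 :: _) as t) =>
      if 0 <? BZ a0 a1 a2 a3 a4 then exact_check n' t else false
    | _ => true
    end
  end.

(** * Correctness of the power series passes *)

Lemma lag_sum_length (f q1 q2 : list Z) :
  q1 ++ rev q2 <> [] -> length (lag_sum f q1 q2) = length f.
Proof.
  revert q1 q2; induction f as [|b f IH]; intros q1 q2 H; simpl; [reflexivity|].
  destruct q1 as [|a q1].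
  - rewrite <- rev_alt; simpl in H; destruct (rev q2) as [|a q1]; [easy|].
    simpl; rewrite IH; [reflexivity|]. now destruct q1.
  - simpl; rewrite IH; [reflexivity|].
    simpl; intros E; apply app_eq_nil in E; destruct E as [_ E]; now apply app_eq_nil in E.
Qed.

Lemma lag_sum_nth (f q1 q2 : list Z) (i : nat) :
  q1 ++ rev q2 <> [] -> (i < length f)%nat ->
  nth i (lag_sum f q1 q2) 0 = nth i f 0 + nth i ((q1 ++ rev q2) ++ lag_sum f q1 q2) 0.
Proof.
  revert q1 q2 i; induction f as [|b f IH]; intros q1 q2 i H Hi; simpl in Hi; [lia|].
  simpl lag_sum; destruct q1 as [|a q1].
  - rewrite <- rev_alt; simpl in H; simpl app; destruct (rev q2) as [|a q1]; [easy|].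
    destruct i as [|i]; [simpl; lia|].
    simpl; rewrite IH by (try lia; now destruct q1).
    simpl rev; rewrite <- app_assoc; reflexivity.
  - destruct i as [|i]; [simpl; lia|].
    simpl; rewrite IH.
    + simpl rev; rewrite <- !app_assoc; reflexivity.
    + simpl; intros E; apply app_eq_nil in E; destruct E as [_ E]; now apply app_eq_nil in E.
    + lia.
Qed.

Definition represents (l : list Z) (F : nat -> nat) : Prop :=
  forall i, (i < length l)%nat -> nth i l 0 = Z.of_nat (F i).

(** [Y] is [F / (1 - x^k)] and [G] is [1 + x^k Y], both given by recurrences so that any counting
    function can be plugged in. Entry [j] of the output refers back to entry [j - k], hence the
    strong induction. *)
Lemma pass_represents (k : nat) (f : list Z) (F Y G : nat -> nat) :
  (0 < k)%nat ->
  (forall n, Y n = (F n + if (k <=? n)%nat then Y (n - k) else 0)%nat) ->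
  (forall n, G n = ((if (n =? 0)%nat then 1 else 0) + if (k <=? n)%nat then Y (n - k) else 0)%nat) ->
  represents f F -> represents (pass k f) G.
Proof.
  intros Hk HY HG Hf i Hi.
  assert (Hne : repeat 0 k ++ rev [] <> []) by (destruct k; [lia|easy]).
  assert (HL : forall i, (i < length f)%nat -> nth i (lag_sum f (repeat 0 k) []) 0 = Z.of_nat (Y i)).
  { intros j; induction j as [j IHj] using (well_founded_induction Wf_nat.lt_wf); intros Hj.
    rewrite lag_sum_nth, Hf by trivial; simpl rev; rewrite app_nil_r.
    rewrite HY, Nat2Z.inj_add; f_equal.
    destruct (Nat.leb_spec k j).
    - rewrite app_nth2, repeat_length by (rewrite repeat_length; lia). apply IHj; lia.
    - rewrite app_nth1, nth_repeat by (rewrite repeat_length; lia). reflexivity. }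
  unfold pass in *; rewrite HG.
  destruct i as [|i].
  - simpl; destruct (Nat.leb_spec k 0); [lia|reflexivity].
  - simpl nth; simpl length in Hi; rewrite length_app, repeat_length, lag_sum_length in Hi by trivial.
    destruct (Nat.leb_spec k (S i)).
    + rewrite app_nth2, repeat_length by (rewrite repeat_length; lia).
      rewrite HL by lia; replace (i - pred k)%nat with (S i - k)%nat by lia; reflexivity.
    + rewrite app_nth1, nth_repeat by (rewrite repeat_length; lia). reflexivity.
Qed.

Lemma pass_length (k : nat) (f : list Z) :
  (0 < k)%nat -> length (pass k f) = (k + length f)%nat.
Proof.
  intros Hk; unfold pass; simpl; rewrite length_app, repeat_length, lag_sum_length; [lia|].
  destruct k; [lia|easy].
Qed.

(** [T j] is the Horner tail that starts at part [j], and [Y j] is [T (j + 1)] divided by [1 - x^j];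
    the passes run from the innermost bracket outwards. *)
Lemma passes_represents (T Y : nat -> nat -> nat) (k : nat) (f : list Z) :
  (forall j n, (j < k)%nat ->
     Y (S j) n = (T (S (S j)) n + if (S j <=? n)%nat then Y (S j) (n - S j) else 0)%nat) ->
  (forall j n, (j < k)%nat ->
     T (S j) n = ((if (n =? 0)%nat then 1 else 0) +
                  if (S j <=? n)%nat then Y (S j) (n - S j) else 0)%nat) ->
  represents f (T (S k)) -> represents (passes k f) (T 1%nat).
Proof.
  revert f; induction k as [|k IH]; intros f HY HT Hf; simpl; [trivial|].
  apply IH; [intros; apply HY; lia|intros; apply HT; lia|].
  apply (pass_represents (S k) f (T (S (S k))) (Y (S k))); trivial; try lia; intros; auto.
Qed.

Lemma passes_length (k : nat) (f : list Z) :
  length (passes k f) = (k * (k + 1) / 2 + length f)%nat.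
Proof.
  revert f; induction k as [|k IH]; intros f; [reflexivity|].
  simpl passes; rewrite IH, pass_length by lia.
  replace (S k * (S k + 1))%nat with (k * (k + 1) + (k + 1) * 2)%nat by lia.
  rewrite Nat.div_add by lia; lia.
Qed.

(** * Soundness of the tests on the determinant *)

Definition window_pos (l : list Z) (i : nat) : Prop :=
  0 < BZ (nth i l 0) (nth (i + 1) l 0) (nth (i + 2) l 0) (nth (i + 3) l 0) (nth (i + 4) l 0).

Lemma exact_check_sound (n : nat) (l : list Z) (i : nat) :
  exact_check n l = true -> (i < n)%nat -> (i + 4 < length l)%nat -> window_pos l i.
Proof.
  revert l i; induction n as [|n IH]; intros l i H Hi Hl; [lia|].
  destruct l as [|a0 [|a1 [|a2 [|a3 [|a4 l]]]]]; simpl in Hl; try lia.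
  simpl in H; destruct (Z.ltb_spec 0 (BZ a0 a1 a2 a3 a4)) as [Hp|]; [|easy].
  destruct i as [|i]; [exact Hp|].
  apply (IH (a1 :: a2 :: a3 :: a4 :: l) i H); [lia|simpl; lia].
Qed.

Lemma shiftr_bounds (a s : Z) : 0 <= s ->
  Z.shiftr a s * 2 ^ s <= a < (Z.shiftr a s + 1) * 2 ^ s.
Proof.
  intros Hs; rewrite Z.shiftr_div_pow2 by trivial.
  assert (0 < 2 ^ s) by (apply Z.pow_pos_nonneg; lia).
  pose proof (Z.div_mod a (2 ^ s)); pose proof (Z.mod_pos_bound a (2 ^ s)); nia.
Qed.

Lemma nth_minors2 (F : list Z) (i : nat) :
  (i + 2 < length F)%nat ->
  nth i (minors2 F) (0, 0) =
    let a := nth i F 0 in let b := nth (i + 1) F 0 in let c := nth (i + 2) F 0 in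
    (b * b - a * c - (a + c + 1), b * b - a * c + (2 * b + 1)).
Proof.
  revert i; induction F as [|a F IH]; intros i Hi; simpl in Hi; [lia|].
  destruct F as [|b [|c F]]; simpl in Hi; try lia.
  destruct i as [|i]; [reflexivity|].
  change (minors2 (a :: b :: c :: F)) with
    ((b * b - a * c - (a + c + 1), b * b - a * c + (2 * b + 1)) :: minors2 (b :: c :: F)).
  simpl nth at 1; rewrite IH by (simpl; lia). reflexivity.
Qed.

Lemma length_minors2 (F : list Z) : length (minors2 F) = (length F - 2)%nat.
Proof.
  induction F as [|a [|b [|c F]] IH]; try reflexivity.
  change (minors2 (a :: b :: c :: F)) with
    ((b * b - a * c - (a + c + 1), b * b - a * c + (2 * b + 1)) :: minors2 (b :: c :: F)).
  simpl length in *; rewrite IH; lia.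
Qed.

Lemma minors3_pos_sound (V : list (Z * Z)) (i : nat) :
  minors3_pos V = true -> (i + 2 < length V)%nat ->
  let p0 := nth i V (0, 0) in let p1 := nth (i + 1) V (0, 0) in let p2 := nth (i + 2) V (0, 0) in
  0 <= fst p0 /\ 0 <= fst p1 /\ 0 <= fst p2 /\ snd p0 * snd p2 < fst p1 * fst p1.
Proof.
  revert i; induction V as [|[l0 h0] V IH]; intros i H Hi; simpl in Hi; [lia|].
  destruct V as [|[l1 h1] [|[l2 h2] V]]; simpl in Hi; try lia.
  change (minors3_pos ((l0, h0) :: (l1, h1) :: (l2, h2) :: V)) with
    (if (0 <=? l0) && (0 <=? l1) && (0 <=? l2) && (h0 * h2 <? l1 * l1)
     then minors3_pos ((l1, h1) :: (l2, h2) :: V) else false) in H.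
  destruct ((0 <=? l0) && (0 <=? l1) && (0 <=? l2) && (h0 * h2 <? l1 * l1)) eqn:E; [|easy].
  rewrite !andb_true_iff, !Z.leb_le, Z.ltb_lt in E.
  destruct i as [|i]; [simpl; tauto|].
  apply (IH i H); simpl; lia.
Qed.

(* Desnanot-Jacobi: [a2 BZ = u2^2 - u1 u3] for the 2x2 minors [u]. *)
Lemma BZ_pos_of_minors (a0 a1 a2 a3 a4 : Z) :
  0 < a2 ->
  (a1 * a1 - a0 * a2) * (a3 * a3 - a2 * a4) < (a2 * a2 - a1 * a3) * (a2 * a2 - a1 * a3) ->
  0 < BZ a0 a1 a2 a3 a4.
Proof.
  intros H2 H.
  assert (E : a2 * BZ a0 a1 a2 a3 a4 = (a2 * a2 - a1 * a3) * (a2 * a2 - a1 * a3)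
     - (a1 * a1 - a0 * a2) * (a3 * a3 - a2 * a4)) by (unfold BZ; ring).
  nia.
Qed.

(** Expanding [(fa + 1) (fc + 1)] and [(fb + 1)^2] produces the slack terms [fa + fc + 1] and
    [2 fb + 1] of [minors2]. *)
Lemma minor2_bounds (P a b c fa fb fc : Z) :
  0 < P -> 0 <= fa -> 0 <= fb -> 0 <= fc ->
  fa * P <= a < (fa + 1) * P -> fb * P <= b < (fb + 1) * P -> fc * P <= c < (fc + 1) * P ->
  (fb * fb - fa * fc - (fa + fc + 1)) * (P * P) <= b * b - a * c
    <= (fb * fb - fa * fc + (2 * fb + 1)) * (P * P).
Proof.
  intros HP Ha Hb Hc [A1 A2] [B1 B2] [C1 C2].
  assert (0 <= fa * P) by nia. assert (0 <= fb * P) by nia. assert (0 <= fc * P) by nia.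
  assert (fb * P * (fb * P) <= b * b) by (apply Z.mul_le_mono_nonneg; lia).
  assert (b * b <= (fb + 1) * P * ((fb + 1) * P)) by (apply Z.mul_le_mono_nonneg; lia).
  assert (fa * P * (fc * P) <= a * c) by (apply Z.mul_le_mono_nonneg; lia).
  assert (a * c <= (fa + 1) * P * ((fc + 1) * P)) by (apply Z.mul_le_mono_nonneg; lia).
  split; nia.
Qed.

Lemma minors_compare (M u1 u2 u3 l1 l2 l3 h1 h3 : Z) :
  0 < M -> 0 <= l1 -> 0 <= l2 -> 0 <= l3 -> h1 * h3 < l2 * l2 ->
  l1 * M <= u1 <= h1 * M -> l2 * M <= u2 -> l3 * M <= u3 <= h3 * M -> u1 * u3 < u2 * u2.
Proof.
  intros HM H1 H2 H3 H [A1 A2] B [C1 C2].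
  assert (0 <= l1 * M) by nia. assert (0 <= l2 * M) by nia. assert (0 <= l3 * M) by nia.
  assert (u1 * u3 <= h1 * M * (h3 * M)) by (apply Z.mul_le_mono_nonneg; lia).
  assert (l2 * M * (l2 * M) <= u2 * u2) by (apply Z.mul_le_mono_nonneg; lia).
  assert (h1 * h3 * (M * M) < l2 * l2 * (M * M)) by (apply Z.mul_lt_mono_pos_r; nia).
  nia.
Qed.

Lemma nth_firstn_lt (l : list Z) (n i : nat) : (i < n)%nat -> nth i (firstn n l) 0 = nth i l 0.
Proof. intros H; rewrite nth_firstn; destruct (Nat.ltb_spec i n); [reflexivity|lia]. Qed.

(** All minors are measured in the common unit [2^e * (2^s)^2], which cancels in the homogeneous
    inequality between them. *)
Lemma block_sound (l : list Z) (s e : Z) (i : nat) :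
  0 <= s -> 0 <= e -> (forall i, (i < length l)%nat -> 0 < nth i l 0) ->
  minors3_pos (map (fun p => (Z.shiftr (fst p) e, Z.shiftr (snd p) e + 1))
     (minors2 (map (fun x => Z.shiftr x s) (firstn 68 l)))) = true ->
  (i < 64)%nat -> (i + 4 < length l)%nat -> window_pos l i.
Proof.
  intros Hs He Hpos H Hi Hl.
  set (F := map (fun x => Z.shiftr x s) (firstn 68 l)) in *.
  set (V := map _ (minors2 F)) in *.
  assert (HlF : length F = Nat.min 68 (length l)) by (unfold F; rewrite length_map, length_firstn; reflexivity).
  assert (HlV : length V = (length F - 2)%nat) by (unfold V; rewrite length_map, length_minors2; reflexivity).
  assert (P : 0 < 2 ^ s) by (apply Z.pow_pos_nonneg; lia).
  assert (Q : 0 < 2 ^ e) by (apply Z.pow_pos_nonneg; lia).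
  assert (HF : forall j, (j < length F)%nat ->
     0 <= nth j F 0 /\ nth j F 0 * 2 ^ s <= nth j l 0 < (nth j F 0 + 1) * 2 ^ s).
  { intros j Hj.
    assert (E : nth j F 0 = Z.shiftr (nth j l 0) s).
    { rewrite (nth_indep F 0 ((fun x => Z.shiftr x s) 0)) by trivial.
      etransitivity; [exact (map_nth (fun x => Z.shiftr x s) (firstn 68 l) 0 j)|].
      now rewrite nth_firstn_lt by lia. }
    rewrite E.
    split; [|apply shiftr_bounds; trivial].
    apply Z.shiftr_nonneg. specialize (Hpos j ltac:(lia)); lia. }
  assert (HV : forall j, (j < length V)%nat ->
     fst (nth j V (0, 0)) * (2 ^ e * (2 ^ s * 2 ^ s))
       <= nth (j + 1) l 0 * nth (j + 1) l 0 - nth j l 0 * nth (j + 2) l 0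
       <= snd (nth j V (0, 0)) * (2 ^ e * (2 ^ s * 2 ^ s))).
  { intros j Hj.
    destruct (HF j ltac:(lia)) as [F0 G0]; destruct (HF (j + 1)%nat ltac:(lia)) as [F1 G1];
    destruct (HF (j + 2)%nat ltac:(lia)) as [F2 G2].
    pose proof (minor2_bounds (2 ^ s) _ _ _ _ _ _ P F0 F1 F2 G0 G1 G2) as [L U].
    rewrite (nth_indep V (0, 0) ((fun p => (Z.shiftr (fst p) e, Z.shiftr (snd p) e + 1)) (0, 0)))
      by trivial.
    unfold V; rewrite (map_nth (fun p => (Z.shiftr (fst p) e, Z.shiftr (snd p) e + 1)) (minors2 F) (0, 0)).
    rewrite nth_minors2 by lia; cbv zeta; cbn [fst snd].
    set (lo := _ - (_ + _ + 1)) in *; set (hi := _ + (2 * _ + 1)) in *.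
    pose proof (shiftr_bounds lo e He); pose proof (shiftr_bounds hi e He).
    set (S2 := 2 ^ s * 2 ^ s) in *; assert (0 < S2) by (unfold S2; nia).
    split; nia. }
  destruct (minors3_pos_sound V i H ltac:(lia)) as (N0 & N1 & N2 & N3).
  assert (W0 := HV i ltac:(lia)); assert (W1 := HV (i + 1)%nat ltac:(lia));
  assert (W2 := HV (i + 2)%nat ltac:(lia)).
  unfold window_pos; apply BZ_pos_of_minors; [apply Hpos; lia|].
  replace (i + 1 + 1)%nat with (i + 2)%nat in W1 by lia.
  replace (i + 1 + 2)%nat with (i + 3)%nat in W1 by lia.
  replace (i + 2 + 1)%nat with (i + 3)%nat in W2 by lia.
  replace (i + 2 + 2)%nat with (i + 4)%nat in W2 by lia.
  apply (minors_compare (2 ^ e * (2 ^ s * 2 ^ s)) _ _ _ _ _ _ _ _ ltac:(nia) N0 N1 N2 N3 W0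
           (proj1 W1) W2).
Qed.

Lemma blocks_sound (fuel : nat) (l : list Z) (i : nat) :
  (forall i, (i < length l)%nat -> 0 < nth i l 0) ->
  blocks fuel l = true -> (i + 4 < length l)%nat -> (i < 64 * fuel)%nat -> window_pos l i.
Proof.
  revert l i; induction fuel as [|fuel IH]; intros l i Hpos H Hl Hf; [lia|].
  destruct l as [|a l]; [simpl in Hl; lia|].
  cbn [blocks] in H.
  set (s := Z.max 0 (Z.log2 a - 48)) in H.
  destruct (minors2 (map (fun x => Z.shiftr x s) (firstn 68 (a :: l)))) as [|[l0 h0] V] eqn:EV.
  - pose proof (length_minors2 (map (fun x => Z.shiftr x s) (firstn 68 (a :: l)))) as E.
    rewrite EV, length_map, length_firstn in E; cbn [length] in *; lia.
  - cbv zeta in H; rewrite <- EV in H.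
    set (e := Z.max 0 (Z.log2 l0 - 27)) in H.
    destruct (minors3_pos _) eqn:E3 in H; [|easy].
    destruct (Nat.lt_ge_cases i 64) as [Hi|Hi].
    + apply (block_sound (a :: l) s e); trivial; unfold s, e; lia.
    + assert (Hsk : forall j, nth j (skipn 64 (a :: l)) 0 = nth (64 + j) (a :: l) 0)
        by (intros; apply nth_skipn).
      pose proof (IH (skipn 64 (a :: l)) (i - 64)%nat) as G.
      rewrite length_skipn in G.
      assert (G' := G ltac:(intros j Hj; rewrite Hsk; apply Hpos; lia) H ltac:(lia) ltac:(lia)).
      unfold window_pos in *; rewrite !Hsk in G'.
      replace (64 + (i - 64))%nat with i in G' by lia.
      replace (64 + (i - 64 + 1))%nat with (i + 1)%nat in G' by lia.
      replace (64 + (i - 64 + 2))%nat with (i + 2)%nat in G' by lia.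
      replace (64 + (i - 64 + 3))%nat with (i + 3)%nat in G' by lia.
      replace (64 + (i - 64 + 4))%nat with (i + 4)%nat in G' by lia.
      exact G'.
Qed.

(** The list starts at [271 = 272 - 1], the lowest index of the first window. The interval test is
    lossy even for [s = 0], so the 64 windows next to the lower limit are tested exactly. *)
Definition table_check (t : list Z) : bool :=
  let l := skipn 271 t in
  if exact_check 64 l then blocks 200 (skipn 64 l) else false.

(** Positivity of [F] allows division by the middle entry in the Desnanot-Jacobi identity. Large
    bounds are stated in [Z] because [nat] numerals are unary. *)
Lemma table_check_sound (t : list Z) (F : nat -> nat) (n : nat) :
  represents t F -> Z.of_nat (length t) = 10012 -> (forall m, Z.of_nat m < 10012 -> (0 < F m)%nat) ->
  table_check t = true -> (271 <= n)%nat -> Z.of_nat n < 10000 ->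
  0 < BZ (Z.of_nat (F n)) (Z.of_nat (F (n + 1)%nat)) (Z.of_nat (F (n + 2)%nat))
     (Z.of_nat (F (n + 3)%nat)) (Z.of_nat (F (n + 4)%nat)).
Proof.
  intros R L Hpos C Hn1 Hn2; unfold table_check in C; cbv zeta in C.
  set (l := skipn 271 t) in C.
  destruct (exact_check 64 l) eqn:E; [|easy].
  assert (Hsk : forall j, nth j l 0 = nth (271 + j) t 0) by (intros; apply nth_skipn).
  assert (Ll : length l = (length t - 271)%nat) by apply length_skipn.
  assert (W : window_pos l (n - 271)).
  { destruct (Nat.lt_ge_cases (n - 271) 64) as [Hi|Hi].
    - apply (exact_check_sound 64); trivial; lia.
    - assert (Hsk2 : forall j, nth j (skipn 64 l) 0 = nth (64 + j) l 0) by (intros; apply nth_skipn).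
      pose proof (blocks_sound 200 (skipn 64 l) (n - 271 - 64)) as G.
      rewrite length_skipn in G.
      assert (G' := G ltac:(intros j Hj; rewrite Hsk2, Hsk, R by lia; specialize (Hpos (271 + (64 + j))%nat ltac:(lia)); lia)
                C ltac:(lia) ltac:(lia)).
      unfold window_pos in *; rewrite !Hsk2 in G'.
      replace (64 + (n - 271 - 64))%nat with (n - 271)%nat in G' by lia.
      replace (64 + (n - 271 - 64 + 1))%nat with (n - 271 + 1)%nat in G' by lia.
      replace (64 + (n - 271 - 64 + 2))%nat with (n - 271 + 2)%nat in G' by lia.
      replace (64 + (n - 271 - 64 + 3))%nat with (n - 271 + 3)%nat in G' by lia.
      replace (64 + (n - 271 - 64 + 4))%nat with (n - 271 + 4)%nat in G' by lia.
      exact G'. }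
  unfold window_pos in W; rewrite !Hsk in W.
  replace (271 + (n - 271))%nat with n in W by lia.
  replace (271 + (n - 271 + 1))%nat with (n + 1)%nat in W by lia.
  replace (271 + (n - 271 + 2))%nat with (n + 2)%nat in W by lia.
  replace (271 + (n - 271 + 3))%nat with (n + 3)%nat in W by lia.
  replace (271 + (n - 271 + 4))%nat with (n + 4)%nat in W by lia.
  rewrite !R in W by lia. exact W.
Qed.

(** A partition of [m < 142 * 143 / 2 = 10153] into distinct parts has at most 141 parts. Starting
    from one coefficient, 141 passes give [1 + 141 * 142 / 2 = 10012] entries, enough for the index
    [9999 + 4]. *)
Definition qtable : list Z := passes 141 [1].

Lemma qtable_check : table_check qtable = true.
Proof. vm_cast_no_check (eq_refl true). Qed.

Lemma qtable_length : Z.of_nat (length qtable) = 10012.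
Proof.
  (* The closed form of the length avoids a second evaluation of the table. *)
  unfold qtable; rewrite passes_length, Nat2Z.inj_add, Nat2Z.inj_div, Nat2Z.inj_mul.
  reflexivity.
Qed.

Lemma qtable_window (T Y : nat -> nat -> nat) (n : nat) :
  (forall j n, (j < 141)%nat ->
     Y (S j) n = (T (S (S j)) n + if (S j <=? n)%nat then Y (S j) (n - S j) else 0)%nat) ->
  (forall j n, (j < 141)%nat ->
     T (S j) n = ((if (n =? 0)%nat then 1 else 0) +
                  if (S j <=? n)%nat then Y (S j) (n - S j) else 0)%nat) ->
  T 142%nat O = 1%nat ->
  (forall m, Z.of_nat m < 10012 -> (0 < T 1 m)%nat) ->
  (271 <= n)%nat -> Z.of_nat n < 10000 ->
  0 < BZ (Z.of_nat (T 1 n)%nat) (Z.of_nat (T 1 (n + 1)%nat)%nat) (Z.of_nat (T 1 (n + 2)%nat)%nat)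
     (Z.of_nat (T 1 (n + 3)%nat)%nat) (Z.of_nat (T 1 (n + 4)%nat)%nat).
Proof.
  intros HY HT H0 Hpos Hn1 Hn2.
  refine (table_check_sound qtable (T 1%nat) n _ qtable_length Hpos qtable_check Hn1 Hn2).
  apply (passes_represents T Y 141 [1] HY HT).
  intros i Hi; destruct i as [|i]; [simpl nth; now rewrite H0|simpl in Hi; lia].
Qed.

Local Close Scope Z_scope.
Local Open Scope R_scope.

(** * Fourier coefficients of the generating function *)

Fixpoint rsum (f : nat -> R) (J : nat) : R :=
  match J with O => 0 | S j => rsum f j + f j end.

Lemma rsum_le (f g : nat -> R) (J : nat) :
  (forall i, f i <= g i) -> rsum f J <= rsum g J.
Proof.
  intros H; induction J as [|J IH]; simpl; [lra|].
  specialize (H J); lra.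
Qed.

Lemma rsum_ext (f g : nat -> R) (J : nat) :
  (forall i, f i = g i) -> rsum f J = rsum g J.
Proof.
  intros H; induction J as [|J IH]; simpl; [reflexivity|].
  now rewrite IH, H.
Qed.

Lemma rsum_plus (f g : nat -> R) (J : nat) :
  rsum (fun i => f i + g i) J = rsum f J + rsum g J.
Proof. induction J as [|J IH]; simpl; [lra|]. rewrite IH; ring. Qed.

Lemma rsum_scal (c : R) (f : nat -> R) (J : nat) :
  rsum (fun i => c * f i) J = c * rsum f J.
Proof. induction J as [|J IH]; simpl; [lra|]. rewrite IH; ring. Qed.

Lemma rsum_ge0 (f : nat -> R) (J : nat) :
  (forall i, 0 <= f i) -> 0 <= rsum f J.
Proof.
  intros H; induction J as [|J IH]; simpl; [lra|].
  specialize (H J); lra.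
Qed.

Definition oddr (i : nat) : R := 2 * INR i + 1.
Definition rho (s : R) (i : nat) : R := exp (- (oddr i * s)).
Definition zfac (r p : R) : R := 2 * r * (1 - cos p) / (1 - r) ^ 2.
Definition arg1 (r p : R) : R := atan (r * sin p / (1 - r * cos p)).

(* [prod_(l odd, l < 2 J) (1 - e^{-l s}) / (1 - e^{-l (s - i t)}) = exp (- gexp s J t + i phase s J t)]. *)
Definition gexp (s : R) (J : nat) (t : R) : R :=
  rsum (fun i => ln (1 + zfac (rho s i) (oddr i * t)) / 2) J.
Definition wgt (s : R) (J : nat) (t : R) : R := exp (- gexp s J t).
Definition phase (s : R) (J : nat) (t : R) : R :=
  rsum (fun i => arg1 (rho s i) (oddr i * t)) J.
Definition fcoef (s : R) (J : nat) (m : Z) : R :=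
  RInt (fun t => wgt s J t * cos (phase s J t - IZR m * t)) (- PI) PI.

Lemma oddr_ge1 (i : nat) : 1 <= oddr i.
Proof. unfold oddr; pose proof (pos_INR i); lra. Qed.

Lemma rho_bounds (s : R) (i : nat) : 0 < s -> 0 < rho s i < 1.
Proof.
  intros Hs; unfold rho; split; [apply exp_pos|].
  rewrite <- exp_0; apply exp_increasing.
  pose proof (oddr_ge1 i); nra.
Qed.

Lemma zfac_ge0 (r p : R) : 0 < r < 1 -> 0 <= zfac r p.
Proof.
  intros Hr; unfold zfac.
  pose proof (COS_bound p).
  apply Rmult_le_pos; [nra|].
  apply Rlt_le, Rinv_0_lt_compat, pow_lt; lra.
Qed.

Lemma one_sub_rcos_pos (r p : R) : 0 < r < 1 -> 0 < 1 - r * cos p.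
Proof. intros Hr; pose proof (COS_bound p); nra. Qed.

Lemma gexp_ge0 (s : R) (J : nat) (t : R) : 0 < s -> 0 <= gexp s J t.
Proof.
  intros Hs; apply rsum_ge0; intros i.
  pose proof (zfac_ge0 (rho s i) (oddr i * t) (rho_bounds s i Hs)).
  assert (0 <= ln (1 + zfac (rho s i) (oddr i * t))); [|lra].
  rewrite <- ln_1; apply ln_le; lra.
Qed.

Lemma wgt_pos (s : R) (J : nat) (t : R) : 0 < wgt s J t.
Proof. apply exp_pos. Qed.

Lemma wgt_le1 (s : R) (J : nat) (t : R) : 0 < s -> wgt s J t <= 1.
Proof.
  intros Hs; unfold wgt; rewrite <- exp_0.
  pose proof (gexp_ge0 s J t Hs).
  destruct (Req_dec (gexp s J t) 0) as [->|]; [rewrite Ropp_0; lra|].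
  left; apply exp_increasing; lra.
Qed.

Lemma continuous_rsum (f : nat -> R -> R) (J : nat) (t : R) :
  (forall i, continuous (f i) t) -> continuous (fun x => rsum (fun i => f i x) J) t.
Proof.
  intros H; induction J as [|J IH]; simpl; [apply continuous_const|].
  now apply (continuous_plus (fun x => rsum (fun i => f i x) J) (f J)).
Qed.

Lemma continuous_gexp (s : R) (J : nat) (t : R) :
  0 < s -> continuous (gexp s J) t.
Proof.
  intros Hs; apply (continuous_rsum (fun i x => ln (1 + zfac (rho s i) (oddr i * x)) / 2)).
  intros i; apply (ex_derive_continuous (V := R_NormedModule)).
  pose proof (rho_bounds s i Hs) as Hr.
  pose proof (zfac_ge0 (rho s i) (oddr i * t) Hr) as Hz.
  unfold zfac in *; auto_derive.
  apply Rlt_le_trans with (1 + 0); [lra|]; apply Rplus_le_compat_l, Hz.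
Qed.

Lemma continuous_phase (s : R) (J : nat) (t : R) :
  0 < s -> continuous (phase s J) t.
Proof.
  intros Hs; apply (continuous_rsum (fun i x => arg1 (rho s i) (oddr i * x))).
  intros i; apply (ex_derive_continuous (V := R_NormedModule)).
  pose proof (rho_bounds s i Hs) as Hr.
  pose proof (one_sub_rcos_pos (rho s i) (oddr i * t) Hr) as Hz.
  unfold arg1; auto_derive; repeat split; trivial; lra.
Qed.

Lemma continuous_wgt (s : R) (J : nat) (t : R) :
  0 < s -> continuous (wgt s J) t.
Proof.
  intros Hs; unfold wgt.
  apply (continuous_comp (fun x => - gexp s J x) exp).
  - apply (continuous_opp (gexp s J)); now apply continuous_gexp.
  - apply continuous_exp.
Qed.

Lemma continuous_wgt_cos (s : R) (J : nat) (m t : R) :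
  0 < s -> continuous (fun x => wgt s J x * cos (phase s J x - m * x)) t.
Proof.
  intros Hs; apply (continuous_mult (wgt s J)); [now apply continuous_wgt|].
  apply (continuous_comp (fun x => phase s J x - m * x) cos).
  - apply (continuous_minus (phase s J)); [now apply continuous_phase|].
    apply (continuous_mult (fun _ => m)); [apply continuous_const|apply continuous_id].
  - apply continuous_cos.
Qed.

Lemma ex_RInt_all (f : R -> R) (a b : R) :
  (forall t, continuous f t) -> ex_RInt f a b.
Proof. intros H; apply (ex_RInt_continuous (V := R_CompleteNormedModule)); auto. Qed.

(* [1 - r e^{ip} = (1 - r) sqrt (1 + zfac r p) e^{-i arg1 r p}], real part after rotation by [x]. *)
Lemma euler_factor (r p x : R) :
  0 < r < 1 ->
  exp (- (ln (1 + zfac r p) / 2)) *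
    (cos (x + arg1 r p) - r * cos (x + arg1 r p + p)) = (1 - r) * cos x.
Proof.
  intros Hr.
  pose proof (zfac_ge0 r p Hr) as Hz.
  pose proof (one_sub_rcos_pos r p Hr) as Hc.
  set (u := 1 - r * cos p) in *.
  set (m := u ^ 2 + (r * sin p) ^ 2).
  assert (Hm : 0 < m) by (unfold m; nra).
  assert (Hsc := sin2_cos2 p); unfold Rsqr in Hsc.
  assert (Hzm : 1 + zfac r p = m / (1 - r) ^ 2).
  { unfold zfac, m, u; field_simplify_eq; [|lra].
    replace (sin p ^ 2) with (1 - cos p ^ 2) by (simpl; nra). ring. }
  assert (Hsq : 0 < sqrt m) by (apply sqrt_lt_R0; lra).
  assert (Hss : sqrt m * sqrt m = m) by (apply sqrt_sqrt; lra).
  assert (He : exp (- (ln (1 + zfac r p) / 2)) = (1 - r) / sqrt m).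
  { rewrite exp_Ropp.
    replace (exp (ln (1 + zfac r p) / 2)) with (sqrt m / (1 - r)).
    - field; split; lra.
    - symmetry; apply Rsqr_inj.
      + apply Rlt_le, exp_pos.
      + apply Rlt_le, Rdiv_lt_0_compat; lra.
      + unfold Rsqr; rewrite <- exp_plus.
        replace (ln (1 + zfac r p) / 2 + ln (1 + zfac r p) / 2) with (ln (1 + zfac r p)) by lra.
        rewrite exp_ln by lra. rewrite Hzm.
        replace (sqrt m / (1 - r) * (sqrt m / (1 - r))) with (sqrt m * sqrt m / (1 - r) ^ 2)
          by (field; lra).
        now rewrite Hss. }
  assert (Hat : sqrt (1 + (r * sin p / u)²) = sqrt m / u).
  { apply Rsqr_inj; [apply sqrt_pos| apply Rlt_le, Rdiv_lt_0_compat; lra|].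
    unfold Rsqr. rewrite sqrt_sqrt.
    - replace (sqrt m / u * (sqrt m / u)) with (sqrt m * sqrt m / u ^ 2) by (field; lra).
      rewrite Hss; unfold m; field; lra.
    - apply Rplus_le_le_0_compat; [lra|]. apply Rle_0_sqr. }
  assert (Hca : cos (arg1 r p) = u / sqrt m).
  { unfold arg1; fold u; rewrite cos_atan, Hat; field; split; lra. }
  assert (Hsa : sin (arg1 r p) = r * sin p / sqrt m).
  { unfold arg1; fold u; rewrite sin_atan, Hat; field; split; lra. }
  rewrite He, (cos_plus (x + arg1 r p) p), (cos_plus x), (sin_plus x), Hca, Hsa.
  replace ((1 - r) * cos x) with ((1 - r) * cos x * (m / (sqrt m * sqrt m)))
    by (rewrite Hss; field; lra).
  field_simplify_eq; [|lra].
  unfold m, u. ring_simplify.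
  ring.
Qed.

Definition oddz (i : nat) : Z := (2 * Z.of_nat i + 1)%Z.

Lemma IZR_oddz (i : nat) : IZR (oddz i) = oddr i.
Proof. unfold oddz, oddr; now rewrite plus_IZR, mult_IZR, <- INR_IZR_INZ. Qed.

(** Fourier form of [(1 - x^l) P_(J+1) = P_J], with [l] the next odd number: [euler_factor] is
    applied under the integral at every [t]. The index lies in [Z] because [m - l] may be
    negative. *)
Lemma fcoef_rec (s : R) (J : nat) (m : Z) :
  0 < s ->
  fcoef s (S J) m =
    (1 - rho s J) * fcoef s J m + rho s J * fcoef s (S J) (m - oddz J).
Proof.
  intros Hs; unfold fcoef.
  rewrite <- (RInt_scal (V := R_CompleteNormedModule) _ _ _ (1 - rho s J)),
          <- (RInt_scal (V := R_CompleteNormedModule) _ _ _ (rho s J));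
    try (apply ex_RInt_all; intros; now apply continuous_wgt_cos).
  rewrite <- (RInt_plus (V := R_CompleteNormedModule));
    try (apply (ex_RInt_scal (V := R_NormedModule)), ex_RInt_all; intros; now apply continuous_wgt_cos).
  apply RInt_ext; intros t _.
  unfold plus, scal; simpl; unfold mult; simpl.
  rewrite minus_IZR, IZR_oddz.
  pose proof (euler_factor (rho s J) (oddr J * t) (phase s J t - IZR m * t)
                (rho_bounds s J Hs)) as E.
  unfold wgt, gexp, phase in *; simpl.
  set (G := rsum (fun i => ln (1 + zfac (rho s i) (oddr i * t)) / 2) J) in *.
  set (P := rsum (fun i => arg1 (rho s i) (oddr i * t)) J) in *.
  set (L := ln (1 + zfac (rho s J) (oddr J * t)) / 2) in *.
  set (a := arg1 (rho s J) (oddr J * t)) in *.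
  replace (- (G + L)) with (- G + - L) by ring.
  rewrite exp_plus.
  replace (P - IZR m * t + a + oddr J * t) with (P + a - (IZR m - oddr J) * t) in E by ring.
  replace (P - IZR m * t + a) with (P + a - IZR m * t) in E by ring.
  transitivity (exp (- G) * ((1 - rho s J) * cos (P - IZR m * t))
     + rho s J * (exp (- G) * exp (- L) * cos (P + a - (IZR m - oddr J) * t))); [|ring].
  rewrite <- E; ring.
Qed.

Lemma fcoef_bound (s : R) (J : nat) (m : Z) :
  0 < s -> Rabs (fcoef s J m) <= 2 * PI.
Proof.
  intros Hs; pose proof PI_RGT_0.
  replace (2 * PI) with ((PI - (- PI)) * 1) by ring.
  apply abs_RInt_le_const; [lra| |].
  - apply ex_RInt_all; intros; now apply continuous_wgt_cos.
  - intros t _; rewrite Rabs_mult, (Rabs_pos_eq (wgt s J t)) by apply Rlt_le, wgt_pos.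
    pose proof (wgt_le1 s J t Hs); pose proof (wgt_pos s J t).
    assert (Rabs (cos (phase s J t - IZR m * t)) <= 1)
      by (apply Rabs_le, COS_bound).
    pose proof (Rabs_pos (cos (phase s J t - IZR m * t))).
    nra.
Qed.

Lemma fcoef_0 (s : R) (m : Z) :
  fcoef s 0 m = if Z.eq_dec m 0 then 2 * PI else 0.
Proof.
  unfold fcoef, wgt, gexp, phase; simpl.
  rewrite Ropp_0, exp_0.
  destruct (Z.eq_dec m 0) as [->|Hm].
  - rewrite (RInt_ext _ (fun _ => 1)).
    + rewrite RInt_const; change ((PI - - PI) * 1 = 2 * PI); ring.
    + intros x _; change (1 * cos (0 - 0 * x) = 1); rewrite Rmult_0_l, Rminus_0_r, cos_0; ring.
  - assert (Hm' : IZR m <> 0) by (now apply not_0_IZR).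
    apply is_RInt_unique.
    assert (H : is_RInt (fun t => 1 * cos (0 - IZR m * t)) (- PI) PI
       (minus ((fun t => sin (IZR m * t) / IZR m) PI)
              ((fun t => sin (IZR m * t) / IZR m) (- PI)))).
    { apply (is_RInt_derive (V := R_CompleteNormedModule) (fun t => sin (IZR m * t) / IZR m)).
      - intros x _; auto_derive; [trivial|].
        rewrite Rminus_0_l, cos_neg; field; trivial.
      - intros x _; apply (ex_derive_continuous (V := R_NormedModule)); auto_derive; trivial. }
    assert (Hs0 : sin (IZR m * PI) = 0) by (apply sin_eq_0_1; now exists m).
    unfold minus, plus, opp in H; simpl in H.
    replace (IZR m * - PI) with (- (IZR m * PI)) in H by ring.
    rewrite sin_neg, Hs0 in H.
    replace (0 / IZR m + - (- 0 / IZR m)) with 0 in H by (field; trivial).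
    exact H.
Qed.

Lemma eq0_of_geometric_bound (x C r : R) :
  0 < r < 1 -> (forall k : nat, Rabs x <= r ^ k * C) -> x = 0.
Proof.
  intros Hr H.
  destruct (Req_dec x 0) as [|Hx]; [trivial|exfalso].
  assert (Hax : 0 < Rabs x) by (now apply Rabs_pos_lt).
  assert (HC : 0 < C) by (specialize (H O); simpl in H; lra).
  destruct (pow_lt_1_zero r ltac:(rewrite Rabs_pos_eq; lra) (Rabs x / C)
              ltac:(apply Rdiv_lt_0_compat; lra)) as [k Hk].
  specialize (Hk k (le_n k)); specialize (H k).
  rewrite Rabs_pos_eq in Hk by (apply pow_le; lra).
  apply (Rmult_lt_compat_r C) in Hk; [|lra].
  unfold Rdiv in Hk; rewrite Rmult_assoc, Rinv_l in Hk by lra. lra.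
Qed.

(** For a negative index the first term of the recurrence vanishes by induction on [J], so each step
    down by [l] contributes a factor [rho < 1]; as [fcoef] is bounded by [2 PI], the value is 0.
    This replaces an appeal to analyticity. *)
Lemma fcoef_neg (s : R) (J : nat) (m : Z) :
  0 < s -> (m < 0)%Z -> fcoef s J m = 0.
Proof.
  intros Hs; revert m; induction J as [|J IH]; intros m Hm.
  - rewrite fcoef_0; destruct (Z.eq_dec m 0); [lia|trivial].
  - apply (eq0_of_geometric_bound _ (2 * PI) (rho s J)); [now apply rho_bounds|].
    intros k; revert m Hm; induction k as [|k IHk]; intros m Hm.
    + simpl; rewrite Rmult_1_l; now apply fcoef_bound.
    + rewrite fcoef_rec, (IH m Hm), Rmult_0_r, Rplus_0_l by trivial.
      rewrite Rabs_mult, Rabs_pos_eq by (apply Rlt_le, rho_bounds; trivial).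
      simpl; rewrite Rmult_assoc; apply Rmult_le_compat_l.
      * apply Rlt_le, rho_bounds; trivial.
      * apply IHk; unfold oddz; lia.
Qed.

Fixpoint rprod (f : nat -> R) (J : nat) : R :=
  match J with O => 1 | S j => rprod f j * f j end.

Lemma rprod_pos (f : nat -> R) (J : nat) : (forall i, 0 < f i) -> 0 < rprod f J.
Proof.
  intros H; induction J as [|J IH]; simpl; [lra|].
  now apply Rmult_lt_0_compat.
Qed.

(** Divided by the tilting factor, [fcoef] obeys the recurrence of [o] with the same initial values;
    [fcoef_neg] supplies the zero when [m < 2 J + 1]. *)
Lemma fcoef_eq (o : nat -> nat -> R) (s : R) (J : nat) (m : nat) :
  0 < s ->
  (forall m, o O m = if (m =? 0)%nat then 1 else 0) ->
  (forall J m, o (S J) m =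
     o J m + if (2 * J + 1 <=? m)%nat then o (S J) (m - (2 * J + 1))%nat else 0) ->
  fcoef s J (Z.of_nat m) =
    2 * PI * rprod (fun i => 1 - rho s i) J * exp (- (INR m * s)) * o J m.
Proof.
  intros Hs H0 HS; revert m; induction J as [|J IH]; intros m.
  - rewrite fcoef_0, H0; simpl.
    destruct (Z.eq_dec (Z.of_nat m) 0), (Nat.eqb_spec m 0); try lia; [subst m|ring].
    simpl; rewrite Rmult_0_l, Ropp_0, exp_0; ring.
  - induction m as [m IHm] using (well_founded_induction Wf_nat.lt_wf).
    rewrite fcoef_rec, IH, HS by trivial; simpl rprod.
    destruct (Nat.leb_spec (2 * J + 1) m) as [Hle|Hgt].
    + replace (Z.of_nat m - oddz J)%Z with (Z.of_nat (m - (2 * J + 1)))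
        by (unfold oddz; lia).
      rewrite IHm by lia; simpl rprod.
      replace (exp (- (INR m * s))) with
        (rho s J * exp (- (INR (m - (2 * J + 1)) * s))); [ring|].
      unfold rho, oddr; rewrite <- exp_plus, minus_INR, plus_INR, mult_INR by trivial.
      simpl; f_equal; ring.
    + rewrite fcoef_neg by (trivial; unfold oddz; lia). ring.
Qed.

(** * Bounds for a single factor *)

(** The tool behind the elementary inequalities below: Taylor bounds follow by descending through
    derivatives. *)
Lemma nonneg_of_deriv (f df : R -> R) (x : R) :
  0 <= x ->
  (forall t, 0 <= t <= x -> is_derive f t (df t)) ->
  (forall t, 0 <= t <= x -> 0 <= df t) ->
  0 <= f 0 -> 0 <= f x.
Proof.
  intros Hx Hd Hp H0.
  destruct (MVT_gen f 0 x df) as [c [Hc E]].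
  - intros t Ht; rewrite Rmin_left, Rmax_right in Ht by lra; apply Hd; lra.
  - intros t Ht; rewrite Rmin_left, Rmax_right in Ht by lra.
    apply continuity_pt_filterlim, (ex_derive_continuous (V := R_NormedModule)).
    exists (df t); apply Hd; lra.
  - rewrite Rmin_left, Rmax_right in Hc by lra.
    specialize (Hp c Hc); nra.
Qed.

Lemma sin_le_id (t : R) : 0 <= t -> sin t <= t.
Proof.
  intros Ht; assert (0 <= t - sin t); [|lra].
  apply (nonneg_of_deriv (fun t => t - sin t) (fun t => 1 - cos t)); trivial.
  - intros u _; auto_derive; trivial; ring.
  - intros u _; pose proof (COS_bound u); lra.
  - rewrite sin_0; lra.
Qed.

Lemma one_sub_cos_le (t : R) : 0 <= t -> 1 - cos t <= t ^ 2 / 2.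
Proof.
  intros Ht; assert (0 <= t ^ 2 / 2 - (1 - cos t)); [|lra].
  apply (nonneg_of_deriv (fun t => t ^ 2 / 2 - (1 - cos t)) (fun t => t - sin t)); trivial.
  - intros u _; auto_derive; trivial; field.
  - intros u Hu; pose proof (sin_le_id u); lra.
  - rewrite cos_0; lra.
Qed.

Lemma sin_ge_cubic (t : R) : 0 <= t -> t - t ^ 3 / 6 <= sin t.
Proof.
  intros Ht; assert (0 <= sin t - (t - t ^ 3 / 6)); [|lra].
  apply (nonneg_of_deriv (fun t => sin t - (t - t ^ 3 / 6)) (fun t => t ^ 2 / 2 - (1 - cos t))); trivial.
  - intros u _; auto_derive; trivial; field.
  - intros u Hu; pose proof (one_sub_cos_le u); lra.
  - rewrite sin_0; lra.
Qed.

Lemma one_sub_cos_ge (t : R) : 0 <= t -> t ^ 2 / 2 - t ^ 4 / 24 <= 1 - cos t.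
Proof.
  intros Ht; assert (0 <= (1 - cos t) - (t ^ 2 / 2 - t ^ 4 / 24)); [|lra].
  apply (nonneg_of_deriv (fun t => (1 - cos t) - (t ^ 2 / 2 - t ^ 4 / 24))
           (fun t => sin t - (t - t ^ 3 / 6))); trivial.
  - intros u _; auto_derive; trivial; field.
  - intros u Hu; pose proof (sin_ge_cubic u); lra.
  - rewrite cos_0; lra.
Qed.

Lemma ln1p_le (z : R) : 0 <= z -> ln (1 + z) <= z.
Proof.
  intros Hz; destruct (Req_dec z 0) as [->|].
  - rewrite Rplus_0_r, ln_1; lra.
  - left; rewrite <- (ln_exp z) at 2; apply ln_increasing; [lra|].
    apply exp_ineq1; lra.
Qed.

Lemma ln1p_ge (z : R) : 0 <= z -> z - z ^ 2 / 2 <= ln (1 + z).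
Proof.
  intros Hz; assert (0 <= ln (1 + z) - (z - z ^ 2 / 2)); [|lra].
  apply (nonneg_of_deriv (fun t => ln (1 + t) - (t - t ^ 2 / 2)) (fun t => t ^ 2 / (1 + t))); trivial.
  - intros u Hu; auto_derive; [lra|]; field; lra.
  - intros u Hu; apply Rmult_le_pos; [nra|]. apply Rlt_le, Rinv_0_lt_compat; lra.
  - rewrite Rplus_0_r, ln_1; lra.
Qed.

(* Cumulants of orders 2, 3 and 4 of the geometric law with parameter [r]. *)
Definition geo2 (r : R) : R := r / (1 - r) ^ 2.
Definition geo3 (r : R) : R := r * (1 + r) / (1 - r) ^ 3.
Definition geo4 (r : R) : R := geo2 r * (1 + 6 * geo2 r).

Lemma zfac_geo2 (r p : R) : zfac r p = 2 * geo2 r * (1 - cos p).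
Proof. unfold zfac, geo2, Rdiv; ring. Qed.

Lemma geo2_pos (r : R) : 0 < r < 1 -> 0 < geo2 r.
Proof. intros Hr; apply Rdiv_lt_0_compat; [lra|]; apply pow_lt; lra. Qed.

Lemma factor_le (r p : R) :
  0 < r < 1 -> 0 <= p -> ln (1 + zfac r p) / 2 <= geo2 r * p ^ 2 / 2.
Proof.
  intros Hr Hp.
  pose proof (ln1p_le _ (zfac_ge0 r p Hr)); rewrite zfac_geo2 in *.
  pose proof (one_sub_cos_le p Hp); pose proof (geo2_pos r Hr); nra.
Qed.

(** The error is exactly a fourth cumulant term: with [g = geo2 r], the cosine costs [g p^4 / 24]
    and the logarithm [g^2 p^4 / 4 = 6 g^2 p^4 / 24]. *)
Lemma factor_ge (r p : R) :
  0 < r < 1 -> 0 <= p ->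
  geo2 r * p ^ 2 / 2 - geo4 r * p ^ 4 / 24 <= ln (1 + zfac r p) / 2.
Proof.
  intros Hr Hp.
  pose proof (ln1p_ge _ (zfac_ge0 r p Hr)); rewrite zfac_geo2 in *.
  pose proof (one_sub_cos_le p Hp); pose proof (one_sub_cos_ge p Hp).
  pose proof (geo2_pos r Hr); pose proof (COS_bound p).
  unfold geo4; set (g := geo2 r) in *; set (c := 1 - cos p) in *.
  assert (Hc : c ^ 2 <= (p ^ 2 / 2) ^ 2) by (apply pow_incr; unfold c in *; lra).
  assert (g ^ 2 * c ^ 2 <= g ^ 2 * (p ^ 2 / 2) ^ 2) by (apply Rmult_le_compat_l; [nra|trivial]).
  assert (g * (p ^ 2 / 2 - p ^ 4 / 24) <= g * c) by (apply Rmult_le_compat_l; lra).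
  nra.
Qed.

(** The left side is the first term of [sum_(m >= 1) r^m (1 - cos (m p)) / m], whose terms are all
    nonnegative. Instead of the series, the proof uses that the difference vanishes at [r = 0] and
    is nondecreasing in [r]. *)
Lemma factor_far (r p : R) :
  0 < r < 1 -> r * (1 - cos p) <= ln (1 + zfac r p) / 2.
Proof.
  intros Hr; pose proof (COS_bound p) as Hc.
  set (c := 1 - cos p).
  assert (Hm : forall t, 0 <= t <= r -> 0 < (1 - t) ^ 2 + 2 * t * c)
    by (intros t Ht; unfold c; nra).
  assert (E : ln (1 + zfac r p) = ln ((1 - r) ^ 2 + 2 * r * c) - 2 * ln (1 - r)).
  { replace (1 + zfac r p) with (((1 - r) ^ 2 + 2 * r * c) * / (1 - r) ^ 2)
      by (unfold zfac, c; field; lra).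
    assert (0 < (1 - r) ^ 2) by (apply pow_lt; lra).
    rewrite ln_mult, ln_Rinv by (trivial; try apply Hm; try apply Rinv_0_lt_compat; lra).
    replace ((1 - r) ^ 2) with ((1 - r) * (1 - r)) at 2 by ring.
    rewrite ln_mult by lra; ring. }
  assert (0 <= ln ((1 - r) ^ 2 + 2 * r * c) - 2 * ln (1 - r) - 2 * r * c); [|lra].
  apply (nonneg_of_deriv
    (fun t => ln ((1 - t) ^ 2 + 2 * t * c) - 2 * ln (1 - t) - 2 * t * c)
    (fun t => 2 * c * ((1 + t) - (1 - t) * ((1 - t) ^ 2 + 2 * t * c))
              / (((1 - t) ^ 2 + 2 * t * c) * (1 - t)))); [lra| | |].
  - intros t Ht; specialize (Hm t Ht); auto_derive.
    + simpl in Hm; split; [exact Hm|lra].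
    + field; split; [lra|]. simpl in Hm; lra.
  - intros t Ht; specialize (Hm t Ht).
    apply Rmult_le_pos; [|apply Rlt_le, Rinv_0_lt_compat, Rmult_lt_0_compat; lra].
    apply Rmult_le_pos; [unfold c; lra|].
    assert ((1 - t) ^ 2 + 2 * t * c <= (1 + t) ^ 2) by (unfold c; nra).
    assert ((1 - t) * ((1 - t) ^ 2 + 2 * t * c) <= (1 - t) * (1 + t) ^ 2)
      by (apply Rmult_le_compat_l; lra).
    assert ((1 - t) * (1 + t) ^ 2 <= 1 + t) by nra.
    lra.
  - replace ((1 - 0) ^ 2 + 2 * 0 * c) with 1 by ring. rewrite Rminus_0_r, ln_1; lra.
Qed.

Lemma arg1_deriv (r p : R) :
  0 < r < 1 ->
  is_derive (fun x => x * (r / (1 - r)) - arg1 r x) p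
    (r * (1 + r) * (1 - cos p) / (((1 - r) ^ 2 + 2 * r * (1 - cos p)) * (1 - r))).
Proof.
  intros Hr; pose proof (COS_bound p) as Hc.
  pose proof (one_sub_rcos_pos r p Hr) as Hu.
  assert (Hsc := sin2_cos2 p); unfold Rsqr in Hsc.
  unfold arg1; auto_derive; [lra|].
  field_simplify_eq.
  - replace (sin p ^ 2) with (1 - cos p ^ 2) by (simpl; lra).
    replace (sin p ^ 4) with ((1 - cos p ^ 2) ^ 2) by (replace (1 - cos p ^ 2) with (sin p ^ 2) by (simpl; lra); ring).
    ring.
  - repeat split; try lra; nra.
Qed.

(** The difference has a nonnegative derivative; with the denominator lowered to [(1 - r)^3] and
    [1 - cos p] raised to [p^2 / 2], that derivative becomes [geo3 r * p^2 / 2]. Hence the deviation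
    from the linear phase has a known sign and at most the size of the third cumulant term. *)
Lemma arg1_bounds (r p : R) :
  0 < r < 1 -> 0 <= p ->
  0 <= p * (r / (1 - r)) - arg1 r p <= geo3 r * p ^ 3 / 6.
Proof.
  intros Hr Hp.
  assert (H0 : 0 * (r / (1 - r)) - arg1 r 0 = 0)
    by (unfold arg1; rewrite sin_0, Rmult_0_r; unfold Rdiv; rewrite !Rmult_0_l, atan_0; ring).
  assert (Hm : forall t, 0 < ((1 - r) ^ 2 + 2 * r * (1 - cos t)) * (1 - r)).
  { intros t; pose proof (COS_bound t). apply Rmult_lt_0_compat; [nra|lra]. }
  split.
  - apply (nonneg_of_deriv (fun x => x * (r / (1 - r)) - arg1 r x)
      (fun p => r * (1 + r) * (1 - cos p) / (((1 - r) ^ 2 + 2 * r * (1 - cos p)) * (1 - r)))); trivial.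
    + intros t _; now apply arg1_deriv.
    + intros t _; pose proof (COS_bound t); apply Rmult_le_pos; [nra|].
      apply Rlt_le, Rinv_0_lt_compat, Hm.
    + rewrite H0; lra.
  - assert (0 <= geo3 r * p ^ 3 / 6 - (p * (r / (1 - r)) - arg1 r p)); [|lra].
    apply (nonneg_of_deriv (fun x => geo3 r * x ^ 3 / 6 - (x * (r / (1 - r)) - arg1 r x))
      (fun p => geo3 r * p ^ 2 / 2 -
        r * (1 + r) * (1 - cos p) / (((1 - r) ^ 2 + 2 * r * (1 - cos p)) * (1 - r)))); trivial.
    + intros t _; apply (is_derive_minus (V := R_NormedModule)); [|now apply arg1_deriv].
      auto_derive; trivial; field.
    + intros t Ht; pose proof (COS_bound t).
      assert (r * (1 + r) * (1 - cos t) / (((1 - r) ^ 2 + 2 * r * (1 - cos t)) * (1 - r))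
              <= r * (1 + r) * (t ^ 2 / 2) / (1 - r) ^ 3).
      { apply Rmult_le_compat.
        - nra.
        - apply Rlt_le, Rinv_0_lt_compat, Hm.
        - apply Rmult_le_compat_l; [nra|]. apply one_sub_cos_le; lra.
        - apply Rinv_le_contravar; [apply pow_lt; lra|].
          replace ((1 - r) ^ 3) with ((1 - r) ^ 2 * (1 - r)) by ring.
          apply Rmult_le_compat_r; nra. }
      replace (geo3 r * t ^ 2 / 2) with (r * (1 + r) * (t ^ 2 / 2) / (1 - r) ^ 3); [lra|].
      unfold geo3; field; lra.
    + rewrite H0; lra.
Qed.

(** * Cumulants *)

Lemma cosh_ge1 (s : R) : 1 <= cosh s.
Proof.
  unfold cosh; pose proof (exp_pos s); pose proof (exp_pos (- s)).
  assert (exp s * exp (- s) = 1) by (rewrite <- exp_plus, Rplus_opp_r; apply exp_0).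
  set (a := exp s) in *; set (b := exp (- s)) in *.
  assert (4 <= (a + b) * (a + b)) by (pose proof (Rle_0_sqr (a - b)); unfold Rsqr in *; lra).
  nra.
Qed.

Lemma sinh_ge (s : R) : 0 <= s -> s <= sinh s.
Proof.
  intros Hs; assert (0 <= sinh s - s); [|lra].
  apply (nonneg_of_deriv (fun t => sinh t - t) (fun t => cosh t - 1)); trivial.
  - intros t _; unfold sinh, cosh; auto_derive; trivial; field.
  - intros t _; pose proof (cosh_ge1 t); lra.
  - rewrite sinh_0; lra.
Qed.

Lemma cosh_le6 (s : R) : 0 <= s <= 1 -> cosh s <= 6.
Proof.
  intros Hs; unfold cosh.
  assert (exp s <= exp 1) by (destruct (Req_dec s 1) as [->|]; [lra|left; apply exp_increasing; lra]).
  assert (exp (- s) <= exp 0) by (destruct (Req_dec s 0) as [->|]; [rewrite Ropp_0; lra|left; apply exp_increasing; lra]).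
  rewrite exp_0 in *; pose proof exp_le_3; lra.
Qed.

Lemma sinh_le (s : R) : 0 <= s <= 1 -> sinh s <= s + s ^ 3.
Proof.
  intros Hs; assert (0 <= s + s ^ 3 - sinh s); [|lra].
  apply (nonneg_of_deriv (fun t => t + t ^ 3 - sinh t) (fun t => 1 + 3 * t ^ 2 - cosh t)); [lra| | |].
  - intros t _; unfold sinh, cosh; auto_derive; trivial; field.
  - intros t Ht.
    apply (nonneg_of_deriv (fun t => 1 + 3 * t ^ 2 - cosh t) (fun t => 6 * t - sinh t)); [lra| | |].
    + intros u _; unfold sinh, cosh; auto_derive; trivial; field.
    + intros u Hu.
      apply (nonneg_of_deriv (fun t => 6 * t - sinh t) (fun t => 6 - cosh t)); [lra| | |].
      * intros v _; unfold sinh, cosh; auto_derive; trivial; field.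
      * intros v Hv; pose proof (cosh_le6 v); lra.
      * rewrite sinh_0; lra.
    + rewrite cosh_0; lra.
  - rewrite sinh_0; lra.
Qed.

Definition lsum (j : nat) (s : R) (J : nat) : R :=
  rsum (fun i => oddr i ^ j * exp (- (oddr i * s))) J.

(* [csch_sum j s] is the full series [lsum j s] summed over all odd numbers. *)
Definition csch_sum (j : nat) (s : R) : R :=
  match j with
  | O => / (2 * sinh s)
  | 1%nat => cosh s / (2 * sinh s ^ 2)
  | 2%nat => / sinh s ^ 3 + / (2 * sinh s)
  | 3%nat => cosh s * (sinh s ^ 2 + 6) / (2 * sinh s ^ 4)
  | _ => / (2 * sinh s) + 10 / sinh s ^ 3 + 12 / sinh s ^ 5
  end.

(** The series [sum_(l odd) (t + l)^j e^{-l s}], expanded by the binomial theorem; for [t = 2 J],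
    its product with [e^{-t s}] is the tail of [lsum j s J]. *)
Definition csch_rem (j : nat) (s t : R) : R :=
  match j with
  | O => csch_sum 0 s
  | 1%nat => t * csch_sum 0 s + csch_sum 1 s
  | 2%nat => t ^ 2 * csch_sum 0 s + 2 * t * csch_sum 1 s + csch_sum 2 s
  | 3%nat => t ^ 3 * csch_sum 0 s + 3 * t ^ 2 * csch_sum 1 s + 3 * t * csch_sum 2 s + csch_sum 3 s
  | _ => t ^ 4 * csch_sum 0 s + 4 * t ^ 3 * csch_sum 1 s + 6 * t ^ 2 * csch_sum 2 s
         + 4 * t * csch_sum 3 s + csch_sum 4 s
  end.

(** Removing the term [l = 1] from the tail leaves the tail at [t + 2]; this drives the telescoping
    in [lsum_eq]. *)
Lemma csch_rem_step (j : nat) (s t : R) :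
  0 < s -> (j <= 4)%nat ->
  csch_rem j s t - exp (- s) * exp (- s) * csch_rem j s (t + 2) = (t + 1) ^ j * exp (- s).
Proof.
  intros Hs Hj.
  assert (H1 : 1 < exp s) by (rewrite <- exp_0; apply exp_increasing; lra).
  assert (H2 : exp s ^ 2 - 1 <> 0) by nra.
  do 5 (destruct j as [|j]; [simpl csch_rem; simpl csch_sum; unfold sinh, cosh;
    rewrite exp_Ropp; simpl pow; field; repeat split; try lra; nra|]).
  lia.
Qed.

Lemma csch_sum_pos (j : nat) (s : R) : 0 < s -> 0 < csch_sum j s.
Proof.
  intros Hs; pose proof (sinh_ge s ltac:(lra)) as Hy; pose proof (cosh_ge1 s) as Hc.
  assert (H3 : 0 < / sinh s ^ 3) by (apply Rinv_0_lt_compat, pow_lt; lra).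
  assert (H5 : 0 < / sinh s ^ 5) by (apply Rinv_0_lt_compat, pow_lt; lra).
  assert (H1 : 0 < / (2 * sinh s)) by (apply Rinv_0_lt_compat; lra).
  destruct j as [|[|[|[|j]]]]; unfold csch_sum; trivial.
  - apply Rdiv_lt_0_compat; [lra|]; apply Rmult_lt_0_compat; [lra|apply pow_lt; lra].
  - lra.
  - apply Rdiv_lt_0_compat; [nra|]; apply Rmult_lt_0_compat; [lra|apply pow_lt; lra].
  - unfold Rdiv; lra.
Qed.

Lemma csch_rem_ge0 (j : nat) (s t : R) : 0 < s -> 0 <= t -> 0 <= csch_rem j s t.
Proof.
  intros Hs Ht.
  pose proof (csch_sum_pos 0 s Hs); pose proof (csch_sum_pos 1 s Hs);
  pose proof (csch_sum_pos 2 s Hs); pose proof (csch_sum_pos 3 s Hs);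
  pose proof (csch_sum_pos 4 s Hs).
  assert (0 <= t ^ 2) by (apply pow_le; trivial).
  assert (0 <= t ^ 3) by (apply pow_le; trivial).
  assert (0 <= t ^ 4) by (apply pow_le; trivial).
  destruct j as [|[|[|[|j]]]]; unfold csch_rem;
    repeat match goal with
    | |- 0 <= _ + _ => apply Rplus_le_le_0_compat
    | |- 0 <= _ * _ => apply Rmult_le_pos
    end; lra.
Qed.

Lemma lsum_eq (j : nat) (s : R) (J : nat) :
  0 < s -> (j <= 4)%nat ->
  lsum j s J = csch_sum j s - exp (- (2 * INR J * s)) * csch_rem j s (2 * INR J).
Proof.
  intros Hs Hj; induction J as [|J IH]; unfold lsum in *.
  - simpl INR; simpl rsum; rewrite Rmult_0_r, Rmult_0_l, Ropp_0, exp_0.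
    do 5 (destruct j as [|j]; [unfold csch_rem; ring|]). lia.
  - simpl rsum; rewrite IH, S_INR; unfold oddr.
    pose proof (csch_rem_step j s (2 * INR J) Hs Hj) as E.
    replace (- ((2 * INR J + 1) * s)) with (- (2 * INR J * s) + - s) by ring.
    replace (- (2 * (INR J + 1) * s)) with (- (2 * INR J * s) + (- s + - s)) by ring.
    replace (2 * (INR J + 1)) with (2 * INR J + 2) by ring.
    rewrite !exp_plus.
    replace ((2 * INR J + 1) ^ j * (exp (- (2 * INR J * s)) * exp (- s))) with
      (exp (- (2 * INR J * s)) * ((2 * INR J + 1) ^ j * exp (- s))) by ring.
    rewrite <- E; ring.
Qed.

Lemma lsum_le_csch (j : nat) (s : R) (J : nat) :
  0 < s -> (j <= 4)%nat -> lsum j s J <= csch_sum j s.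
Proof.
  intros Hs Hj; rewrite lsum_eq by trivial.
  pose proof (exp_pos (- (2 * INR J * s))).
  pose proof (csch_rem_ge0 j s (2 * INR J) Hs ltac:(pose proof (pos_INR J); lra)).
  nra.
Qed.

Lemma inv_pow_le (s y : R) (k : nat) : 0 < s <= y -> / y ^ k <= / s ^ k.
Proof. intros H; apply Rinv_le_contravar; [apply pow_lt; lra|apply pow_incr; lra]. Qed.

Lemma cosh_le_sinh (s : R) : cosh s <= 1 + sinh s ^ 2 / 2.
Proof.
  assert (cosh s ^ 2 = 1 + sinh s ^ 2).
  { unfold cosh, sinh.
    assert (exp s * exp (- s) = 1) by (rewrite <- exp_plus, Rplus_opp_r; apply exp_0). nra. }
  pose proof (cosh_ge1 s); nra.
Qed.

(** The leading terms are [j! / (2 s^(j+1))]. After [cosh s <= 1 + sinh^2 s / 2] only constants and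
    negative powers of [sinh s >= s] remain. *)
Lemma csch_sum_le (s : R) :
  0 < s ->
  csch_sum 0 s <= / s / 2 /\ csch_sum 1 s <= / s ^ 2 / 2 + / 4 /\
  csch_sum 2 s <= / s ^ 3 + / s / 2 /\ csch_sum 3 s <= 3 * / s ^ 4 + 2 * / s ^ 2 + / 4 /\
  csch_sum 4 s <= / s / 2 + 10 * / s ^ 3 + 12 * / s ^ 5.
Proof.
  intros Hs; pose proof (sinh_ge s ltac:(lra)) as Hy; pose proof (cosh_le_sinh s) as Hc.
  set (y := sinh s) in *.
  assert (H1 := inv_pow_le s y 1 (conj Hs Hy)); rewrite !pow_1 in H1.
  assert (H2 := inv_pow_le s y 2 (conj Hs Hy)).
  assert (H3 := inv_pow_le s y 3 (conj Hs Hy)).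
  assert (H4 := inv_pow_le s y 4 (conj Hs Hy)).
  assert (H5 := inv_pow_le s y 5 (conj Hs Hy)).
  assert (P2 : 0 < / y ^ 2) by (apply Rinv_0_lt_compat, pow_lt; lra).
  assert (P4 : 0 < / y ^ 4) by (apply Rinv_0_lt_compat, pow_lt; lra).
  unfold csch_sum; fold y; repeat split.
  - rewrite Rinv_mult; lra.
  - replace (cosh s / (2 * y ^ 2)) with (cosh s * / y ^ 2 / 2) by (field; lra).
    assert (cosh s * / y ^ 2 <= (1 + y ^ 2 / 2) * / y ^ 2) by (apply Rmult_le_compat_r; lra).
    replace ((1 + y ^ 2 / 2) * / y ^ 2) with (/ y ^ 2 + / 2) in * by (field; lra). lra.
  - rewrite Rinv_mult; lra.
  - replace (cosh s * (y ^ 2 + 6) / (2 * y ^ 4)) with (cosh s * ((y ^ 2 + 6) * / y ^ 4 / 2)) by (field; lra).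
    assert (cosh s * ((y ^ 2 + 6) * / y ^ 4 / 2) <= (1 + y ^ 2 / 2) * ((y ^ 2 + 6) * / y ^ 4 / 2)).
    { apply Rmult_le_compat_r; [|lra].
      apply Rmult_le_pos; [apply Rmult_le_pos; [nra|lra]|lra]. }
    replace ((1 + y ^ 2 / 2) * ((y ^ 2 + 6) * / y ^ 4 / 2))
      with (3 * / y ^ 4 + 2 * / y ^ 2 + / 4) in * by (field; lra). lra.
  - unfold Rdiv; rewrite Rinv_mult; lra.
Qed.

Lemma exp_ge_pow (n : nat) (x : R) : 0 <= x -> x ^ n / INR (fact n) <= exp x.
Proof.
  revert x; induction n as [|n IH]; intros x Hx.
  - simpl; pose proof (exp_ineq1_le x); lra.
  - assert (Hf : 0 < INR (fact (S n))) by (apply lt_0_INR, lt_O_fact).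
    assert (Hf' : 0 < INR (fact n)) by (apply lt_0_INR, lt_O_fact).
    assert (0 <= exp x - x ^ S n / INR (fact (S n))); [|lra].
    apply (nonneg_of_deriv (fun x => exp x - x ^ S n / INR (fact (S n)))
             (fun x => exp x - x ^ n / INR (fact n))); trivial.
    + intros t _.
      apply (is_derive_minus (V := R_NormedModule)); [apply is_derive_exp|].
      apply is_derive_ext with (fun x => / INR (fact (S n)) * x ^ S n); [intros; apply Rmult_comm|].
      replace (t ^ n / INR (fact n)) with (/ INR (fact (S n)) * (INR (S n) * 1 * t ^ pred (S n))).
      * apply (is_derive_scal (fun x => x ^ S n)).
        apply (is_derive_pow (fun x => x)); apply (is_derive_id (K := R_AbsRing)).
      * simpl pred; rewrite fact_simpl, mult_INR.
        assert (INR (S n) <> 0) by (apply not_0_INR; lia).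
        field; split; lra.
    + intros t Ht; pose proof (IH t ltac:(lra)); lra.
    + rewrite exp_0; simpl (0 ^ S n); rewrite Rmult_0_l; unfold Rdiv; lra.
Qed.

(** The range [s <= 1/36] permits use at [s], [2 s] and [3 s] when [s <= 1/108]. As [2 J s >= 2000]
    makes the tails tiny and [sinh s <= 1.001 s], a loss of half a percent covers everything. *)
Lemma lsum_ge (s : R) (J : nat) :
  0 < s <= / 36 -> 1000 <= INR J * s ->
  / s / 2 * 0.995 <= lsum 0 s J /\ / s ^ 2 / 2 * 0.995 <= lsum 1 s J /\
  / s ^ 3 * 0.995 <= lsum 2 s J.
Proof.
  intros Hs HJ; set (T := 2 * INR J * s).
  assert (HT : 2000 <= T) by (unfold T; lra).
  assert (HX : exp (- T) * T ^ 4 <= 24).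
  { pose proof (exp_ge_pow 4 T ltac:(lra)) as H4; simpl fact in H4; rewrite exp_Ropp.
    replace (INR 24) with 24 in H4 by (simpl INR; lra).
    pose proof (exp_pos T).
    apply Rmult_le_reg_l with (exp T); [trivial|].
    rewrite <- Rmult_assoc, Rinv_r by lra. lra. }
  pose proof (exp_pos (- T)) as HX0.
  set (X := exp (- T)) in *.
  assert (HX2 : X * T ^ 2 <= 1 / 100000).
  { assert (X * T ^ 2 * 4000000 <= X * T ^ 2 * T ^ 2) by (apply Rmult_le_compat_l; nra). nra. }
  assert (HX1 : X * T <= 1 / 100000) by nra.
  assert (HX3 : X <= 1 / 100000) by nra.
  destruct (csch_sum_le s ltac:(lra)) as (U0 & U1 & U2 & _ & _).
  pose proof (sinh_ge s ltac:(lra)) as Hy; pose proof (sinh_le s ltac:(lra)) as Hy'.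
  pose proof (cosh_ge1 s) as Hc.
  assert (Hy2 : sinh s <= s * 1.001) by nra.
  assert (Hi : 0 < / s) by (apply Rinv_0_lt_compat; lra).
  assert (His : / s * s = 1) by (apply Rinv_l; lra).
  assert (Hi1 : / s * 0.9990009 <= / sinh s).
  { replace (/ s * 0.9990009) with (/ (s * (/ 0.9990009))) by (field; lra).
    apply Rinv_le_contravar; [lra|]. lra. }
  rewrite !lsum_eq by (lra || lia); fold T; fold X.
  assert (ET : 2 * INR J = T * / s) by (unfold T; field; lra).
  rewrite ET; unfold csch_rem.
  pose proof (csch_sum_pos 0 s ltac:(lra)); pose proof (csch_sum_pos 1 s ltac:(lra));
  pose proof (csch_sum_pos 2 s ltac:(lra)).
  assert (B0 : / s / 2 * 0.999 <= csch_sum 0 s).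
  { unfold csch_sum; rewrite Rinv_mult; lra. }
  assert (Hi2 : / s ^ 2 * 0.998 <= / sinh s ^ 2).
  { rewrite <- !pow_inv; nra. }
  assert (Hi3 : / s ^ 3 * 0.997 <= / sinh s ^ 3).
  { rewrite <- !pow_inv.
    apply Rle_trans with ((/ s * 0.9990009) ^ 3); [|apply pow_incr; lra].
    assert (0 < (/ s) ^ 3) by (apply pow_lt; trivial).
    replace ((/ s * 0.9990009) ^ 3) with ((/ s) ^ 3 * 0.9990009 ^ 3) by ring.
    apply Rmult_le_compat_l; lra. }
  assert (B1 : / s ^ 2 / 2 * 0.998 <= csch_sum 1 s).
  { unfold csch_sum. replace (cosh s / (2 * sinh s ^ 2)) with (cosh s * (/ sinh s ^ 2 / 2)) by (field; lra).
    assert (0 < / s ^ 2) by (apply Rinv_0_lt_compat, pow_lt; lra). nra. }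
  assert (B2 : / s ^ 3 * 0.997 <= csch_sum 2 s).
  { unfold csch_sum. assert (0 < / (2 * sinh s)) by (apply Rinv_0_lt_compat; lra). lra. }
  rewrite <- !pow_inv in *.
  set (i := / s) in *.
  assert (Hi36 : 36 <= i) by nra.
  repeat split.
  - nra.
  - assert (X * (T * i * csch_sum 0 s) <= i ^ 2 * (1 / 100000)).
    { apply Rle_trans with (X * T * (i * (i / 2))); [|nra].
      replace (X * (T * i * csch_sum 0 s)) with (X * T * (i * csch_sum 0 s)) by ring.
      apply Rmult_le_compat_l; nra. }
    assert (X * csch_sum 1 s <= i ^ 2 * (1 / 100000)).
    { apply Rle_trans with (1 / 100000 * (i ^ 2 / 2 + / 4)); [|nra].
      apply Rmult_le_compat; lra. }
    nra.
  - assert (i ^ 2 >= 36) by nra.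
    assert (0 < i ^ 3) by (apply pow_lt; lra).
    assert (X * ((T * i) ^ 2 * csch_sum 0 s) <= i ^ 3 * (1 / 100000)).
    { apply Rle_trans with (X * T ^ 2 * (i ^ 2 * (i / 2))).
      - replace (X * ((T * i) ^ 2 * csch_sum 0 s)) with (X * T ^ 2 * (i ^ 2 * csch_sum 0 s)) by ring.
        apply Rmult_le_compat_l; [nra|]. apply Rmult_le_compat_l; lra.
      - apply Rle_trans with (1 / 100000 * (i ^ 2 * (i / 2))); [|lra].
        apply Rmult_le_compat_r; nra. }
    assert (X * (2 * (T * i) * csch_sum 1 s) <= i ^ 3 * (1 / 10000)).
    { replace (X * (2 * (T * i) * csch_sum 1 s)) with (X * T * (2 * i * csch_sum 1 s)) by ring.
      apply Rle_trans with (1 / 100000 * (2 * i * (i ^ 2 / 2 + / 4))); [|nra].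
      apply Rmult_le_compat; try nra. }
    assert (X * csch_sum 2 s <= i ^ 3 * (1 / 10000)).
    { apply Rle_trans with (1 / 100000 * (i ^ 3 + i / 2)); [|nra].
      apply Rmult_le_compat; lra. }
    nra.
Qed.

(** * Bounds for the first four cumulants *)

Definition geo1 (r : R) : R := r / (1 - r).
Definition cum1 (s : R) (J : nat) : R := rsum (fun i => oddr i * geo1 (rho s i)) J.
Definition cum2 (s : R) (J : nat) : R := rsum (fun i => oddr i ^ 2 * geo2 (rho s i)) J.
Definition cum3 (s : R) (J : nat) : R := rsum (fun i => oddr i ^ 3 * geo3 (rho s i)) J.
Definition cum4 (s : R) (J : nat) : R := rsum (fun i => oddr i ^ 4 * geo4 (rho s i)) J.

Lemma exp_neg_lt1 (x : R) : 0 < x -> 0 < exp (- x) < 1.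
Proof.
  intros Hx; split; [apply exp_pos|].
  rewrite <- exp_0; apply exp_increasing; lra.
Qed.

Lemma geo1_exp (x : R) : 0 < x -> geo1 (exp (- x)) = / (exp x - 1).
Proof.
  intros Hx; unfold geo1; rewrite exp_Ropp.
  assert (1 < exp x) by (rewrite <- exp_0; apply exp_increasing; lra).
  field; lra.
Qed.

Lemma geo1_le (x : R) : 0 < x -> geo1 (exp (- x)) <= / x.
Proof.
  intros Hx; rewrite geo1_exp by trivial.
  pose proof (exp_ineq1 x ltac:(lra)); apply Rinv_le_contravar; lra.
Qed.

Lemma geo1_ge (x : R) : 0 < x -> / x - / 2 <= geo1 (exp (- x)).
Proof.
  intros Hx; rewrite geo1_exp by trivial.
  assert (H1 : 1 < exp x) by (rewrite <- exp_0; apply exp_increasing; lra).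
  assert (H : 0 <= 2 + x - (2 - x) * exp x).
  { apply (nonneg_of_deriv (fun x => 2 + x - (2 - x) * exp x) (fun x => 1 - (1 - x) * exp x)); [lra| | |].
    - intros t _; auto_derive; trivial; ring.
    - intros t Ht.
      apply (nonneg_of_deriv (fun x => 1 - (1 - x) * exp x) (fun x => x * exp x)); [lra| | |].
      + intros u _; auto_derive; trivial; ring.
      + intros u Hu; pose proof (exp_pos u); nra.
      + rewrite exp_0; lra.
    - rewrite exp_0; lra. }
  apply Rmult_le_reg_l with (2 * x * (exp x - 1)); [nra|].
  replace (2 * x * (exp x - 1) * (/ x - / 2)) with ((2 - x) * (exp x - 1)) by (field; lra).
  replace (2 * x * (exp x - 1) * / (exp x - 1)) with (2 * x) by (field; lra).
  lra.
Qed.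

Lemma geo2_geo1 (r : R) : r < 1 -> geo2 r = geo1 r * (1 + geo1 r).
Proof. intros Hr; unfold geo2, geo1; field; lra. Qed.

(** [geo2 (exp (- x))] equals [1 / (2 sinh (x / 2))^2]. *)
Lemma geo2_le (x : R) : 0 < x -> geo2 (exp (- x)) <= / x ^ 2.
Proof.
  intros Hx; pose proof (sinh_ge (x / 2) ltac:(lra)) as H; unfold sinh in H.
  unfold geo2; set (a := exp (x / 2)) in *; set (b := exp (- (x / 2))) in *.
  assert (Hab : a * b = 1) by (unfold a, b; rewrite <- exp_plus, Rplus_opp_r; apply exp_0).
  assert (Hb : 0 < b) by apply exp_pos.
  replace (exp (- x)) with (b * b) by (unfold b; rewrite <- exp_plus; f_equal; lra).
  assert (Hba : 1 - b * b = b * (a - b)) by (ring_simplify; nra).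
  assert (0 < a - b) by lra.
  rewrite Hba; replace (b * b / (b * (a - b)) ^ 2) with (/ (a - b) ^ 2) by (field; split; lra).
  apply inv_pow_le; lra.
Qed.

(** With [g = geo1 (exp (- x))], this is [g (1 + g) = (g + 1/2)^2 - 1/4] together with
    [g + 1/2 >= 1/x]. *)
Lemma geo2_ge (x : R) : 0 < x -> / x ^ 2 - / 4 <= geo2 (exp (- x)).
Proof.
  intros Hx; pose proof (exp_neg_lt1 x Hx) as Hr.
  rewrite geo2_geo1 by lra.
  pose proof (geo1_ge x Hx) as H.
  assert (0 < / x) by (apply Rinv_0_lt_compat; lra).
  rewrite <- pow_inv; nra.
Qed.

Lemma geo3_geo2 (r : R) : r < 1 -> geo3 r = geo2 r * (1 + 2 * geo1 r).
Proof. intros Hr; unfold geo3, geo2, geo1; field; lra. Qed.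

Lemma geo1_pos (r : R) : 0 < r < 1 -> 0 < geo1 r.
Proof. intros Hr; apply Rdiv_lt_0_compat; lra. Qed.

Lemma pow_step (i : R) (k : nat) : 108 <= i -> i ^ k <= i ^ S k / 108.
Proof.
  intros Hi; simpl; assert (0 < i ^ k) by (apply pow_lt; lra). nra.
Qed.

Section Cumulants.
Variables (s : R) (J : nat).
Hypothesis Hs : 0 < s <= / 108.

Let term_facts (i : nat) :
  let l := oddr i in let r := exp (- (l * s)) in
  1 <= l /\ 0 < r < 1 /\ exp (- (l * (2 * s))) = r ^ 2 /\ exp (- (l * (3 * s))) = r ^ 3 /\
  geo1 r <= / l * / s /\ geo2 r <= (/ l * / s) ^ 2 /\ 0 < / l /\ l * / l = 1 /\ 0 < / s.
Proof.
  intros l r.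
  assert (Hl : 1 <= l) by apply oddr_ge1.
  assert (Hx : 0 < l * s) by nra.
  repeat split; trivial.
  - apply exp_pos.
  - apply exp_neg_lt1; trivial.
  - unfold r; simpl; rewrite Rmult_1_r, <- exp_plus; f_equal; ring.
  - unfold r; simpl; rewrite Rmult_1_r, <- !exp_plus; f_equal; ring.
  - rewrite <- Rinv_mult; apply geo1_le; trivial.
  - rewrite <- Rinv_mult, pow_inv; apply geo2_le; trivial.
  - apply Rinv_0_lt_compat; lra.
  - apply Rinv_r; lra.
  - apply Rinv_0_lt_compat; lra.
Qed.

(** Three terms of the geometric series are kept exactly; the crude [geo1 r <= 1 / (l s)] enters
    only behind the damping factor [r^3], where it cancels a power of [l] and leaves a lower [lsum]
    at [3 s]. The other cumulants follow the same pattern. *)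
Lemma cum1_le_lsum :
  cum1 s J <= lsum 1 s J + lsum 1 (2 * s) J + lsum 1 (3 * s) J + / s * lsum 0 (3 * s) J.
Proof.
  unfold cum1, lsum; rewrite <- !rsum_scal, <- !rsum_plus; apply rsum_le; intros i.
  destruct (term_facts i) as (Hl & Hr & E2 & E3 & U1 & U2 & Hil & Hll & His).
  unfold rho; rewrite E2, E3; set (l := oddr i) in *; set (r := exp (- (l * s))) in *.
  replace (geo1 r) with (r + r ^ 2 + r ^ 3 + r ^ 3 * geo1 r) by (unfold geo1; field; lra).
  assert (0 < r ^ 3) by (apply pow_lt; lra).
  assert (l * (r ^ 3 * geo1 r) <= l * (r ^ 3 * (/ l * / s))).
  { apply Rmult_le_compat_l; [lra|]. apply Rmult_le_compat_l; lra. }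
  replace (l * (r ^ 3 * (/ l * / s))) with (/ s * r ^ 3) in * by (field; lra).
  simpl pow in *; lra.
Qed.

Lemma cum2_le_lsum :
  cum2 s J <= lsum 2 s J + 2 * lsum 2 (2 * s) J + 3 * lsum 2 (3 * s) J
    + 3 * / s * lsum 1 (3 * s) J + (/ s) ^ 2 * lsum 0 (3 * s) J.
Proof.
  unfold cum2, lsum; rewrite <- !rsum_scal, <- !rsum_plus; apply rsum_le; intros i.
  destruct (term_facts i) as (Hl & Hr & E2 & E3 & U1 & U2 & Hil & Hll & His).
  unfold rho; rewrite E2, E3; set (l := oddr i) in *; set (r := exp (- (l * s))) in *.
  replace (geo2 r) with (r + 2 * r ^ 2 + 3 * r ^ 3 + r ^ 3 * (3 * geo1 r + geo2 r))
    by (unfold geo1, geo2; field; lra).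
  assert (0 < r ^ 3) by (apply pow_lt; lra).
  assert (l ^ 2 * (r ^ 3 * (3 * geo1 r + geo2 r)) <=
          l ^ 2 * (r ^ 3 * (3 * (/ l * / s) + (/ l * / s) ^ 2))).
  { apply Rmult_le_compat_l; [nra|]. apply Rmult_le_compat_l; lra. }
  replace (l ^ 2 * (r ^ 3 * (3 * (/ l * / s) + (/ l * / s) ^ 2)))
    with (3 * / s * (l ^ 1 * r ^ 3) + (/ s) ^ 2 * (l ^ 0 * r ^ 3)) in * by (field; lra).
  lra.
Qed.

(** The coefficient 5/4 is [3 - 7/4]: the lower bounds [1/x - 1/2] for [geo1] and [1/x^2 - 1/4] for
    [geo2] cost [3/2 + 1/4] copies of the term at [3 s]. *)
Lemma cum2_ge_lsum :
  lsum 2 s J + 2 * lsum 2 (2 * s) J + 5 / 4 * lsum 2 (3 * s) J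
    + 3 * / s * lsum 1 (3 * s) J + (/ s) ^ 2 * lsum 0 (3 * s) J <= cum2 s J.
Proof.
  unfold cum2, lsum; rewrite <- !rsum_scal, <- !rsum_plus; apply rsum_le; intros i.
  destruct (term_facts i) as (Hl & Hr & E2 & E3 & U1 & U2 & Hil & Hll & His).
  assert (Hx : 0 < oddr i * s) by nra.
  pose proof (geo1_ge _ Hx) as G1; pose proof (geo2_ge _ Hx) as G2.
  unfold rho; rewrite E2, E3; set (l := oddr i) in *; set (r := exp (- (l * s))) in *.
  rewrite Rinv_mult in G1; rewrite <- pow_inv, Rinv_mult in G2.
  replace (geo2 r) with (r + 2 * r ^ 2 + 3 * r ^ 3 + r ^ 3 * (3 * geo1 r + geo2 r))
    by (unfold geo1, geo2; field; lra).
  assert (0 < r ^ 3) by (apply pow_lt; lra).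
  assert (l ^ 2 * (r ^ 3 * (3 * (/ l * / s - / 2) + ((/ l * / s) ^ 2 - / 4))) <=
          l ^ 2 * (r ^ 3 * (3 * geo1 r + geo2 r))).
  { apply Rmult_le_compat_l; [nra|]. apply Rmult_le_compat_l; lra. }
  replace (l ^ 2 * (r ^ 3 * (3 * (/ l * / s - / 2) + ((/ l * / s) ^ 2 - / 4))))
    with (3 * / s * (l ^ 1 * r ^ 3) + (/ s) ^ 2 * (l ^ 0 * r ^ 3) - 7 / 4 * (l ^ 2 * r ^ 3)) in *
    by (field; lra).
  lra.
Qed.

(** [geo3 r] is [sum m^2 r^m], and its part beyond [m = 3] is [r^3 sum (m + 3)^2 r^m], hence the
    weights 9, 6, 1. The coefficients 9, 7, 2 come from [9 v + 6 v^2 + v^2 (1 + 2 v)] with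
    [v = 1 / (l s)]. *)
Lemma cum3_le_lsum :
  cum3 s J <= lsum 3 s J + 4 * lsum 3 (2 * s) J + 9 * lsum 3 (3 * s) J
    + 9 * / s * lsum 2 (3 * s) J + 7 * (/ s) ^ 2 * lsum 1 (3 * s) J
    + 2 * (/ s) ^ 3 * lsum 0 (3 * s) J.
Proof.
  unfold cum3, lsum; rewrite <- !rsum_scal, <- !rsum_plus; apply rsum_le; intros i.
  destruct (term_facts i) as (Hl & Hr & E2 & E3 & U1 & U2 & Hil & Hll & His).
  unfold rho; rewrite E2, E3; set (l := oddr i) in *; set (r := exp (- (l * s))) in *.
  replace (geo3 r) with (r + 4 * r ^ 2 + 9 * r ^ 3 + r ^ 3 * (9 * geo1 r + 6 * geo2 r + geo3 r))
    by (unfold geo1, geo2, geo3; field; lra).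
  rewrite (geo3_geo2 r) by lra.
  pose proof (geo1_pos r Hr); pose proof (geo2_pos r Hr).
  assert (0 < r ^ 3) by (apply pow_lt; lra).
  set (v := / l * / s) in *.
  assert (geo2 r * (1 + 2 * geo1 r) <= v ^ 2 * (1 + 2 * v)) by (apply Rmult_le_compat; lra).
  assert (l ^ 3 * (r ^ 3 * (9 * geo1 r + 6 * geo2 r + geo2 r * (1 + 2 * geo1 r))) <=
          l ^ 3 * (r ^ 3 * (9 * v + 6 * v ^ 2 + v ^ 2 * (1 + 2 * v)))).
  { apply Rmult_le_compat_l; [apply pow_le; lra|]. apply Rmult_le_compat_l; lra. }
  replace (l ^ 3 * (r ^ 3 * (9 * v + 6 * v ^ 2 + v ^ 2 * (1 + 2 * v))))
    with (9 * / s * (l ^ 2 * r ^ 3) + 7 * (/ s) ^ 2 * (l ^ 1 * r ^ 3)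
          + 2 * (/ s) ^ 3 * (l ^ 0 * r ^ 3)) in * by (unfold v; field; lra).
  lra.
Qed.

Lemma cum4_le_lsum :
  cum4 s J <= lsum 4 s J + 8 * lsum 4 (2 * s) J + 27 * lsum 4 (3 * s) J
    + 27 * / s * lsum 3 (3 * s) J + 37 * (/ s) ^ 2 * lsum 2 (3 * s) J
    + 18 * (/ s) ^ 3 * lsum 1 (3 * s) J + 6 * (/ s) ^ 4 * lsum 0 (3 * s) J.
Proof.
  unfold cum4, lsum; rewrite <- !rsum_scal, <- !rsum_plus; apply rsum_le; intros i.
  destruct (term_facts i) as (Hl & Hr & E2 & E3 & U1 & U2 & Hil & Hll & His).
  unfold rho; rewrite E2, E3; set (l := oddr i) in *; set (r := exp (- (l * s))) in *.
  replace (geo4 r) with (r + 8 * r ^ 2 + 27 * r ^ 3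
      + r ^ 3 * (27 * geo1 r + 27 * geo2 r + 9 * geo3 r + geo4 r))
    by (unfold geo4, geo1, geo2, geo3; field; lra).
  rewrite (geo3_geo2 r) by lra; unfold geo4.
  pose proof (geo1_pos r Hr); pose proof (geo2_pos r Hr).
  assert (0 < r ^ 3) by (apply pow_lt; lra).
  set (v := / l * / s) in *.
  assert (geo2 r * (1 + 2 * geo1 r) <= v ^ 2 * (1 + 2 * v)) by (apply Rmult_le_compat; lra).
  assert (geo2 r * (1 + 6 * geo2 r) <= v ^ 2 * (1 + 6 * v ^ 2)) by (apply Rmult_le_compat; lra).
  assert (l ^ 4 * (r ^ 3 * (27 * geo1 r + 27 * geo2 r + 9 * (geo2 r * (1 + 2 * geo1 r))
            + geo2 r * (1 + 6 * geo2 r))) <=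
          l ^ 4 * (r ^ 3 * (27 * v + 27 * v ^ 2 + 9 * (v ^ 2 * (1 + 2 * v)) + v ^ 2 * (1 + 6 * v ^ 2)))).
  { apply Rmult_le_compat_l; [apply pow_le; lra|]. apply Rmult_le_compat_l; lra. }
  replace (l ^ 4 * (r ^ 3 * (27 * v + 27 * v ^ 2 + 9 * (v ^ 2 * (1 + 2 * v)) + v ^ 2 * (1 + 6 * v ^ 2))))
    with (27 * / s * (l ^ 3 * r ^ 3) + 37 * (/ s) ^ 2 * (l ^ 2 * r ^ 3)
          + 18 * (/ s) ^ 3 * (l ^ 1 * r ^ 3) + 6 * (/ s) ^ 4 * (l ^ 0 * r ^ 3)) in *
    by (unfold v; field; lra).
  lra.
Qed.

Let inv_mult_pow (k : nat) (c : R) : 0 < c -> / (c * s) ^ k = (/ c) ^ k * (/ s) ^ k.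
Proof. intros Hc; rewrite <- pow_inv, Rinv_mult; apply Rpow_mult_distr. Qed.

(** The limiting constants as [s] tends to 0 are [pi^2/12], [pi^2/6], [pi^2/2] and [2 pi^2], about
    0.822, 1.645, 4.93 and 19.74. *)
Lemma cum_upper :
  cum1 s J <= 0.85 * (/ s) ^ 2 /\ cum2 s J <= 1.7 * (/ s) ^ 3 /\
  cum3 s J <= 5.16 * (/ s) ^ 4 /\ cum4 s J <= 20.8 * (/ s) ^ 5.
Proof.
  pose proof cum1_le_lsum as C1; pose proof cum2_le_lsum as C2;
  pose proof cum3_le_lsum as C3; pose proof cum4_le_lsum as C4.
  destruct (csch_sum_le s ltac:(lra)) as (U10 & U11 & U12 & U13 & U14).
  destruct (csch_sum_le (2 * s) ltac:(lra)) as (U20 & U21 & U22 & U23 & U24).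
  destruct (csch_sum_le (3 * s) ltac:(lra)) as (U30 & U31 & U32 & U33 & U34).
  pose proof (lsum_le_csch 0 (3 * s) J ltac:(lra) ltac:(lia)) as L30.
  pose proof (lsum_le_csch 1 s J ltac:(lra) ltac:(lia)) as L11.
  pose proof (lsum_le_csch 1 (2 * s) J ltac:(lra) ltac:(lia)) as L21.
  pose proof (lsum_le_csch 1 (3 * s) J ltac:(lra) ltac:(lia)) as L31.
  pose proof (lsum_le_csch 2 s J ltac:(lra) ltac:(lia)) as L12.
  pose proof (lsum_le_csch 2 (2 * s) J ltac:(lra) ltac:(lia)) as L22.
  pose proof (lsum_le_csch 2 (3 * s) J ltac:(lra) ltac:(lia)) as L32.
  pose proof (lsum_le_csch 3 s J ltac:(lra) ltac:(lia)) as L13.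
  pose proof (lsum_le_csch 3 (2 * s) J ltac:(lra) ltac:(lia)) as L23.
  pose proof (lsum_le_csch 3 (3 * s) J ltac:(lra) ltac:(lia)) as L33.
  pose proof (lsum_le_csch 4 s J ltac:(lra) ltac:(lia)) as L14.
  pose proof (lsum_le_csch 4 (2 * s) J ltac:(lra) ltac:(lia)) as L24.
  pose proof (lsum_le_csch 4 (3 * s) J ltac:(lra) ltac:(lia)) as L34.
  rewrite ?inv_mult_pow, ?Rinv_mult in * by lra; rewrite <- ?pow_inv in *.
  assert (Hi : 108 <= / s).
  { rewrite <- (Rinv_inv 108); apply Rinv_le_contravar; lra. }
  set (i := / s) in *.
  (* Each missing power of [i >= 108] costs a factor 1/108, which makes the lower order terms linear
     in the leading one. *)
  assert (i2 := pow_step i 1 Hi); assert (i3 := pow_step i 2 Hi);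
  assert (i4 := pow_step i 3 Hi); assert (i5 := pow_step i 4 Hi).
  rewrite pow_1 in i2.
  assert (M : forall a b c : R, 0 <= a -> b <= c -> a * b <= a * c)
    by (intros; apply Rmult_le_compat_l; trivial).
  assert (p1 : 0 <= i) by lra.
  assert (p2 : 0 <= i ^ 2) by (apply pow_le; lra).
  assert (p3 : 0 <= i ^ 3) by (apply pow_le; lra).
  assert (p4 : 0 <= i ^ 4) by (apply pow_le; lra).
  repeat split.
  - pose proof (M _ _ _ p1 (Rle_trans _ _ _ L30 U30)). lra.
  - pose proof (M _ _ _ p1 (Rle_trans _ _ _ L31 U31)) as H1.
    pose proof (M _ _ _ p2 (Rle_trans _ _ _ L30 U30)) as H2.
    lra.
  - pose proof (M _ _ _ p1 (Rle_trans _ _ _ L32 U32)) as H1.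
    pose proof (M _ _ _ p2 (Rle_trans _ _ _ L31 U31)) as H2.
    pose proof (M _ _ _ p3 (Rle_trans _ _ _ L30 U30)) as H3.
    lra.
  - pose proof (M _ _ _ p1 (Rle_trans _ _ _ L33 U33)) as H1.
    pose proof (M _ _ _ p2 (Rle_trans _ _ _ L32 U32)) as H2.
    pose proof (M _ _ _ p3 (Rle_trans _ _ _ L31 U31)) as H3.
    pose proof (M _ _ _ p4 (Rle_trans _ _ _ L30 U30)) as H4.
    lra.
Qed.

Lemma cum2_lower : 1000 <= INR J * s -> 1.62 * (/ s) ^ 3 <= cum2 s J.
Proof.
  intros HJ; pose proof cum2_ge_lsum as C.
  assert (0 <= INR J * s) by lra.
  destruct (lsum_ge s J ltac:(lra) ltac:(lra)) as (L10 & L11 & L12).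
  destruct (lsum_ge (2 * s) J ltac:(lra) ltac:(lra)) as (L20 & L21 & L22).
  destruct (lsum_ge (3 * s) J ltac:(lra) ltac:(lra)) as (L30 & L31 & L32).
  rewrite ?inv_mult_pow, ?Rinv_mult in * by lra; rewrite <- ?pow_inv in *.
  assert (Hi : 0 < / s) by (apply Rinv_0_lt_compat; lra).
  set (i := / s) in *.
  assert (M : forall a b c : R, 0 <= a -> b <= c -> a * b <= a * c)
    by (intros; apply Rmult_le_compat_l; trivial).
  assert (p2 : 0 <= i ^ 2) by (apply pow_le; lra).
  assert (p3 : 0 <= i ^ 3) by (apply pow_le; lra).
  pose proof (M _ _ _ (Rlt_le _ _ Hi) L31) as H1; pose proof (M _ _ _ p2 L30) as H2.
  lra.
Qed.
End Cumulants.

(** * The weight away from the saddle point *)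

(** Real part of the geometric sum [(1 - e^{-2 J z}) / (2 sinh z)] at [z = s - i t], cleared of the
    denominator by [|sinh z|^2 = sinh^2 s + sin^2 t]. *)
Lemma cos_sum_eq (s t : R) (J : nat) :
  2 * (sinh s ^ 2 + sin t ^ 2) * rsum (fun i => exp (- (oddr i * s)) * cos (oddr i * t)) J =
  sinh s * cos t - exp (- (2 * INR J * s)) *
    (sinh s * cos t * cos (2 * INR J * t) - cosh s * sin t * sin (2 * INR J * t)).
Proof.
  induction J as [|J IH].
  - simpl; rewrite !Rmult_0_r, !Rmult_0_l, cos_0, sin_0, Ropp_0, exp_0; ring.
  - simpl rsum; rewrite Rmult_plus_distr_l, IH, S_INR; unfold oddr.
    replace (- ((2 * INR J + 1) * s)) with (- (2 * INR J * s) + - s) by ring.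
    replace (- (2 * (INR J + 1) * s)) with (- (2 * INR J * s) + (- s + - s)) by ring.
    replace ((2 * INR J + 1) * t) with (2 * INR J * t + t) by ring.
    replace (2 * (INR J + 1) * t) with (2 * INR J * t + (t + t)) by ring.
    rewrite !exp_plus, !cos_plus, !sin_plus, !cos_plus.
    unfold sinh, cosh; rewrite exp_Ropp.
    assert (Hsc := sin2_cos2 t); unfold Rsqr in Hsc.
    pose proof (exp_pos s).
    set (X := exp (- (2 * INR J * s))); set (C := cos (2 * INR J * t)); set (Sn := sin (2 * INR J * t)).
    set (E := exp s) in *; set (c := cos t) in *; set (d := sin t) in *.
    field_simplify_eq; [|lra].
    replace (c ^ 3) with (c * (1 - d ^ 2)) by (replace (1 - d ^ 2) with (c ^ 2) by (simpl; lra); ring).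
    replace (c ^ 2) with (1 - d ^ 2) by (simpl; lra).
    ring.
Qed.

Lemma gexp_ge_cos_sum (s t : R) (J : nat) :
  0 < s ->
  / (2 * sinh s) * (1 - sinh s ^ 2 * cos t / (sinh s ^ 2 + sin t ^ 2)
                    - 2 * exp (- (2 * INR J * s))) <= gexp s J t.
Proof.
  intros Hs; pose proof (sinh_ge s ltac:(lra)) as Hy.
  set (X := exp (- (2 * INR J * s))).
  assert (HX : 0 < X) by apply exp_pos.
  apply Rle_trans with (rsum (fun i => exp (- (oddr i * s)) * (1 - cos (oddr i * t))) J).
  2:{ apply rsum_le; intros i; apply factor_far, rho_bounds; trivial. }
  rewrite (rsum_ext _ (fun i => oddr i ^ 0 * exp (- (oddr i * s)) +
             (-1) * (exp (- (oddr i * s)) * cos (oddr i * t)))) by (intros; ring).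
  rewrite rsum_plus, rsum_scal; fold (lsum 0 s J).
  rewrite lsum_eq by (trivial; lia); unfold csch_rem, csch_sum; fold X.
  pose proof (cos_sum_eq s t J) as E; fold X in E.
  set (C := rsum _ J) in *.
  set (y := sinh s) in *; set (D := y ^ 2 + sin t ^ 2) in *.
  set (a := y * cos t) in *; set (b := cosh s * sin t) in *.
  set (p := cos (2 * INR J * t)) in *; set (q := sin (2 * INR J * t)) in *.
  assert (HD : y ^ 2 <= D) by (unfold D; nra).
  assert (HD0 : 0 < D) by nra.
  assert (Hch : cosh s ^ 2 = 1 + y ^ 2).
  { unfold y, cosh, sinh.
    assert (exp s * exp (- s) = 1) by (rewrite <- exp_plus, Rplus_opp_r; apply exp_0). nra. }
  assert (Hab : a ^ 2 + b ^ 2 = D).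
  { unfold a, b, D. rewrite !Rpow_mult_distr, Hch.
    assert (Hsc := sin2_cos2 t); unfold Rsqr in Hsc.
    replace (cos t ^ 2) with (1 - sin t ^ 2) by (simpl; lra). ring. }
  assert (Hpq : p ^ 2 + q ^ 2 = 1).
  { unfold p, q. assert (Hsc := sin2_cos2 (2 * INR J * t)); unfold Rsqr in Hsc. simpl; lra. }
  (* Cauchy-Schwarz bounds the boundary term by [sqrt D], and [y <= sqrt D] turns this into
     [D / y]. *)
  assert (Habs : - (a * p - b * q) <= D / y).
  { assert (Hsq : (a * p - b * q) ^ 2 <= D).
    { assert (0 <= (a * q + b * p) ^ 2) by apply pow2_ge_0.
      replace ((a * p - b * q) ^ 2) with ((a ^ 2 + b ^ 2) * (p ^ 2 + q ^ 2) - (a * q + b * p) ^ 2) by ring.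
      rewrite Hab, Hpq; lra. }
    assert (Hsq2 : (a * p - b * q) ^ 2 <= (D / y) ^ 2).
    { apply Rle_trans with D; trivial.
      replace ((D / y) ^ 2) with (D * (D / y ^ 2)) by (field; lra).
      assert (1 <= D / y ^ 2); [|nra].
      apply Rmult_le_reg_r with (y ^ 2); [nra|].
      unfold Rdiv; rewrite Rmult_assoc, Rinv_l by nra; lra. }
    assert (0 < D / y) by (apply Rdiv_lt_0_compat; lra).
    nra. }
  assert (HC : C <= a / (2 * D) + X / (2 * y)).
  { apply Rmult_le_reg_l with (2 * D); [lra|].
    rewrite E.
    replace (2 * D * (a / (2 * D) + X / (2 * y))) with (a + X * (D / y)) by (field; lra).
    nra. }
  replace (/ (2 * y) * (1 - y ^ 2 * cos t / D - 2 * X)) with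
    (/ (2 * y) - X * / (2 * y) - (a / (2 * D) + X / (2 * y))); [lra|].
  unfold a; field; split; lra.
Qed.

(** For [t = x s] the quotient [sinh^2 s / (sinh^2 s + sin^2 t)] is about [1 / (1 + x^2)]. Near
    [t = PI] the sine is small again, but there [cos t <= 0] makes the term favourable. The
    condition [s <= x^2] makes the truncation term negligible against [x^2 / (1 + x^2)]. *)
Lemma gexp_far (s t x : R) (J : nat) :
  0 < s <= / 108 -> 10000 <= INR J * s ^ 2 ->
  0 <= x <= 4 -> s <= x ^ 2 -> x * s <= t <= PI ->
  0.49 * / s * (x ^ 2 / (1 + x ^ 2)) <= gexp s J t.
Proof.
  intros Hs HJ Hx Hx2 Ht.
  eapply Rle_trans; [|apply gexp_ge_cos_sum; lra].
  pose proof (sinh_ge s ltac:(lra)) as Hy; pose proof (sinh_le s ltac:(lra)) as Hy'.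
  assert (Hy2 : sinh s <= s * 1.001) by nra.
  assert (HX : exp (- (2 * INR J * s)) <= s / 20000).
  { assert (HT : 20000 / s <= 2 * INR J * s).
    { apply Rmult_le_reg_r with s; [lra|]. unfold Rdiv; rewrite Rmult_assoc, Rinv_l by lra. nra. }
    assert (0 < 20000 / s) by (apply Rdiv_lt_0_compat; lra).
    rewrite exp_Ropp; pose proof (exp_ineq1_le (2 * INR J * s)).
    replace (s / 20000) with (/ (20000 / s)) by (field; lra).
    apply Rinv_le_contravar; lra. }
  pose proof (exp_pos (- (2 * INR J * s))) as HX0.
  set (X := exp (- (2 * INR J * s))) in *; set (y := sinh s) in *.
  assert (HF : 0 <= x ^ 2 / (1 + x ^ 2) <= 16 / 17).
  { split; [apply Rmult_le_pos; [nra|apply Rlt_le, Rinv_0_lt_compat; nra]|].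
    apply Rmult_le_reg_r with (1 + x ^ 2); [nra|].
    unfold Rdiv; rewrite Rmult_assoc, Rinv_l by nra; nra. }
  set (f := x ^ 2 / (1 + x ^ 2)) in *.
  assert (Hf : s / 17 <= f).
  { pose proof (pow2_ge_0 x); assert (x ^ 2 <= 16) by nra.
    assert (s * (1 + x ^ 2) <= s * 17) by (apply Rmult_le_compat_l; lra).
    unfold f; apply (Rle_div_r (s / 17)); lra. }
  assert (Hb : 0.985 * f <= 1 - y ^ 2 * cos t / (y ^ 2 + sin t ^ 2) - 2 * X).
  { assert (HD : 0 < y ^ 2 + sin t ^ 2) by nra.
    destruct (Rle_lt_dec (cos t) 0) as [Hc|Hc].
    - assert (y ^ 2 * cos t / (y ^ 2 + sin t ^ 2) <= 0).
      { apply Rmult_le_reg_r with (y ^ 2 + sin t ^ 2); trivial.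
        unfold Rdiv; rewrite Rmult_assoc, Rinv_l by lra; nra. }
      lra.
    - assert (Ht2 : t < PI / 2).
      { destruct (Rlt_le_dec t (PI / 2)) as [|H]; trivial; exfalso.
        pose proof (cos_le_0 t H ltac:(pose proof PI_RGT_0; lra)); lra. }
      assert (Hxs : 0 <= x * s <= 0.0371) by nra.
      pose proof PI_RGT_0.
      assert (Hsin : 0.999 * (x * s) <= sin t).
      { apply Rle_trans with (sin (x * s)).
        - pose proof (sin_ge_cubic (x * s) ltac:(lra)).
          assert ((x * s) ^ 2 <= 0.002) by nra.
          assert ((x * s) * (x * s) ^ 2 <= (x * s) * 0.002) by (apply Rmult_le_compat_l; lra).
          replace ((x * s) ^ 3) with ((x * s) * (x * s) ^ 2) in * by ring. lra.
        - destruct (Req_dec (x * s) t) as [->|]; [lra|].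
          left; apply sin_increasing_1; lra. }
      assert (y ^ 2 * cos t / (y ^ 2 + sin t ^ 2) <= y ^ 2 / (y ^ 2 + sin t ^ 2)).
      { apply Rmult_le_compat_r; [apply Rlt_le, Rinv_0_lt_compat; trivial|].
        pose proof (COS_bound t); nra. }
      assert (0.994 * f <= 1 - y ^ 2 / (y ^ 2 + sin t ^ 2)).
      { replace (1 - y ^ 2 / (y ^ 2 + sin t ^ 2)) with (sin t ^ 2 / (y ^ 2 + sin t ^ 2)) by (field; lra).
        assert (H1 : 0.998 * (x * s) ^ 2 <= sin t ^ 2) by nra.
        assert (H2 : y ^ 2 <= 1.0021 * s ^ 2) by nra.
        assert (f * (1 + x ^ 2) = x ^ 2) by (unfold f; field; nra).
        apply Rmult_le_reg_r with (y ^ 2 + sin t ^ 2); trivial.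
        unfold Rdiv; rewrite (Rmult_assoc (sin t ^ 2)), Rinv_l, Rmult_1_r by lra.
        assert (f * y ^ 2 <= f * (1.0021 * s ^ 2)) by (apply Rmult_le_compat_l; lra).
        assert (Hfs : f * s ^ 2 = (x * s) ^ 2 * (1 - f)).
        { replace ((x * s) ^ 2 * (1 - f)) with (s ^ 2 * (x ^ 2 - f * x ^ 2)) by ring.
          replace (x ^ 2 - f * x ^ 2) with f by lra. ring. }
        assert (0 <= (x * s) ^ 2 * (1 - f)) by (apply Rmult_le_pos; [apply pow2_ge_0|lra]).
        assert (0.994 * f * y ^ 2 <= 0.997 * ((x * s) ^ 2 * (1 - f))) by lra.
        assert ((x * s) ^ 2 * (1 - f) * 0.998 <= sin t ^ 2 * (1 - f)).
        { replace ((x * s) ^ 2 * (1 - f) * 0.998) with (0.998 * (x * s) ^ 2 * (1 - f)) by ring.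
          apply Rmult_le_compat_r; lra. }
        assert (0 <= sin t ^ 2 * f) by (apply Rmult_le_pos; [apply pow2_ge_0|lra]).
        lra. }
      lra. }
  apply Rle_trans with (/ (2 * y) * (0.985 * f)).
  - assert (0.4995 * / s <= / (2 * y)).
    { assert (Hi : 0 < / s) by (apply Rinv_0_lt_compat; lra).
      assert (/ s * y <= / s * (s * 1.001)) by (apply Rmult_le_compat_l; lra).
      rewrite <- Rmult_assoc, Rinv_l in * by lra.
      apply Rmult_le_reg_r with (2 * y); [lra|]. rewrite (Rinv_l (2 * y)) by lra. lra. }
    assert (0 <= / s * f) by (apply Rmult_le_pos; [apply Rlt_le, Rinv_0_lt_compat; lra|lra]).
    assert (0.4995 * / s * f <= / (2 * y) * f) by (apply Rmult_le_compat_r; lra).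
    lra.
  - apply Rmult_le_compat_l; [apply Rlt_le, Rinv_0_lt_compat; lra|trivial].
Qed.

(** * The scaled integrand *)

Lemma gexp_le_cum (s t : R) (J : nat) :
  0 < s -> 0 <= t -> gexp s J t <= cum2 s J * t ^ 2 / 2.
Proof.
  intros Hs Ht.
  replace (cum2 s J * t ^ 2 / 2) with (t ^ 2 / 2 * cum2 s J) by field.
  unfold cum2; rewrite <- rsum_scal; apply rsum_le; intros i.
  pose proof (oddr_ge1 i); pose proof (rho_bounds s i Hs).
  pose proof (factor_le (rho s i) (oddr i * t) ltac:(lra) ltac:(nra)).
  rewrite Rpow_mult_distr in *; lra.
Qed.

Lemma gexp_ge_cum (s t : R) (J : nat) :
  0 < s -> 0 <= t -> cum2 s J * t ^ 2 / 2 - cum4 s J * t ^ 4 / 24 <= gexp s J t.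
Proof.
  intros Hs Ht.
  replace (cum2 s J * t ^ 2 / 2 - cum4 s J * t ^ 4 / 24)
    with (t ^ 2 / 2 * cum2 s J + - (t ^ 4 / 24) * cum4 s J) by field.
  unfold cum2, cum4; rewrite <- !rsum_scal, <- rsum_plus; apply rsum_le; intros i.
  pose proof (oddr_ge1 i); pose proof (rho_bounds s i Hs).
  pose proof (factor_ge (rho s i) (oddr i * t) ltac:(lra) ltac:(nra)).
  rewrite !Rpow_mult_distr in *; lra.
Qed.

Lemma phase_bounds (s t : R) (J : nat) :
  0 < s -> 0 <= t -> 0 <= cum1 s J * t - phase s J t <= cum3 s J * t ^ 3 / 6.
Proof.
  intros Hs Ht.
  replace (cum1 s J * t - phase s J t) with (t * cum1 s J + (-1) * phase s J t) by ring.
  replace (cum3 s J * t ^ 3 / 6) with (t ^ 3 / 6 * cum3 s J) by field.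
  unfold cum1, cum3, phase; rewrite <- !rsum_scal, <- rsum_plus.
  split; [apply rsum_ge0|apply rsum_le]; intros i;
    pose proof (oddr_ge1 i); pose proof (rho_bounds s i Hs);
    pose proof (arg1_bounds (rho s i) (oddr i * t) ltac:(lra) ltac:(nra));
    unfold geo1; rewrite !Rpow_mult_distr in *; lra.
Qed.

(** * Rational bounds for the exponential *)

Lemma exp_neg_ge (y : R) : 0 <= y -> 1 - y + y ^ 2 / 2 - y ^ 3 / 6 <= exp (- y).
Proof.
  intros Hy; assert (0 <= exp (- y) - (1 - y + y ^ 2 / 2 - y ^ 3 / 6)); [|lra].
  assert (H1 : forall y, 0 <= y -> 0 <= exp (- y) - (1 - y)).
  { intros u Hu; pose proof (exp_ineq1_le (- u)); lra. }
  assert (H2 : forall y, 0 <= y -> 0 <= (1 - y + y ^ 2 / 2) - exp (- y)).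
  { intros u Hu; apply (nonneg_of_deriv (fun y => (1 - y + y ^ 2 / 2) - exp (- y)) (fun y => exp (- y) - (1 - y))); trivial.
    - intros v _; auto_derive; trivial; field.
    - intros v Hv; apply H1; lra.
    - rewrite Ropp_0, exp_0; lra. }
  apply (nonneg_of_deriv (fun y => exp (- y) - (1 - y + y ^ 2 / 2 - y ^ 3 / 6)) (fun y => (1 - y + y ^ 2 / 2) - exp (- y))); trivial.
  - intros v _; auto_derive; trivial; field.
  - intros v Hv; apply H2; lra.
  - rewrite Ropp_0, exp_0; lra.
Qed.

Lemma exp_neg_le (y : R) : 0 <= y -> exp (- y) <= 1 - y + y ^ 2 / 2 - y ^ 3 / 6 + y ^ 4 / 24.
Proof.
  intros Hy; assert (0 <= 1 - y + y ^ 2 / 2 - y ^ 3 / 6 + y ^ 4 / 24 - exp (- y)); [|lra].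
  apply (nonneg_of_deriv (fun y => 1 - y + y ^ 2 / 2 - y ^ 3 / 6 + y ^ 4 / 24 - exp (- y))
     (fun y => exp (- y) - (1 - y + y ^ 2 / 2 - y ^ 3 / 6))); trivial.
  - intros v _; auto_derive; trivial; field.
  - intros v Hv; pose proof (exp_neg_ge v); lra.
  - rewrite Ropp_0, exp_0; lra.
Qed.

Lemma exp_pow (x : R) (n : nat) : exp x ^ n = exp (INR n * x).
Proof.
  induction n as [|n IH]; [simpl; now rewrite Rmult_0_l, exp_0|].
  rewrite <- tech_pow_Rmult, IH, <- exp_plus, S_INR; f_equal; ring.
Qed.

(** The exponent is divided by 16 so that a cubic Taylor polynomial is accurate; the rational [r]
    below it is raised to the 16th power. *)
Lemma exp_neg_lower (y r c : R) :
  0 <= y -> 0 <= r -> r <= 1 - y + y ^ 2 / 2 - y ^ 3 / 6 -> c <= r ^ 16 ->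
  c <= exp (- (16 * y)).
Proof.
  intros Hy Hr Hry Hc.
  replace (- (16 * y)) with (INR 16 * - y) by (simpl; ring).
  rewrite <- exp_pow; apply Rle_trans with (r ^ 16); trivial.
  apply pow_incr; pose proof (exp_neg_ge y Hy); lra.
Qed.

Lemma exp_neg_upper (y r c : R) :
  0 <= y -> 1 - y + y ^ 2 / 2 - y ^ 3 / 6 + y ^ 4 / 24 <= r -> r ^ 16 <= c ->
  exp (- (16 * y)) <= c.
Proof.
  intros Hy Hry Hc.
  replace (- (16 * y)) with (INR 16 * - y) by (simpl; ring).
  rewrite <- exp_pow; apply Rle_trans with (r ^ 16); trivial.
  apply pow_incr; pose proof (exp_neg_le y Hy); pose proof (exp_pos (- y)); lra.
Qed.

Lemma exp_le_mono (x y : R) : x <= y -> exp x <= exp y.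
Proof.
  intros H; destruct (Req_dec x y) as [->|]; [lra|].
  left; apply exp_increasing; lra.
Qed.

(* Values at [(i + 1) / 4] of [exp (- 0.85 v^2) (1 - 0.003425 v^6)], rounded down. *)
Definition cval (i : nat) : R :=
  nth i (0.9481 :: 0.8084 :: 0.6194 :: 0.4259 :: 0.2614 :: 0.1418 :: 0.0667 :: 0.026
         :: 0.0074 :: 0.0007 :: nil) 0.

Lemma cval_le (i : nat) :
  (i < 10)%nat ->
  0 <= cval i /\
  cval i <= exp (- (0.85 * (INR (S i) / 4) ^ 2)) * (1 - 0.003425 * (INR (S i) / 4) ^ 6).
Proof.
  intros Hi.
  assert (H : forall y r e c b, 0 <= y -> 0 <= r -> r <= 1 - y + y ^ 2 / 2 - y ^ 3 / 6 -> e <= r ^ 16 ->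
     0 <= b -> c <= e * b -> c <= exp (- (16 * y)) * b).
  { intros y r e c b H1 H2 H3 H4 H5 H6; apply Rle_trans with (e * b); trivial.
    apply Rmult_le_compat_r; trivial. exact (exp_neg_lower y r e H1 H2 H3 H4). }
  assert (E : forall b, 0.85 * b ^ 2 = 16 * (0.053125 * b ^ 2)) by (intros; lra).
  rewrite E.
  (* In each case the first number lies below the Taylor polynomial at a sixteenth of the exponent,
     the second below its 16th power. *)
  destruct i as [|[|[|[|[|[|[|[|[|[|i]]]]]]]]]]; try lia;
    unfold cval; simpl nth; simpl INR; (split; [lra|]);
    [ eapply (H _ 0.99668 0.94818) | eapply (H _ 0.9868 0.80847) | eapply (H _ 0.97055 0.61985)
    | eapply (H _ 0.94826 0.4274) | eapply (H _ 0.92034 0.26495) | eapply (H _ 0.88732 0.14766)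
    | eapply (H _ 0.84982 0.07399) | eapply (H _ 0.80847 0.03331) | eapply (H _ 0.76397 0.01346)
    | eapply (H _ 0.71699 0.00487) ]; lra.
Qed.

Definition tpoint (i : nat) : R :=
  nth i (2.5 :: 2.75 :: 3 :: 3.25 :: 3.5 :: 3.75 :: 4 :: 4.5 :: 5 :: 5.5 :: 6 :: nil) 6.
(* Values at [tpoint i] of [exp (- (0.81 v^2 - 0.008026 v^4))], rounded up. *)
Definition uval (i : nat) : R :=
  nth i (0.008666 :: 0.003464 :: 0.001311 :: 0.000474 :: 0.000166 :: 0.000057 :: 0.00002
         :: 0.000003 :: 0.000001 :: 0.000001 :: nil) 0.

Lemma uval_ge (i : nat) :
  (i < 10)%nat ->
  exp (- (0.81 * tpoint i ^ 2 - 0.008026 * tpoint i ^ 4)) <= uval i.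
Proof.
  intros Hi.
  assert (E : forall b, 0.81 * b ^ 2 - 0.008026 * b ^ 4 = 16 * (0.050625 * b ^ 2 - 0.000501625 * b ^ 4))
    by (intros; lra).
  rewrite E.
  destruct i as [|[|[|[|[|[|[|[|[|[|i]]]]]]]]]]; try lia;
    unfold uval, tpoint; simpl nth;
    [ eapply (exp_neg_upper _ 0.74321) | eapply (exp_neg_upper _ 0.70181)
    | eapply (exp_neg_upper _ 0.66045) | eapply (exp_neg_upper _ 0.61975)
    | eapply (exp_neg_upper _ 0.58028) | eapply (exp_neg_upper _ 0.54253)
    | eapply (exp_neg_upper _ 0.50692) | eapply (exp_neg_upper _ 0.44338)
    | eapply (exp_neg_upper _ 0.39154) | eapply (exp_neg_upper _ 0.35219) ]; lra.
Qed.

(** * Integrals against step functions *)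

Lemma RInt_nonneg_le (f g : R -> R) (a b : R) :
  a <= b -> (forall t, continuous f t) -> (forall t, continuous g t) ->
  (forall t, a <= t <= b -> f t <= g t) -> RInt f a b <= RInt g a b.
Proof.
  intros Hab Hf Hg H; apply RInt_le; trivial; try (apply ex_RInt_all; trivial).
  intros t Ht; apply H; lra.
Qed.

Lemma RInt_scal_R (f : R -> R) (a b c : R) :
  (forall t, continuous f t) -> RInt (fun t => c * f t) a b = c * RInt f a b.
Proof. intros Hf; apply (RInt_scal (V := R_CompleteNormedModule)), ex_RInt_all; trivial. Qed.

Lemma RInt_plus_R (f g : R -> R) (a b : R) :
  (forall t, continuous f t) -> (forall t, continuous g t) ->
  RInt (fun t => f t + g t) a b = RInt f a b + RInt g a b.
Proof. intros Hf Hg; apply (RInt_plus (V := R_CompleteNormedModule)); apply ex_RInt_all; trivial. Qed.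

Lemma RInt_Chasles_R (f : R -> R) (a b c : R) :
  (forall t, continuous f t) -> RInt f a c = RInt f a b + RInt f b c.
Proof.
  intros Hf; symmetry; apply (RInt_Chasles (V := R_CompleteNormedModule)); apply ex_RInt_all; trivial.
Qed.

Lemma continuous_mult_R (f g : R -> R) :
  (forall t, continuous f t) -> (forall t, continuous g t) ->
  forall t, continuous (fun x => f x * g x) t.
Proof. intros Hf Hg t; apply (continuous_mult (K := R_AbsRing) f g); auto. Qed.

Lemma continuous_pow (n : nat) (t : R) : continuous (fun x => x ^ n) t.
Proof. apply (ex_derive_continuous (V := R_NormedModule)); auto_derive; trivial. Qed.

Lemma RInt_pow_R (n : nat) (a b : R) :
  RInt (fun t => t ^ n) a b = (b ^ S n - a ^ S n) / INR (S n).
Proof.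
  assert (Hn : INR (S n) <> 0) by (apply not_0_INR; lia).
  apply is_RInt_unique.
  replace ((b ^ S n - a ^ S n) / INR (S n)) with
    (minus ((fun t => / INR (S n) * t ^ S n) b) ((fun t => / INR (S n) * t ^ S n) a)).
  - apply (is_RInt_derive (V := R_CompleteNormedModule) (fun t => / INR (S n) * t ^ S n)).
    + intros x _.
      replace (x ^ n) with (/ INR (S n) * (INR (S n) * 1 * x ^ pred (S n))) by (simpl pred; field; trivial).
      apply (is_derive_scal (fun x => x ^ S n)).
      apply (is_derive_pow (fun x => x)); apply (is_derive_id (K := R_AbsRing)).
    + intros x _; apply continuous_pow.
  - unfold minus, plus, opp; simpl; unfold Rdiv; ring.
Qed.

(** Only [f] is replaced by a step function; the factor [p] stays under the integral, so powers of
    [t] are integrated exactly. *)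
Lemma steps_le (f p : R -> R) (c x : nat -> R) (n : nat) :
  (forall t, continuous f t) -> (forall t, continuous p t) -> (forall t, 0 <= p t) ->
  (forall i, (i < n)%nat -> x i <= x (S i)) ->
  (forall i t, (i < n)%nat -> x i <= t <= x (S i) -> c i <= f t) ->
  rsum (fun i => c i * RInt p (x i) (x (S i))) n <= RInt (fun t => f t * p t) (x O) (x n).
Proof.
  intros Hf Hp Hp0 Hx Hc.
  assert (Hfp := continuous_mult_R f p Hf Hp).
  induction n as [|n IH].
  - simpl; rewrite RInt_point; apply Rle_refl.
  - simpl rsum; rewrite (RInt_Chasles_R (fun t => f t * p t) (x O) (x n)) by trivial.
    apply Rplus_le_compat.
    + apply IH; intros; [apply Hx|apply Hc]; trivial; lia.
    + rewrite <- RInt_scal_R by trivial.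
      apply RInt_nonneg_le; trivial.
      * apply Hx; lia.
      * intros t; apply (continuous_mult_R (fun _ => c n) p); trivial; intros; apply continuous_const.
      * intros t Ht; apply Rmult_le_compat_r; [apply Hp0|]. apply Hc; trivial; lia.
Qed.

Lemma steps_ge (f p : R -> R) (c x : nat -> R) (n : nat) :
  (forall t, continuous f t) -> (forall t, continuous p t) -> (forall t, 0 <= p t) ->
  (forall i, (i < n)%nat -> x i <= x (S i)) ->
  (forall i t, (i < n)%nat -> x i <= t <= x (S i) -> f t <= c i) ->
  RInt (fun t => f t * p t) (x O) (x n) <= rsum (fun i => c i * RInt p (x i) (x (S i))) n.
Proof.
  intros Hf Hp Hp0 Hx Hc.
  assert (Hf' : forall t, continuous (fun x => - f x) t)
    by (intros; apply (continuous_opp f); trivial).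
  assert (H := steps_le (fun t => - f t) p (fun i => - c i) x n Hf' Hp Hp0 Hx).
  assert (H' : rsum (fun i => - c i * RInt p (x i) (x (S i))) n
                 <= RInt (fun t => - f t * p t) (x O) (x n)).
  { apply H; intros i t Hi Ht; apply Ropp_le_contravar, Hc; trivial. }
  rewrite (rsum_ext _ (fun i => (-1) * (c i * RInt p (x i) (x (S i))))) in H' by (intros; ring).
  rewrite rsum_scal in H'.
  rewrite (RInt_ext _ (fun t => (-1) * (f t * p t))) in H' by (intros; simpl; ring).
  rewrite RInt_scal_R in H' by (now apply continuous_mult_R).
  lra.
Qed.

(** * The substitution [t = k^3 v], with [k = sqrt s] so that only integer powers occur *)

Section Scaled.
Variables (k s : R) (J : nat).
Hypothesis Hk : 0 < k.
Hypothesis Hsk : s = k ^ 2.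
Hypothesis Hs : s <= / 108.
Hypothesis HJ : 10000 <= INR J * s ^ 2.

Let s_bounds : 0 < s <= / 108.
Proof. split; [rewrite Hsk; nra|trivial]. Qed.

Let HJ1 : 1000 <= INR J * s.
Proof. pose proof (pos_INR J); nra. Qed.

Let k_small : k <= 0.09623.
Proof. rewrite Hsk in Hs; nra. Qed.

Let inv_k (n : nat) : (/ s) ^ n * k ^ (2 * n) = 1.
Proof.
  rewrite Hsk, pow_inv, <- pow_mult, Rinv_l; [trivial|].
  apply pow_nonzero; lra.
Qed.

(** At the saddle point [cum1 s J] is the integer [n + 1], and this is the odd phase [psi]. *)
Definition devphase (t : R) : R := phase s J t - cum1 s J * t.

Lemma gexp_scaled_le (v : R) : 0 <= v -> gexp s J (k ^ 3 * v) <= 0.85 * v ^ 2.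
Proof.
  intros Hv; assert (0 < k ^ 3) by (apply pow_lt; trivial).
  eapply Rle_trans; [apply gexp_le_cum; [lra|nra]|].
  destruct (cum_upper s J s_bounds) as (_ & C2 & _ & _).
  pose proof (inv_k 3) as E; simpl (2 * 3)%nat in E.
  assert (0 <= k ^ 6 * v ^ 2) by (apply Rmult_le_pos; apply pow_le; lra).
  assert (cum2 s J * (k ^ 6 * v ^ 2) <= 1.7 * (/ s) ^ 3 * (k ^ 6 * v ^ 2)) by (apply Rmult_le_compat_r; lra).
  replace (1.7 * (/ s) ^ 3 * (k ^ 6 * v ^ 2)) with (1.7 * ((/ s) ^ 3 * k ^ 6) * v ^ 2) in * by ring.
  rewrite E in *.
  replace (cum2 s J * (k ^ 3 * v) ^ 2 / 2) with (cum2 s J * (k ^ 6 * v ^ 2) / 2) by (field; lra).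
  lra.
Qed.

(** [0.81 = 1.62 / 2], and 0.008026 exceeds [20.8 / (24 * 108)]. *)
Lemma gexp_scaled_ge (v : R) :
  0 <= v -> 0.81 * v ^ 2 - 0.008026 * v ^ 4 <= gexp s J (k ^ 3 * v).
Proof.
  intros Hv; assert (0 < k ^ 3) by (apply pow_lt; trivial).
  eapply Rle_trans; [|apply gexp_ge_cum; [lra|nra]].
  destruct (cum_upper s J s_bounds) as (_ & _ & _ & C4).
  pose proof (cum2_lower s J s_bounds HJ1) as C2.
  pose proof (inv_k 3) as E3; simpl (2 * 3)%nat in E3.
  pose proof (inv_k 5) as E5; simpl (2 * 5)%nat in E5.
  assert (0 <= k ^ 6 * v ^ 2) by (apply Rmult_le_pos; apply pow_le; lra).
  assert (0 <= k ^ 12 * v ^ 4) by (apply Rmult_le_pos; apply pow_le; lra).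
  assert (1.62 * (/ s) ^ 3 * (k ^ 6 * v ^ 2) <= cum2 s J * (k ^ 6 * v ^ 2)) by (apply Rmult_le_compat_r; lra).
  assert (cum4 s J * (k ^ 12 * v ^ 4) <= 20.8 * (/ s) ^ 5 * (k ^ 12 * v ^ 4)) by (apply Rmult_le_compat_r; lra).
  replace (1.62 * (/ s) ^ 3 * (k ^ 6 * v ^ 2)) with (1.62 * ((/ s) ^ 3 * k ^ 6) * v ^ 2) in * by ring.
  replace (20.8 * (/ s) ^ 5 * (k ^ 12 * v ^ 4)) with (20.8 * ((/ s) ^ 5 * k ^ 10) * (k ^ 2 * v ^ 4)) in * by ring.
  rewrite E3, E5, <- Hsk in *.
  replace (cum2 s J * (k ^ 3 * v) ^ 2 / 2) with (cum2 s J * (k ^ 6 * v ^ 2) / 2) by (field; lra).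
  replace (cum4 s J * (k ^ 3 * v) ^ 4 / 24) with (cum4 s J * (k ^ 12 * v ^ 4) / 24) by (field; lra).
  assert (s * v ^ 4 <= / 108 * v ^ 4) by (apply Rmult_le_compat_r; [apply pow_le; lra|lra]).
  assert (0 <= v ^ 4) by (apply pow_le; lra).
  lra.
Qed.

(** The third cumulant bounds the phase by [5.16 / 6 = 0.86] times [k v^3]; 0.003425 exceeds
    [0.86^2 / (2 * 108)]. *)
Lemma devphase_scaled (v : R) :
  0 <= v -> devphase (k ^ 3 * v) ^ 2 / 2 <= 0.003425 * v ^ 6.
Proof.
  intros Hv; assert (Hk3 : 0 < k ^ 3) by (apply pow_lt; trivial).
  destruct (phase_bounds s (k ^ 3 * v) J ltac:(lra) ltac:(nra)) as [P1 P2].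
  destruct (cum_upper s J s_bounds) as (_ & _ & C3 & _).
  pose proof (inv_k 4) as E; simpl (2 * 4)%nat in E.
  assert (0 <= k ^ 9 * v ^ 3) by (apply Rmult_le_pos; apply pow_le; lra).
  assert (cum3 s J * (k ^ 9 * v ^ 3) <= 5.16 * (/ s) ^ 4 * (k ^ 9 * v ^ 3)) by (apply Rmult_le_compat_r; lra).
  replace (5.16 * (/ s) ^ 4 * (k ^ 9 * v ^ 3)) with (5.16 * ((/ s) ^ 4 * k ^ 8) * (k * v ^ 3)) in * by ring.
  rewrite E in *.
  replace (cum3 s J * (k ^ 3 * v) ^ 3 / 6) with (cum3 s J * (k ^ 9 * v ^ 3) / 6) in P2 by (field; lra).
  unfold devphase.
  set (d := cum1 s J * (k ^ 3 * v) - phase s J (k ^ 3 * v)) in *.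
  replace (phase s J (k ^ 3 * v) - cum1 s J * (k ^ 3 * v)) with (- d) by (unfold d; ring).
  assert (Hd : d ^ 2 <= (0.86 * (k * v ^ 3)) ^ 2) by (apply pow_incr; lra).
  replace ((- d) ^ 2) with (d ^ 2) by ring.
  replace ((0.86 * (k * v ^ 3)) ^ 2) with (0.7396 * (k ^ 2 * v ^ 6)) in Hd by lra.
  rewrite <- Hsk in Hd.
  assert (0 <= v ^ 6) by (apply pow_le; lra).
  assert (s * v ^ 6 <= / 108 * v ^ 6) by (apply Rmult_le_compat_r; lra).
  lra.
Qed.

Definition minor (t : R) : R := wgt s J t * cos (devphase t).

Lemma cos_ge_quad (x : R) : 1 - x ^ 2 / 2 <= cos x.
Proof.
  destruct (Rle_lt_dec 0 x) as [H|H].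
  - pose proof (one_sub_cos_le x H); lra.
  - pose proof (one_sub_cos_le (- x) ltac:(lra)) as H1; rewrite cos_neg in H1.
    replace ((- x) ^ 2) with (x ^ 2) in H1 by ring; lra.
Qed.

(** Both bounds decrease in [v], so the right end of the interval is used. The cosine bound
    [1 - 0.003425 b^6] is positive at [b = 5/2] but negative at [11/4], which dictates where the
    centre ends. *)
Lemma minor_center (i : nat) (t : R) :
  (i < 10)%nat -> k ^ 3 * (INR i / 4) <= t <= k ^ 3 * (INR (S i) / 4) -> cval i <= minor t.
Proof.
  intros Hi Ht; assert (Hk3 : 0 < k ^ 3) by (apply pow_lt; trivial).
  set (v := t / k ^ 3).
  assert (Ev : t = k ^ 3 * v) by (unfold v; field; lra).
  assert (Hi0 := pos_INR i).
  assert (Hv : INR i / 4 <= v <= INR (S i) / 4).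
  { rewrite Ev in Ht; split; apply Rmult_le_reg_l with (k ^ 3); lra. }
  assert (H10 : INR (S i) <= 10) by (replace 10 with (INR 10) by (simpl; lra); apply le_INR; lia).
  set (b := INR (S i) / 4) in *.
  assert (Hb : 0 <= v <= b /\ b <= 2.5) by (unfold b in *; lra).
  destruct (cval_le i Hi) as [Hc0 Hc]; fold b in Hc.
  eapply Rle_trans; [exact Hc|].
  unfold minor; rewrite Ev.
  assert (Hb6 : b ^ 6 <= 2.5 ^ 6) by (apply pow_incr; lra).
  apply Rmult_le_compat.
  - apply Rlt_le, exp_pos.
  - lra.
  - unfold wgt; apply exp_le_mono, Ropp_le_contravar.
    pose proof (gexp_scaled_le v ltac:(lra)).
    assert (v ^ 2 <= b ^ 2) by (apply pow_incr; lra). lra.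
  - pose proof (cos_ge_quad (devphase (k ^ 3 * v))).
    pose proof (devphase_scaled v ltac:(lra)).
    assert (v ^ 6 <= b ^ 6) by (apply pow_incr; lra). lra.
Qed.

(** The exponent [0.81 v^2 - 0.008026 v^4] increases as long as [v^2] stays below about 50, so up to
    [v = 6] the left end gives the maximum of the bound. *)
Lemma wgt_tail_step (i : nat) (t : R) :
  (i < 10)%nat -> k ^ 3 * tpoint i <= t <= k ^ 3 * tpoint (S i) -> wgt s J t <= uval i.
Proof.
  intros Hi Ht; assert (Hk3 : 0 < k ^ 3) by (apply pow_lt; trivial).
  set (v := t / k ^ 3).
  assert (Ev : t = k ^ 3 * v) by (unfold v; field; lra).
  assert (Hv : tpoint i <= v <= tpoint (S i)).
  { rewrite Ev in Ht; split; apply Rmult_le_reg_l with (k ^ 3); lra. }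
  assert (Ha : 2.5 <= tpoint i /\ tpoint (S i) <= 6).
  { destruct i as [|[|[|[|[|[|[|[|[|[|i]]]]]]]]]]; try lia; unfold tpoint; simpl nth; lra. }
  eapply Rle_trans; [|apply uval_ge; trivial].
  unfold wgt; apply exp_le_mono, Ropp_le_contravar; rewrite Ev.
  eapply Rle_trans; [|apply gexp_scaled_ge; lra].
  set (a := tpoint i) in *.
  assert (a ^ 2 <= v ^ 2) by (apply pow_incr; lra).
  assert (v ^ 2 <= 6 ^ 2) by (apply pow_incr; lra).
  replace (v ^ 4) with (v ^ 2 * v ^ 2) by ring; replace (a ^ 4) with (a ^ 2 * a ^ 2) by ring.
  nra.
Qed.

Let tail_mono (i : nat) : (i < 10)%nat -> tpoint i <= tpoint (S i).
Proof.
  intros Hi; destruct i as [|[|[|[|[|[|[|[|[|[|i]]]]]]]]]]; try lia; unfold tpoint; simpl nth; lra.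
Qed.

(** Only the fourth moment of the tail is estimated: beyond the cut it dominates the lower moments,
    which are later derived from it. *)
Lemma tail_near :
  RInt (fun t => wgt s J t * t ^ 4) (k ^ 3 * 2.5) (k ^ 3 * 6) <= 0.225 * k ^ 15.
Proof.
  assert (Hk3 : 0 < k ^ 3) by (apply pow_lt; trivial).
  pose proof (steps_ge (wgt s J) (fun t => t ^ 4) uval (fun i => k ^ 3 * tpoint i) 10) as H.
  eapply Rle_trans; [apply H|].
  - intros; apply continuous_wgt; lra.
  - intros; apply continuous_pow.
  - intros t; replace (t ^ 4) with ((t ^ 2) ^ 2) by ring; apply pow2_ge_0.
  - intros i Hi; apply Rmult_le_compat_l; [lra|]; apply tail_mono; trivial.
  - intros i t Hi Ht; apply wgt_tail_step; trivial.
  - cbn [rsum]; rewrite !RInt_pow_R; unfold uval, tpoint; simpl nth; simpl INR.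
    assert (0 < k ^ 15) by (apply pow_lt; trivial). lra.
Qed.

(** Here [t / s = k v <= 0.6], so [gexp_far] gives an exponent of at least
    [0.49 / 1.36 * v^2 >= 0.36 v^2]. Then [e^{-X} <= 9! / X^9] replaces the integrand by a multiple
    of [t^(-14)]. *)
Lemma tail_mid :
  RInt (fun t => wgt s J t * t ^ 4) (k ^ 3 * 6) (0.6 * s) <= 0.0212 * k ^ 15.
Proof.
  assert (Hk3 : 0 < k ^ 3) by (apply pow_lt; trivial).
  assert (Hab : k ^ 3 * 6 <= 0.6 * s).
  { rewrite Hsk; replace (k ^ 3 * 6) with (k ^ 2 * (6 * k)) by ring.
    rewrite (Rmult_comm 0.6); apply Rmult_le_compat_l; [apply pow2_ge_0|lra]. }
  set (a := k ^ 3 * 6) in *; assert (Ha : 0 < a) by (unfold a; lra).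
  set (C := 362880 / 0.36 ^ 9).
  assert (HI : is_RInt (fun t => C * k ^ 54 * / t ^ 14) a (0.6 * s)
     (minus ((fun t => - (C * k ^ 54 / 13) * / t ^ 13) (0.6 * s)) ((fun t => - (C * k ^ 54 / 13) * / t ^ 13) a))).
  { apply (is_RInt_derive (V := R_CompleteNormedModule) (fun t => - (C * k ^ 54 / 13) * / t ^ 13));
      intros x Hx; rewrite Rmin_left in Hx by trivial; assert (x <> 0) by lra.
    - auto_derive; [apply (pow_nonzero x 13); trivial|]. field; trivial.
    - apply (ex_derive_continuous (V := R_NormedModule)); auto_derive.
      apply (pow_nonzero x 14); trivial. }
  apply Rle_trans with (RInt (fun t => C * k ^ 54 * / t ^ 14) a (0.6 * s)).
  - apply RInt_le; trivial.
    + apply ex_RInt_all; apply (continuous_mult_R (wgt s J) (fun t => t ^ 4)).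
      * intros; apply continuous_wgt; lra.
      * intros; apply continuous_pow.
    + eexists; exact HI.
    + intros t Ht.
      set (v := t / k ^ 3).
      assert (Ev : t = k ^ 3 * v) by (unfold v; field; lra).
      assert (Hv : 6 <= v) by (apply Rmult_le_reg_l with (k ^ 3); unfold a in Ht; lra).
      assert (Hts : t / s = k * v) by (rewrite Ev, Hsk; field; lra).
      assert (Hx6 : k * v <= 0.6).
      { rewrite <- Hts; apply Rle_div_l; lra. }
      assert (Hx0 : 0 <= k * v) by nra.
      assert (Hkv : s <= (k * v) ^ 2).
      { rewrite Rpow_mult_distr, <- Hsk. assert (1 <= v ^ 2) by nra. nra. }
      assert (Hpi : 3 < PI) by (pose proof PI2_3_2; lra).
      pose proof (gexp_far s t (k * v) J s_bounds HJ ltac:(lra) Hkv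
        ltac:(rewrite <- Hts; split; [right; field; lra|lra])) as Hg.
      assert (Hg2 : 0.36 * v ^ 2 <= gexp s J t).
      { eapply Rle_trans; [|exact Hg].
        set (x2 := (k * v) ^ 2) in *.
        assert (Hx2 : x2 <= 0.36) by (unfold x2; nra).
        assert (Hi : / 1.36 <= / (1 + x2)) by (apply Rinv_le_contravar; lra).
        assert (Hsx : / s * x2 = v ^ 2) by (unfold x2; rewrite Hsk; field; lra).
        replace (0.49 * / s * (x2 / (1 + x2))) with (0.49 * (/ s * x2) * / (1 + x2)) by (field; lra).
        rewrite Hsx.
        assert (0.49 * v ^ 2 * / 1.36 <= 0.49 * v ^ 2 * / (1 + x2)) by (apply Rmult_le_compat_l; nra).
        nra. }
      set (X := 0.36 * v ^ 2) in *.
      assert (HX : 0 < X) by (unfold X; nra).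
      assert (Hw : wgt s J t <= 362880 * / X ^ 9).
      { apply Rle_trans with (exp (- X)); [unfold wgt; apply exp_le_mono; lra|].
        rewrite exp_Ropp.
        pose proof (exp_ge_pow 9 X ltac:(lra)) as He.
        replace (INR (fact 9)) with 362880 in He by (rewrite !fact_simpl, !mult_INR; simpl fact; simpl INR; lra).
        assert (0 < X ^ 9) by (apply pow_lt; trivial).
        replace (362880 * / X ^ 9) with (/ (X ^ 9 / 362880)) by (field; lra).
        apply Rinv_le_contravar; trivial. lra. }
      assert (Hv0 : v <> 0) by lra.
      replace (C * k ^ 54 * / t ^ 14) with (362880 * / X ^ 9 * t ^ 4).
      * apply Rmult_le_compat_r; trivial. apply pow_le; nra.
      * unfold C, X; rewrite Ev; field; repeat split; lra.
  - rewrite (is_RInt_unique _ _ _ _ HI).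
    unfold minus, plus, opp; simpl.
    assert (HC : C <= 3.5732e9) by (unfold C; lra).
    assert (0 < C * k ^ 54 / 13).
    { assert (0 < k ^ 54) by (apply pow_lt; trivial). unfold C; lra. }
    assert (0 < / (0.6 * s) ^ 13) by (apply Rinv_0_lt_compat, pow_lt; lra).
    assert (Ea : C * k ^ 54 / 13 * / a ^ 13 = C / 13 / 6 ^ 13 * k ^ 15).
    { unfold a; field; lra. }
    assert (C / 13 / 6 ^ 13 * k ^ 15 <= 0.0212 * k ^ 15).
    { apply Rmult_le_compat_r; [apply pow_le; lra|lra]. }
    change (- (C * k ^ 54 / 13) * / (0.6 * s) ^ 13 + - (- (C * k ^ 54 / 13) * / a ^ 13) <= 0.0212 * k ^ 15).
    nra.
Qed.

Lemma wgt_far (x t : R) :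
  0.5 <= x <= 4 -> x * s <= t <= PI -> wgt s J t <= exp (- (0.49 * (x ^ 2 / (1 + x ^ 2)) * / s)).
Proof.
  intros Hx Ht; unfold wgt; apply exp_le_mono, Ropp_le_contravar.
  pose proof (gexp_far s t x J s_bounds HJ ltac:(lra) ltac:(nra) ltac:(lra)). lra.
Qed.

(** When [108 c >= n], the quotient of [e^{-c/s}] by [s^n] is largest at [s = 1/108]; this follows
    from [e^y >= 1 + y] applied to an [n]-th part of the exponent. *)
Lemma exp_far_bound (c : R) (n : nat) :
  (0 < n)%nat -> INR n <= 108 * c ->
  exp (- (c * / s)) <= (108 * s) ^ n * exp (- (108 * c)).
Proof.
  intros Hn Hc.
  assert (Hn0 : 0 < INR n) by (apply lt_0_INR; trivial).
  assert (HZ : 108 <= / s).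
  { rewrite <- (Rinv_inv 108); apply Rinv_le_contravar; lra. }
  set (y := c * (/ s - 108)).
  replace (- (c * / s)) with (- y + - (108 * c)) by (unfold y; ring).
  rewrite exp_plus; apply Rmult_le_compat_r; [apply Rlt_le, exp_pos|].
  replace (- y) with (INR n * - (y / INR n)) by (field; lra).
  rewrite <- exp_pow; apply pow_incr; split; [apply Rlt_le, exp_pos|].
  rewrite exp_Ropp.
  replace (108 * s) with (/ (/ s / 108)) by (field; lra).
  apply Rinv_le_contravar; [lra|].
  pose proof (exp_ineq1_le (y / INR n)).
  assert ((/ s - 108) / 108 <= y / INR n).
  { apply (Rle_div_r ((/ s - 108) / 108)); [lra|]. unfold y. nra. }
  lra.
Qed.

Lemma tail_piece (x b : R) :
  0.5 <= x <= 4 -> x * s <= b <= PI ->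
  RInt (fun t => wgt s J t * t ^ 4) (x * s) b
    <= exp (- (0.49 * (x ^ 2 / (1 + x ^ 2)) * / s)) * (b ^ 5 / 5).
Proof.
  intros Hx Hb.
  pose proof (steps_ge (wgt s J) (fun t => t ^ 4)
     (fun _ => exp (- (0.49 * (x ^ 2 / (1 + x ^ 2)) * / s)))
     (fun i => match i with O => x * s | _ => b end) 1) as H; simpl in H.
  rewrite Rplus_0_l in H.
  eapply Rle_trans; [apply H|].
  - intros; apply continuous_wgt; lra.
  - intros; apply (continuous_pow 4).
  - intros t; replace (t * (t * (t * (t * 1)))) with ((t ^ 2) ^ 2) by ring; apply pow2_ge_0.
  - intros i Hi; destruct i; [lra|lia].
  - intros i t Hi Ht; destruct i; [|lia]. apply (wgt_far x); lra.
  - apply Rmult_le_compat_l; [apply Rlt_le, exp_pos|].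
    change (RInt (fun t => t ^ 4) (x * s) b <= b ^ 5 / 5).
    rewrite RInt_pow_R; simpl INR.
    assert (0 <= (x * s) ^ 5) by (apply pow_le; nra). lra.
Qed.

(** The weight is bounded by a constant on each of three pieces, starting at [0.6 s], [s] and [4 s].
    The powers 3, 3 and 8 complete [s^5], [s^5] and [PI^5] to [s^8 = k^16], which leaves a spare
    factor [k] against [k^15]. *)
Lemma tail_far :
  RInt (fun t => wgt s J t * t ^ 4) (0.6 * s) PI <= 0.0205 * k ^ 15.
Proof.
  assert (Hpi : 3 < PI <= 4) by (pose proof PI2_3_2; pose proof PI_4; lra).
  assert (Hf : forall t, continuous (fun t => wgt s J t * t ^ 4) t).
  { apply (continuous_mult_R (wgt s J) (fun t => t ^ 4)).
    - intros; apply continuous_wgt; lra.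
    - intros; apply continuous_pow. }
  rewrite (RInt_Chasles_R _ _ (1 * s)), (RInt_Chasles_R _ (1 * s) (4 * s)) by trivial.
  pose proof (tail_piece 0.6 (1 * s) ltac:(lra) ltac:(lra)) as P1.
  pose proof (tail_piece 1 (4 * s) ltac:(lra) ltac:(lra)) as P2.
  pose proof (tail_piece 4 PI ltac:(lra) ltac:(lra)) as P3.
  (* The rates 0.1297, 0.245, 0.461 lie below or at [0.49 x^2 / (1 + x^2)] for [x = 0.6, 1, 4]. Each
     exponential is first split into a small power so that the Taylor argument stays near 0.3. *)
  assert (E1 : exp (- (108 * 0.1297)) <= 8.3e-7).
  { replace (- (108 * 0.1297)) with (INR 3 * - (16 * 0.291825)) by (simpl INR; lra).
    rewrite <- exp_pow; apply Rle_trans with (0.00939 ^ 3); [|lra].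
    apply pow_incr; split; [apply Rlt_le, exp_pos|].
    apply (exp_neg_upper _ 0.74692); lra. }
  assert (E2 : exp (- (108 * 0.245)) <= 4e-12).
  { replace (- (108 * 0.245)) with (INR 6 * - (16 * 0.275625)) by (simpl INR; lra).
    rewrite <- exp_pow; apply Rle_trans with (0.0124 ^ 6); [|lra].
    apply pow_incr; split; [apply Rlt_le, exp_pos|].
    apply (exp_neg_upper _ 0.7592); lra. }
  assert (E3 : exp (- (108 * 0.461)) <= 3e-22).
  { replace (- (108 * 0.461)) with (INR 10 * - (16 * 0.311175)) by (simpl INR; lra).
    rewrite <- exp_pow; apply Rle_trans with (0.0070 ^ 10); [|lra].
    apply pow_incr; split; [apply Rlt_le, exp_pos|].
    apply (exp_neg_upper _ 0.7327); lra. }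
  pose proof (exp_far_bound 0.1297 3 ltac:(lia) ltac:(simpl INR; lra)) as F1.
  pose proof (exp_far_bound 0.245 3 ltac:(lia) ltac:(simpl INR; lra)) as F2.
  pose proof (exp_far_bound 0.461 8 ltac:(lia) ltac:(simpl INR; lra)) as F3.
  assert (Hi : 0 < / s) by (apply Rinv_0_lt_compat; lra).
  assert (Q : forall x b c K n e, x ^ 2 / (1 + x ^ 2) * 0.49 >= c -> 0 <= K ->
     exp (- (c * / s)) <= (108 * s) ^ n * exp (- (108 * c)) -> exp (- (108 * c)) <= e ->
     0 <= b <= K ->
     exp (- (0.49 * (x ^ 2 / (1 + x ^ 2)) * / s)) * b <= (108 * s) ^ n * e * K).
  { intros x b c K n e Hc HK H1 H2 Hb.
    assert (0 <= (108 * s) ^ n) by (apply pow_le; lra).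
    apply Rmult_le_compat; [apply Rlt_le, exp_pos|lra| |lra].
    apply Rle_trans with (exp (- (c * / s))); [apply exp_le_mono; nra|].
    eapply Rle_trans; [exact H1|]. apply Rmult_le_compat_l; trivial. }
  assert (s5 : 0 < s ^ 5) by (apply pow_lt; lra).
  assert (G1 := Q 0.6 ((1 * s) ^ 5 / 5) 0.1297 (s ^ 5 / 5) 3%nat 8.3e-7 ltac:(lra) ltac:(lra) F1 E1
     ltac:(rewrite Rmult_1_l; lra)).
  assert (G2 := Q 1 ((4 * s) ^ 5 / 5) 0.245 ((4 * s) ^ 5 / 5) 3%nat 4e-12 ltac:(lra) ltac:(nra) F2 E2
     ltac:(nra)).
  assert (HP5 : 0 <= PI ^ 5 / 5 <= 4 ^ 5 / 5).
  { assert (PI ^ 5 <= 4 ^ 5) by (apply pow_incr; lra).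
    assert (0 < PI ^ 5) by (apply pow_lt; lra). lra. }
  assert (G3 := Q 4 (PI ^ 5 / 5) 0.461 (4 ^ 5 / 5) 8%nat 3e-22 ltac:(lra) ltac:(lra) F3 E3 HP5).
  assert (Hs8 : s ^ 8 <= 0.09623 * k ^ 15).
  { rewrite Hsk; replace ((k ^ 2) ^ 8) with (k * k ^ 15) by ring.
    apply Rmult_le_compat_r; [apply pow_le; lra|trivial]. }
  assert (0 < s ^ 8) by (apply pow_lt; lra).
  lra.
Qed.

Lemma tail_bound :
  RInt (fun t => wgt s J t * t ^ 4) (k ^ 3 * 2.5) PI <= 0.27 * k ^ 15.
Proof.
  assert (Hf : forall t, continuous (fun t => wgt s J t * t ^ 4) t).
  { apply (continuous_mult_R (wgt s J) (fun t => t ^ 4)).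
    - intros; apply continuous_wgt; lra.
    - intros; apply continuous_pow. }
  rewrite (RInt_Chasles_R _ _ (k ^ 3 * 6)), (RInt_Chasles_R _ (k ^ 3 * 6) (0.6 * s)) by trivial.
  pose proof tail_near; pose proof tail_mid; pose proof tail_far.
  assert (0 < k ^ 15) by (apply pow_lt; trivial). lra.
Qed.

End Scaled.

(** * Positivity of the determinant above 10000 *)

Definition BR (a0 a1 a2 a3 a4 : R) : R :=
  - (a0 * a2 * a4) + a2 ^ 3 + a0 * a3 ^ 2 + a1 ^ 2 * a4 - 2 * a1 * a2 * a3.

(* [BR] is the determinant of a Toeplitz matrix; if its symmetric part is positive definite,
   then so is the determinant, since [det (S + K) = det S + x^T S x] for skew [K] with axial vector [x]. *)
Lemma BR_pos_of_sym (a0 a1 a2 a3 a4 : R) :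
  let s1 := (a1 + a3) / 2 in let s2 := (a0 + a4) / 2 in
  0 < a2 -> 0 < a2 - s2 -> 0 < a2 * (a2 + s2) - 2 * s1 ^ 2 -> 0 < BR a0 a1 a2 a3 a4.
Proof.
  intros s1 s2 H0 H2 HE.
  set (k1 := (a3 - a1) / 2); set (k2 := (a4 - a0) / 2).
  assert (E : BR a0 a1 a2 a3 a4 = (a2 - s2) * (a2 * (a2 + s2) - 2 * s1 ^ 2) +
     (2 * (a2 + s2) * k1 ^ 2 - 4 * s1 * k1 * k2 + a2 * k2 ^ 2))
    by (unfold BR, s1, s2, k1, k2; field).
  assert (Q : 0 <= 2 * (a2 + s2) * k1 ^ 2 - 4 * s1 * k1 * k2 + a2 * k2 ^ 2).
  { apply Rmult_le_reg_l with a2; [trivial|]. rewrite Rmult_0_r.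
    replace (a2 * (2 * (a2 + s2) * k1 ^ 2 - 4 * s1 * k1 * k2 + a2 * k2 ^ 2))
      with ((a2 * k2 - 2 * s1 * k1) ^ 2 + 2 * k1 ^ 2 * (a2 * (a2 + s2) - 2 * s1 ^ 2)) by ring.
    apply Rplus_le_le_0_compat; [apply pow2_ge_0|].
    apply Rmult_le_pos; [pose proof (pow2_ge_0 k1)|]; lra. }
  rewrite E; pose proof (Rmult_lt_0_compat _ _ H2 HE); lra.
Qed.

Lemma RInt_even (f : R -> R) (a : R) :
  (forall t, continuous f t) -> (forall t, f (- t) = f t) ->
  RInt f (- a) a = 2 * RInt f 0 a.
Proof.
  intros Hf He; rewrite (RInt_Chasles_R f (- a) 0 a) by trivial.
  assert (E : RInt f 0 a = RInt f (- a) 0); [|rewrite E; apply Rplus_diag].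
  assert (H : is_RInt f (- a) (- 0) (RInt f (- a) 0)).
  { rewrite Ropp_0; apply (RInt_correct (V := R_CompleteNormedModule)), ex_RInt_all; trivial. }
  apply (is_RInt_comp_opp (V := R_NormedModule)), (is_RInt_swap (V := R_NormedModule)),
    (is_RInt_opp (V := R_NormedModule)) in H.
  apply is_RInt_unique.
  rewrite opp_opp in H.
  refine (is_RInt_ext _ _ _ _ _ _ H); intros t _.
  rewrite opp_opp; apply He.
Qed.

(** * Moments of the weight and the symmetric part *)

Section Positivity.
Variables (k s : R) (J : nat).
Hypothesis Hk : 0 < k.
Hypothesis Hsk : s = k ^ 2.
Hypothesis Hs : s <= / 108.
Hypothesis HJ : 10000 <= INR J * s ^ 2.

Let s_pos : 0 < s.
Proof. rewrite Hsk; apply pow_lt; trivial. Qed.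

Let k_small : k <= 0.09623.
Proof. rewrite Hsk in Hs; nra. Qed.

Let Hw : forall t, continuous (wgt s J) t.
Proof. intros; apply continuous_wgt; trivial. Qed.

Let Hm : forall t, continuous (minor s J) t.
Proof. intros; apply continuous_wgt_cos; trivial. Qed.

Let vers (t : R) : R := 1 - cos t.

Let continuous_vers (t : R) : continuous vers t.
Proof. apply (ex_derive_continuous (V := R_NormedModule)); unfold vers; auto_derive; trivial. Qed.

Let csum (p : R -> R) : R :=
  rsum (fun i => cval i * RInt p (k ^ 3 * (INR i / 4)) (k ^ 3 * (INR (S i) / 4))) 10.
Let tint (p : R -> R) : R := RInt (fun t => wgt s J t * p t) (k ^ 3 * 2.5) PI.

Let cut_pos : 0 < k ^ 3 * 2.5 < 0.0023.
Proof.
  assert (0 < k ^ 3) by (apply pow_lt; trivial).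
  assert (k ^ 3 <= 0.09623 ^ 3) by (apply pow_incr; lra). lra.
Qed.

Let pi_gt : 3 < PI.
Proof. pose proof PI2_3_2; lra. Qed.

(** [csum] integrates against the step function of the centre, [tint] against the full weight on the
    tail, where only [cos >= -1] is used. Their difference is linear in [p], so the bound applies to
    squares of polynomials in [vers] as well. *)
Let minor_int_ge (p : R -> R) :
  (forall t, continuous p t) -> (forall t, 0 <= p t) ->
  csum p - tint p <= RInt (fun t => minor s J t * p t) 0 PI.
Proof.
  intros Hp Hp0.
  assert (Hmp := continuous_mult_R _ _ Hm Hp).
  rewrite (RInt_Chasles_R (fun t => minor s J t * p t) 0 (k ^ 3 * 2.5) PI) by trivial.
  assert (Hk3 : 0 < k ^ 3) by (apply pow_lt; trivial).
  assert (C : csum p <= RInt (fun t => minor s J t * p t) 0 (k ^ 3 * 2.5)).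
  { pose proof (steps_le (minor s J) p cval (fun i => k ^ 3 * (INR i / 4)) 10 Hm Hp Hp0) as H.
    cbv beta in H.
    replace (k ^ 3 * (INR 0 / 4)) with 0 in H by (simpl INR; lra).
    replace (k ^ 3 * (INR 10 / 4)) with (k ^ 3 * 2.5) in H by (simpl INR; lra).
    apply H.
    - intros i _; rewrite S_INR; apply Rmult_le_compat_l; lra.
    - intros i t Hi Ht; apply (minor_center k); trivial. }
  assert (T : - tint p <= RInt (fun t => minor s J t * p t) (k ^ 3 * 2.5) PI).
  { unfold tint; replace (- RInt (fun t => wgt s J t * p t) (k ^ 3 * 2.5) PI)
      with ((-1) * RInt (fun t => wgt s J t * p t) (k ^ 3 * 2.5) PI) by ring.
    assert (Hwp := continuous_mult_R _ _ Hw Hp).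
    rewrite <- RInt_scal_R by trivial.
    apply RInt_nonneg_le; trivial; [lra| |].
    - intros t; apply (continuous_mult_R (fun _ => -1) (fun t => wgt s J t * p t)); trivial.
      intros; apply continuous_const.
    - intros t _; unfold minor; pose proof (wgt_pos s J t); pose proof (Hp0 t).
      pose proof (COS_bound (devphase s J t)).
      assert (0 <= wgt s J t * p t) by nra. nra. }
  lra.
Qed.

Let tint_le (p : R -> R) (c : R) :
  (forall t, continuous p t) -> 0 <= c ->
  (forall t, k ^ 3 * 2.5 <= t <= PI -> p t <= c * t ^ 4) ->
  tint p <= c * (0.27 * k ^ 15).
Proof.
  intros Hp Hc H.
  assert (H4 : forall t, continuous (fun t => wgt s J t * t ^ 4) t).
  { apply (continuous_mult_R (wgt s J) (fun t => t ^ 4)); trivial.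
    intros; apply continuous_pow. }
  apply Rle_trans with (c * RInt (fun t => wgt s J t * t ^ 4) (k ^ 3 * 2.5) PI).
  - rewrite <- RInt_scal_R by trivial; unfold tint.
    apply RInt_nonneg_le; [lra| | |].
    + apply continuous_mult_R; trivial.
    + intros t; apply (continuous_mult_R (fun _ => c) (fun t => wgt s J t * t ^ 4)); trivial.
      intros; apply continuous_const.
    + intros t Ht; specialize (H t Ht); pose proof (wgt_pos s J t). nra.
  - apply Rmult_le_compat_l; trivial. apply tail_bound; trivial.
Qed.

Let vers_le (t : R) : 0 <= t -> 0 <= vers t <= t ^ 2 / 2.
Proof.
  intros Ht; unfold vers; pose proof (one_sub_cos_le t Ht); pose proof (COS_bound t); lra.
Qed.

Let vers_ge (t : R) : 0 <= t <= k ^ 3 * 2.5 -> 0.49999 * t ^ 2 <= vers t.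
Proof.
  intros Ht; unfold vers; pose proof (one_sub_cos_ge t ltac:(lra)).
  assert (t ^ 2 <= 0.0023 ^ 2) by (apply pow_incr; lra).
  pose proof (pow2_ge_0 t).
  assert (t ^ 4 <= t ^ 2 * 0.0023 ^ 2)
    by (replace (t ^ 4) with (t ^ 2 * t ^ 2) by ring; apply Rmult_le_compat_l; lra).
  lra.
Qed.

Let csum_le (p : R -> R) (n : nat) (c : R) :
  (forall t, continuous p t) ->
  (forall t, 0 <= t <= k ^ 3 * 2.5 -> p t <= c * t ^ n) ->
  csum p <= c * csum (fun t => t ^ n).
Proof.
  intros Hp H; unfold csum; rewrite <- rsum_scal.
  assert (Hk3 : 0 < k ^ 3) by (apply pow_lt; trivial).
  assert (G : forall m, (m <= 10)%nat ->
    rsum (fun i => cval i * RInt p (k ^ 3 * (INR i / 4)) (k ^ 3 * (INR (S i) / 4))) m <=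
    rsum (fun i => c * (cval i * RInt (fun t => t ^ n) (k ^ 3 * (INR i / 4)) (k ^ 3 * (INR (S i) / 4)))) m);
    [|apply G; lia].
  induction m as [|m IH]; intros Hm10; cbn [rsum]; [lra|].
  apply Rplus_le_compat; [apply IH; lia|].
  replace (c * (cval m * RInt (fun t => t ^ n) (k ^ 3 * (INR m / 4)) (k ^ 3 * (INR (S m) / 4))))
    with (cval m * (c * RInt (fun t => t ^ n) (k ^ 3 * (INR m / 4)) (k ^ 3 * (INR (S m) / 4)))) by ring.
  apply Rmult_le_compat_l; [apply cval_le; lia|].
  rewrite <- RInt_scal_R by (intros; apply continuous_pow).
  assert (INR (S m) <= 10) by (replace 10 with (INR 10) by (simpl INR; lra); apply le_INR; lia).
  assert (0 <= INR m) by apply pos_INR.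
  assert (0 <= k ^ 3 * (INR m / 4)) by (apply Rmult_le_pos; lra).
  assert (k ^ 3 * (INR (S m) / 4) <= k ^ 3 * 2.5) by (apply Rmult_le_compat_l; lra).
  apply RInt_nonneg_le; trivial.
  - rewrite S_INR; apply Rmult_le_compat_l; lra.
  - intros t; apply (continuous_mult_R (fun _ => c) (fun t => t ^ n)).
    + intros; apply continuous_const.
    + intros; apply continuous_pow.
  - intros t Ht; apply H; lra.
Qed.

Let csum_ge (p : R -> R) (n : nat) (c : R) :
  (forall t, continuous p t) ->
  (forall t, 0 <= t <= k ^ 3 * 2.5 -> c * t ^ n <= p t) ->
  c * csum (fun t => t ^ n) <= csum p.
Proof.
  intros Hp H.
  assert (G : csum (fun t => (-1) * p t) <= - c * csum (fun t => t ^ n)).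
  { apply csum_le.
    - intros t; apply (continuous_mult_R (fun _ => -1) p); trivial.
      intros; apply continuous_const.
    - intros t Ht; specialize (H t Ht); lra. }
  assert (E : csum (fun t => (-1) * p t) = (-1) * csum p).
  { unfold csum; rewrite <- rsum_scal; apply rsum_ext; intros i.
    rewrite RInt_scal_R by trivial; ring. }
  lra.
Qed.

Let csum_pow :
  csum (fun t => t ^ 0) = 0.82645 * k ^ 3 /\
  0.40439 * k ^ 9 <= csum (fun t => t ^ 2) <= 0.4044 * k ^ 9 /\
  0.57393 * k ^ 15 <= csum (fun t => t ^ 4).
Proof.
  assert (0 < k ^ 9) by (apply pow_lt; trivial).
  assert (0 < k ^ 15) by (apply pow_lt; trivial).
  unfold csum; cbn [rsum]; rewrite !RInt_pow_R; unfold cval; simpl nth; simpl INR.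
  repeat split; lra.
Qed.

(** This is [(vers t - c)^2], expanded for the linearity of the integral. *)
Let quad_poly (c t : R) : R := 1 * vers t ^ 2 + ((- 2 * c) * vers t ^ 1 + c ^ 2 * vers t ^ 0).

Let continuous_vers_pow (n : nat) (t : R) : continuous (fun x => vers x ^ n) t.
Proof.
  apply (continuous_comp vers (fun x => x ^ n)); [apply continuous_vers|apply continuous_pow].
Qed.

Let continuous_scal_vers (a : R) (n : nat) (t : R) : continuous (fun x => a * vers x ^ n) t.
Proof.
  apply (continuous_mult_R (fun _ => a) (fun x => vers x ^ n)).
  - intros; apply continuous_const.
  - intros; apply continuous_vers_pow.
Qed.

Let continuous_quad (c t : R) : continuous (quad_poly c) t.
Proof.
  apply (continuous_plus (fun t => 1 * vers t ^ 2) (fun t => (- 2 * c) * vers t ^ 1 + c ^ 2 * vers t ^ 0)).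
  - apply continuous_scal_vers.
  - apply (continuous_plus (fun t => (- 2 * c) * vers t ^ 1) (fun t => c ^ 2 * vers t ^ 0));
      apply continuous_scal_vers.
Qed.

Let RInt_quad (f : R -> R) (a b c : R) :
  (forall t, continuous f t) ->
  RInt (fun t => f t * quad_poly c t) a b =
  RInt (fun t => f t * vers t ^ 2) a b - 2 * c * RInt (fun t => f t * vers t ^ 1) a b
    + c ^ 2 * RInt (fun t => f t * vers t ^ 0) a b.
Proof.
  intros Hf.
  assert (Hfv : forall n t, continuous (fun x => f x * vers x ^ n) t).
  { intros n; apply (continuous_mult_R f (fun x => vers x ^ n)); trivial. }
  assert (Hfs : forall d n t, continuous (fun x => d * (f x * vers x ^ n)) t).
  { intros d n; apply (continuous_mult_R (fun _ => d) (fun x => f x * vers x ^ n)); trivial.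
    intros; apply continuous_const. }
  rewrite (RInt_ext _ (fun t => f t * vers t ^ 2 +
     ((- 2 * c) * (f t * vers t ^ 1) + c ^ 2 * (f t * vers t ^ 0)))).
  - rewrite (RInt_plus_R (fun t => f t * vers t ^ 2)); [|trivial|].
    + rewrite (RInt_plus_R (fun t => (- 2 * c) * (f t * vers t ^ 1))) by trivial.
      rewrite !RInt_scal_R by trivial. lra.
    + intros t; apply (continuous_plus (fun t => (- 2 * c) * (f t * vers t ^ 1))
                         (fun t => c ^ 2 * (f t * vers t ^ 0))); apply Hfs.
  - intros t _; unfold quad_poly; simpl; ring.
Qed.

Let csum_quad (c : R) :
  csum (quad_poly c) = csum (fun t => vers t ^ 2) - 2 * c * csum (fun t => vers t ^ 1)
    + c ^ 2 * csum (fun t => vers t ^ 0).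
Proof.
  unfold csum.
  replace (rsum (fun i => cval i * RInt (fun t => vers t ^ 2) (k ^ 3 * (INR i / 4)) (k ^ 3 * (INR (S i) / 4))) 10
    - 2 * c * rsum (fun i => cval i * RInt (fun t => vers t ^ 1) (k ^ 3 * (INR i / 4)) (k ^ 3 * (INR (S i) / 4))) 10
    + c ^ 2 * rsum (fun i => cval i * RInt (fun t => vers t ^ 0) (k ^ 3 * (INR i / 4)) (k ^ 3 * (INR (S i) / 4))) 10)
  with (rsum (fun i => cval i * RInt (fun t => vers t ^ 2) (k ^ 3 * (INR i / 4)) (k ^ 3 * (INR (S i) / 4))) 10
    + ((- 2 * c) * rsum (fun i => cval i * RInt (fun t => vers t ^ 1) (k ^ 3 * (INR i / 4)) (k ^ 3 * (INR (S i) / 4))) 10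
    + c ^ 2 * rsum (fun i => cval i * RInt (fun t => vers t ^ 0) (k ^ 3 * (INR i / 4)) (k ^ 3 * (INR (S i) / 4))) 10))
    by ring.
  rewrite <- !rsum_scal, <- !rsum_plus; apply rsum_ext; intros i.
  set (a := k ^ 3 * (INR i / 4)); set (b := k ^ 3 * (INR (S i) / 4)).
  pose proof (RInt_quad (fun _ => 1) a b c (fun t => continuous_const _ _)) as H.
  rewrite (RInt_ext _ (quad_poly c)) in H by (intros; apply Rmult_1_l).
  rewrite (RInt_ext (fun t => 1 * vers t ^ 2) (fun t => vers t ^ 2)) in H by (intros; apply Rmult_1_l).
  rewrite (RInt_ext (fun t => 1 * vers t ^ 1) (fun t => vers t ^ 1)) in H by (intros; apply Rmult_1_l).
  rewrite (RInt_ext (fun t => 1 * vers t ^ 0) (fun t => vers t ^ 0)) in H by (intros; apply Rmult_1_l).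
  rewrite H; ring.
Qed.

Let mom (n : nat) : R := RInt (fun t => minor s J t * vers t ^ n) 0 PI.

Let tint_pow :
  tint (fun t => vers t ^ 0) <= 0.007 * k ^ 3 /\
  0 <= tint (fun t => vers t ^ 1) <= 0.0217 * k ^ 9 /\
  tint (fun t => vers t ^ 2) <= 0.0675 * k ^ 15.
Proof.
  assert (Hk3 : 0 < k ^ 3) by (apply pow_lt; trivial).
  set (i := / k ^ 3).
  assert (Hi : 0 < i) by (apply Rinv_0_lt_compat; trivial).
  assert (E : i * k ^ 3 = 1) by (apply Rinv_l; lra).
  (* Since [0.4 = 1 / 2.5], the factor [(0.4 t / k^3)^2] is at least 1 beyond the cut and raises the
     degree in [t] by two. *)
  assert (P : forall t, k ^ 3 * 2.5 <= t -> 1 <= t ^ 2 * (0.4 * i) ^ 2).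
  { intros t Ht; rewrite <- Rpow_mult_distr.
    assert (1 <= t * (0.4 * i)) by nra.
    nra. }
  repeat split.
  - eapply Rle_trans; [apply (tint_le _ ((0.4 * i) ^ 4))|].
    + apply continuous_vers_pow.
    + apply pow_le; lra.
    + intros t Ht; simpl (vers t ^ 0); specialize (P t ltac:(lra)).
      replace ((0.4 * i) ^ 4 * t ^ 4) with ((t ^ 2 * (0.4 * i) ^ 2) * (t ^ 2 * (0.4 * i) ^ 2)) by ring.
      nra.
    + replace ((0.4 * i) ^ 4 * (0.27 * k ^ 15)) with (0.4 ^ 4 * 0.27 * (i * k ^ 3) ^ 4 * k ^ 3) by ring.
      rewrite E; lra.
  - unfold tint; apply RInt_ge_0; [lra| |].
    + apply ex_RInt_all, (continuous_mult_R (wgt s J) (fun t => vers t ^ 1)); trivial.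
    + intros t Ht; rewrite pow_1; apply Rmult_le_pos; [apply Rlt_le, wgt_pos|apply vers_le; lra].
  - eapply Rle_trans; [apply (tint_le _ ((0.4 * i) ^ 2 / 2))|].
    + apply continuous_vers_pow.
    + pose proof (pow2_ge_0 (0.4 * i)); lra.
    + intros t Ht; rewrite pow_1; specialize (P t ltac:(lra)).
      pose proof (vers_le t ltac:(lra)).
      replace ((0.4 * i) ^ 2 / 2 * t ^ 4) with ((t ^ 2 * (0.4 * i) ^ 2) * (t ^ 2 / 2)) by (unfold Rdiv; ring).
      nra.
    + replace ((0.4 * i) ^ 2 / 2 * (0.27 * k ^ 15)) with (0.4 ^ 2 / 2 * 0.27 * (i * k ^ 3) ^ 2 * k ^ 9)
        by (unfold Rdiv; ring).
      assert (0 < k ^ 9) by (apply pow_lt; trivial).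
      rewrite E; lra.
  - eapply Rle_trans; [apply (tint_le _ (/ 4))|].
    + apply continuous_vers_pow.
    + lra.
    + intros t Ht; pose proof (vers_le t ltac:(lra)).
      replace (/ 4 * t ^ 4) with ((t ^ 2 / 2) ^ 2) by field. apply pow_incr; lra.
    + lra.
Qed.

Let low0 := csum (fun t => vers t ^ 0) - tint (fun t => vers t ^ 0).
Let low1 := csum (fun t => vers t ^ 1) - tint (fun t => vers t ^ 1).
Let low2 := csum (fun t => vers t ^ 2) - tint (fun t => vers t ^ 2).

(** [low1] needs an upper bound, for which the tail part is dropped as nonnegative. The largest
    relative loss is in [low2], where the tail takes 0.0675 out of about 0.143. *)
Let low_bounds :
  0.819 * k ^ 3 <= low0 /\ 0 <= low1 <= 0.2023 * k ^ 9 /\ 0.075 * k ^ 15 <= low2.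
Proof.
  destruct csum_pow as (C0 & C2 & C4); destruct tint_pow as (T0 & T1 & T2).
  assert (0 < k ^ 3) by (apply pow_lt; trivial).
  assert (0 < k ^ 9) by (apply pow_lt; trivial).
  assert (0 < k ^ 15) by (apply pow_lt; trivial).
  assert (D1 : csum (fun t => vers t ^ 1) <= / 2 * csum (fun t => t ^ 2)).
  { apply csum_le; [apply continuous_vers_pow|].
    intros t Ht; rewrite pow_1; pose proof (vers_le t ltac:(lra)); lra. }
  assert (D1' : 0.49999 * csum (fun t => t ^ 2) <= csum (fun t => vers t ^ 1)).
  { apply csum_ge; [apply continuous_vers_pow|].
    intros t Ht; rewrite pow_1; apply vers_ge; trivial. }
  assert (D2 : 0.2499 * csum (fun t => t ^ 4) <= csum (fun t => vers t ^ 2)).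
  { apply csum_ge; [apply continuous_vers_pow|].
    intros t Ht; pose proof (vers_ge t Ht) as Hv.
    apply Rle_trans with ((0.49999 * t ^ 2) ^ 2).
    - assert (0 <= t ^ 4) by (apply pow_le; lra).
      replace ((0.49999 * t ^ 2) ^ 2) with (0.49999 ^ 2 * t ^ 4) by ring. lra.
    - apply pow_incr; pose proof (pow2_ge_0 t); lra. }
  unfold low0, low1, low2.
  change (fun t => vers t ^ 0) with (fun t : R => t ^ 0) in *.
  repeat split; lra.
Qed.

(** Bounding the moments one by one fails, because [mom 1] enters with the wrong sign. Instead the
    quadratic forms in [c] are compared: the lower one is positive by its discriminant, and
    [c = mom 1 / mom 0], the minimum of the upper one, yields the strict inequality. *)
Let mom_gram : 0 < mom 0 /\ mom 1 ^ 2 < mom 0 * mom 2.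
Proof.
  destruct low_bounds as (L0 & L1 & L2).
  assert (k3 : 0 < k ^ 3) by (apply pow_lt; trivial).
  assert (k9 : 0 < k ^ 9) by (apply pow_lt; trivial).
  assert (k15 : 0 < k ^ 15) by (apply pow_lt; trivial).
  assert (k18 : 0 < k ^ 18) by (apply pow_lt; trivial).
  assert (Hdet : low1 ^ 2 < low0 * low2).
  { apply Rle_lt_trans with ((0.2023 * k ^ 9) ^ 2); [apply pow_incr; lra|].
    apply Rlt_le_trans with ((0.819 * k ^ 3) * (0.075 * k ^ 15)).
    - replace ((0.2023 * k ^ 9) ^ 2) with (0.2023 ^ 2 * k ^ 18) by ring.
      replace ((0.819 * k ^ 3) * (0.075 * k ^ 15)) with (0.819 * 0.075 * k ^ 18) by ring. lra.
    - apply Rmult_le_compat; lra. }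
  assert (HT0 : low0 <= mom 0).
  { apply minor_int_ge; [apply continuous_vers_pow|]. intros; simpl; lra. }
  assert (Hc : forall c, low2 - 2 * c * low1 + c ^ 2 * low0 <= mom 2 - 2 * c * mom 1 + c ^ 2 * mom 0).
  { intros c.
    assert (G := minor_int_ge (quad_poly c) (continuous_quad c)).
    unfold tint in G; rewrite (RInt_quad (minor s J)), (RInt_quad (wgt s J)), csum_quad in G by trivial.
    unfold low0, low1, low2, mom, tint.
    assert (G' := G ltac:(intros t; replace (quad_poly c t) with ((vers t - c) ^ 2)
      by (unfold quad_poly; ring); apply pow2_ge_0)).
    lra. }
  assert (H0 : 0 < low0) by lra.
  split; [lra|].
  specialize (Hc (mom 1 / mom 0)).
  set (c := mom 1 / mom 0) in *.
  assert (Ec : mom 1 = c * mom 0) by (unfold c; field; lra).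
  assert (Hq : 0 < low2 - 2 * c * low1 + c ^ 2 * low0).
  { apply Rmult_lt_reg_l with low0; [trivial|]. rewrite Rmult_0_r.
    replace (low0 * (low2 - 2 * c * low1 + c ^ 2 * low0))
      with ((c * low0 - low1) ^ 2 + (low0 * low2 - low1 ^ 2)) by ring.
    pose proof (pow2_ge_0 (c * low0 - low1)); lra. }
  rewrite Ec in *.
  replace ((c * mom 0) ^ 2) with (mom 0 * (c ^ 2 * mom 0)) by ring.
  apply Rmult_lt_compat_l; lra.
Qed.

(** A quarter of [a2 - s2]: the symmetric part on the antisymmetric vector [(1, 0, -1)], up to a
    factor. *)
Let sin2_int_pos : 0 < RInt (fun t => minor s J t * sin t ^ 2) 0 PI.
Proof.
  assert (Hc : forall t, continuous (fun t => sin t ^ 2) t).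
  { intros t; apply (ex_derive_continuous (V := R_NormedModule)); auto_derive; trivial. }
  destruct csum_pow as (_ & C2 & _).
  assert (Hk3 : 0 < k ^ 3) by (apply pow_lt; trivial).
  assert (Hk9 : 0 < k ^ 9) by (apply pow_lt; trivial).
  set (i := / k ^ 3).
  assert (Hi : 0 < i) by (apply Rinv_0_lt_compat; trivial).
  assert (E : i * k ^ 3 = 1) by (apply Rinv_l; lra).
  assert (D : 0.99 * csum (fun t => t ^ 2) <= csum (fun t => sin t ^ 2)).
  { apply csum_ge; trivial; intros t Ht.
    pose proof (sin_ge_cubic t ltac:(lra)) as Hsin.
    assert (t ^ 2 <= 0.0023 ^ 2) by (apply pow_incr; lra).
    assert (t * t ^ 2 <= t * 0.0023 ^ 2) by (apply Rmult_le_compat_l; lra).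
    replace (t ^ 3) with (t * t ^ 2) in Hsin by ring.
    apply Rle_trans with ((0.999 * t) ^ 2); [|apply pow_incr; lra].
    pose proof (pow2_ge_0 t).
    replace ((0.999 * t) ^ 2) with (0.999 ^ 2 * t ^ 2) by ring. lra. }
  assert (T : tint (fun t => sin t ^ 2) <= (0.4 * i) ^ 2 * (0.27 * k ^ 15)).
  { apply tint_le; trivial; [apply pow2_ge_0|]. intros t Ht.
    pose proof (sin_le_id t ltac:(lra)).
    assert (0 <= sin t) by (apply sin_ge_0; lra).
    assert (sin t ^ 2 <= t ^ 2) by (apply pow_incr; lra).
    assert (1 <= t ^ 2 * (0.4 * i) ^ 2).
    { rewrite <- Rpow_mult_distr. assert (1 <= t * (0.4 * i)) by nra. nra. }
    replace ((0.4 * i) ^ 2 * t ^ 4) with ((t ^ 2 * (0.4 * i) ^ 2) * t ^ 2) by ring.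
    pose proof (pow2_ge_0 t). nra. }
  replace ((0.4 * i) ^ 2 * (0.27 * k ^ 15)) with (0.4 ^ 2 * 0.27 * (i * k ^ 3) ^ 2 * k ^ 9) in T by ring.
  rewrite E in T.
  pose proof (minor_int_ge (fun t => sin t ^ 2) Hc (fun t => pow2_ge_0 _)). lra.
Qed.

Let wgt_even (t : R) : wgt s J (- t) = wgt s J t.
Proof.
  unfold wgt, gexp; do 2 f_equal; apply rsum_ext; intros i; unfold zfac.
  replace (oddr i * - t) with (- (oddr i * t)) by ring. now rewrite cos_neg.
Qed.

Let devphase_odd (t : R) : devphase s J (- t) = - devphase s J t.
Proof.
  unfold devphase.
  assert (E : phase s J (- t) = - phase s J t); [|rewrite E; ring].
  unfold phase.
  replace (- rsum (fun i => arg1 (rho s i) (oddr i * t)) J)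
    with ((-1) * rsum (fun i => arg1 (rho s i) (oddr i * t)) J) by ring.
  rewrite <- rsum_scal; apply rsum_ext; intros i; unfold arg1.
  replace (oddr i * - t) with (- (oddr i * t)) by ring.
  rewrite cos_neg, sin_neg.
  replace (rho s i * - sin (oddr i * t) / (1 - rho s i * cos (oddr i * t)))
    with (- (rho s i * sin (oddr i * t) / (1 - rho s i * cos (oddr i * t)))) by (unfold Rdiv; ring).
  rewrite atan_opp; ring.
Qed.

Let minor_even (t : R) : minor s J (- t) = minor s J t.
Proof. unfold minor; now rewrite wgt_even, devphase_odd, cos_neg. Qed.

(** Adding the indices [N - j] and [N + j] cancels the products of sines; the remaining integrand is
    even. *)
Let fcoef_sym (N j : Z) :
  cum1 s J = IZR N ->
  fcoef s J (N - j) + fcoef s J (N + j) = 4 * RInt (fun t => minor s J t * cos (IZR j * t)) 0 PI.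
Proof.
  intros HN; unfold fcoef.
  assert (Hcj : forall t, continuous (fun t => cos (IZR j * t)) t).
  { intros t; apply (ex_derive_continuous (V := R_NormedModule)); auto_derive; trivial. }
  assert (Hmc := continuous_mult_R _ _ Hm Hcj).
  rewrite <- RInt_plus_R by (intros; apply continuous_wgt_cos; trivial).
  rewrite (RInt_ext _ (fun t => 2 * (minor s J t * cos (IZR j * t)))).
  - rewrite RInt_scal_R, RInt_even by (trivial; intros t; rewrite minor_even;
      replace (IZR j * - t) with (- (IZR j * t)) by ring; now rewrite cos_neg).
    ring.
  - intros t _; unfold minor, devphase; rewrite HN, minus_IZR, plus_IZR.
    replace (phase s J t - (IZR N - IZR j) * t) with (phase s J t - IZR N * t + IZR j * t) by ring.
    replace (phase s J t - (IZR N + IZR j) * t) with (phase s J t - IZR N * t - IZR j * t) by ring.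
    set (d := phase s J t - IZR N * t); rewrite cos_plus, cos_minus.
    change (wgt s J t * (cos d * cos (IZR j * t) - sin d * sin (IZR j * t)) +
      wgt s J t * (cos d * cos (IZR j * t) + sin d * sin (IZR j * t)) =
      2 * (wgt s J t * cos d * cos (IZR j * t))). ring.
Qed.

Lemma BR_fcoef_pos (N : Z) :
  cum1 s J = IZR N ->
  0 < BR (fcoef s J (N - 2)) (fcoef s J (N - 1)) (fcoef s J N)
         (fcoef s J (N + 1)) (fcoef s J (N + 2)).
Proof.
  intros HN.
  destruct mom_gram as [H0 H1]; pose proof sin2_int_pos as HS.
  assert (Hv : forall n t, continuous (fun t => minor s J t * vers t ^ n) t).
  { intros n; apply (continuous_mult_R (minor s J) (fun t => vers t ^ n)); trivial. }
  assert (Hvs : forall d n t, continuous (fun t => d * (minor s J t * vers t ^ n)) t).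
  { intros d n; apply (continuous_mult_R (fun _ => d) (fun t => minor s J t * vers t ^ n)); trivial.
    intros; apply continuous_const. }
  assert (lin : forall a b c, RInt (fun t => a * (minor s J t * vers t ^ 0) +
     (b * (minor s J t * vers t ^ 1) + c * (minor s J t * vers t ^ 2))) 0 PI =
     a * mom 0 + (b * mom 1 + c * mom 2)).
  { intros a b c; rewrite (RInt_plus_R (fun t => a * (minor s J t * vers t ^ 0))), RInt_scal_R; trivial.
    - rewrite (RInt_plus_R (fun t => b * (minor s J t * vers t ^ 1))), !RInt_scal_R; trivial.
    - intros t; apply (continuous_plus (fun t => b * (minor s J t * vers t ^ 1))
        (fun t => c * (minor s J t * vers t ^ 2))); apply Hvs. }
  assert (F0 : fcoef s J N = 2 * mom 0).
  { pose proof (fcoef_sym N 0 HN) as E; rewrite Z.sub_0_r, Z.add_0_r in E.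
    rewrite (RInt_ext _ (fun t => minor s J t * vers t ^ 0)) in E
      by (intros; rewrite Rmult_0_l, cos_0; reflexivity).
    fold (mom 0) in E; lra. }
  assert (F1 : fcoef s J (N - 1) + fcoef s J (N + 1) = 4 * (mom 0 - mom 1)).
  { rewrite (fcoef_sym N 1 HN); f_equal.
    replace (mom 0 - mom 1) with (1 * mom 0 + ((-1) * mom 1 + 0 * mom 2)) by ring.
    rewrite <- lin; apply RInt_ext; intros t _; unfold vers; rewrite Rmult_1_l.
    simpl; ring. }
  assert (F2 : fcoef s J (N - 2) + fcoef s J (N + 2) = 4 * (mom 0 - 4 * mom 1 + 2 * mom 2)).
  { rewrite (fcoef_sym N 2 HN); f_equal.
    replace (mom 0 - 4 * mom 1 + 2 * mom 2) with (1 * mom 0 + ((-4) * mom 1 + 2 * mom 2)) by ring.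
    rewrite <- lin; apply RInt_ext; intros t _; unfold vers; rewrite cos_2a_cos.
    simpl; ring. }
  assert (F3 : RInt (fun t => minor s J t * sin t ^ 2) 0 PI = 2 * mom 1 - mom 2).
  { replace (2 * mom 1 - mom 2) with (0 * mom 0 + (2 * mom 1 + (-1) * mom 2)) by ring.
    rewrite <- lin; apply RInt_ext; intros t _; unfold vers.
    assert (Hsc := sin2_cos2 t); unfold Rsqr in Hsc.
    replace (sin t ^ 2) with (1 - cos t ^ 2) by (simpl; lra). simpl; ring. }
  rewrite F3 in HS.
  (* From [cos t = 1 - vers t] and [cos (2 t) = 1 - 4 vers t + 2 vers t ^ 2]:
     [a2 - s2 = 4 (2 T1 - T2)] and [a2 (a2 + s2) - 2 s1^2 = 8 (T0 T2 - T1^2)], with [Tk = mom k]. *)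
  apply BR_pos_of_sym; rewrite ?F0, ?F1, ?F2; nra.
Qed.
End Positivity.

(** * Existence of the saddle point and removal of the tilt *)

Lemma cum1_continuous (J : nat) (s : R) : 0 < s -> continuity_pt (fun s => cum1 s J) s.
Proof.
  intros Hs; apply continuity_pt_filterlim.
  apply (continuous_rsum (fun i s => oddr i * geo1 (rho s i))); intros i.
  apply (ex_derive_continuous (V := R_NormedModule)).
  pose proof (rho_bounds s i Hs) as H.
  unfold geo1, rho in *; auto_derive; lra.
Qed.

(** The factor [l = 1] alone gives this bound. *)
Lemma cum1_large (J : nat) (s : R) : (0 < J)%nat -> 0 < s -> / s - / 2 <= cum1 s J.
Proof.
  intros HJ Hs; destruct J as [|J]; [lia|]; clear HJ.
  induction J as [|J IH].
  - unfold cum1; simpl; unfold rho, oddr; simpl.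
    replace (2 * 0 + 1) with 1 by ring; rewrite !Rmult_1_l.
    pose proof (geo1_ge s Hs); lra.
  - unfold cum1 in *; simpl rsum in *.
    pose proof (oddr_ge1 (S J)); pose proof (geo1_pos _ (rho_bounds s (S J) Hs)).
    simpl in IH; nra.
Qed.

(** Intermediate values: at [1 / (N + 1)] the mean is at least [N + 1/2], at [1/108] it is at most
    [0.85 * 108^2 = 9914.4 < N]. *)
Lemma saddle_exists (N : nat) :
  (10001 <= Z.of_nat N)%Z ->
  exists (s : R) (J : nat),
    0 < s <= / 108 /\ 10000 <= INR J * s ^ 2 /\ (N <= J)%nat /\ cum1 s J = INR N.
Proof.
  intros HN.
  (* [J] is fixed before [s], since [cum1] depends on it; [s >= 1 / (N + 1)] then gives
     [J s^2 >= 10000]. *)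
  set (J := Z.to_nat (10000 * ((Z.of_nat N + 1) * (Z.of_nat N + 1)))).
  assert (HN' : 10001 <= INR N).
  { rewrite INR_IZR_INZ; now apply IZR_le. }
  assert (Hx : / (INR N + 1) < / 108) by (apply Rinv_lt_contravar; nra).
  assert (Hx0 : 0 < / (INR N + 1)) by (apply Rinv_0_lt_compat; lra).
  destruct (IVT_interv (fun s => INR N - cum1 s J) (/ (INR N + 1)) (/ 108)) as [s [Hs E]].
  - intros a Ha; apply continuity_pt_minus.
    + apply continuity_pt_const; intros ? ?; reflexivity.
    + apply cum1_continuous; lra.
  - trivial.
  - pose proof (cum1_large J (/ (INR N + 1)) ltac:(unfold J; lia) Hx0) as H.
    rewrite Rinv_inv in H; lra.
  - destruct (cum_upper (/ 108) J ltac:(lra)) as (C & _).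
    rewrite Rinv_inv in C; lra.
  - exists s, J; repeat split; try lra.
    + assert (HJ : INR J = 10000 * (INR N + 1) ^ 2).
      { unfold J; rewrite !INR_IZR_INZ, Z2Nat.id by nia.
        rewrite !mult_IZR, plus_IZR; ring. }
      rewrite HJ.
      assert (1 <= (INR N + 1) * s).
      { apply Rmult_le_reg_l with (/ (INR N + 1)); [trivial|].
        rewrite <- Rmult_assoc, Rinv_l by lra; lra. }
      replace (10000 * (INR N + 1) ^ 2 * s ^ 2) with (10000 * ((INR N + 1) * s) ^ 2) by ring.
      nra.
    + unfold J; nia.
Qed.

Theorem BR_odd_partitions_pos (o : nat -> nat -> R) (n : nat) :
  (forall m, o O m = if (m =? 0)%nat then 1 else 0) ->
  (forall J m, o (S J) m =
     o J m + if (2 * J + 1 <=? m)%nat then o (S J) (m - (2 * J + 1))%nat else 0) ->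
  (10000 <= Z.of_nat n)%Z ->
  exists J, (n + 1 <= J)%nat /\
    0 < BR (o J (n - 1)%nat) (o J n) (o J (n + 1)%nat) (o J (n + 2)%nat) (o J (n + 3)%nat).
Proof.
  intros H0 HS Hn.
  destruct (saddle_exists (n + 1) ltac:(lia)) as (s & J & Hs & HJ & HNJ & E).
  exists J; split; [trivial|].
  rewrite INR_IZR_INZ in E.
  pose proof (BR_fcoef_pos (sqrt s) s J ltac:(apply sqrt_lt_R0; lra)
     ltac:(symmetry; simpl; rewrite Rmult_1_r; apply sqrt_sqrt; lra) ltac:(lra) HJ _ E) as P.
  replace (Z.of_nat (n + 1) - 2)%Z with (Z.of_nat (n - 1)) in P by lia.
  replace (Z.of_nat (n + 1) - 1)%Z with (Z.of_nat n) in P by lia.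
  replace (Z.of_nat (n + 1) + 1)%Z with (Z.of_nat (n + 2)) in P by lia.
  replace (Z.of_nat (n + 1) + 2)%Z with (Z.of_nat (n + 3)) in P by lia.
  rewrite !(fcoef_eq o) in P by (trivial; lra).
  set (C := 2 * PI * rprod (fun i => 1 - rho s i) J) in P.
  set (X := exp (- (INR (n - 1) * s))) in P; set (e := exp (- s)).
  assert (EX : forall j, exp (- (INR (n - 1 + j) * s)) = X * e ^ j).
  { intros j; unfold X, e; rewrite exp_pow, <- exp_plus, plus_INR; f_equal; ring. }
  replace (exp (- (INR n * s))) with (X * e ^ 1) in P by (rewrite <- EX; do 4 f_equal; lia).
  replace (exp (- (INR (n + 1) * s))) with (X * e ^ 2) in P by (rewrite <- EX; do 4 f_equal; lia).
  replace (exp (- (INR (n + 2) * s))) with (X * e ^ 3) in P by (rewrite <- EX; do 4 f_equal; lia).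
  replace (exp (- (INR (n + 3) * s))) with (X * e ^ 4) in P by (rewrite <- EX; do 4 f_equal; lia).
  assert (HC : 0 < C).
  { unfold C; pose proof PI_RGT_0; apply Rmult_lt_0_compat; [lra|]; apply rprod_pos.
    intros i; pose proof (rho_bounds s i ltac:(lra)); lra. }
  assert (HX : 0 < X) by apply exp_pos.
  assert (He : 0 < e) by apply exp_pos.
  (* [BR] is homogeneous of degree 3, and in each of its terms the indices sum to 6. *)
  apply Rmult_lt_reg_l with ((C * X) ^ 3 * e ^ 6).
  - apply Rmult_lt_0_compat; apply pow_lt; [apply Rmult_lt_0_compat|]; trivial.
  - rewrite Rmult_0_r; eapply Rlt_le_trans; [exact P|]. right; unfold BR; ring.
Qed.

(** A subtraction-free inequality in [nat] is the common form in which both ranges are handed over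
    to [int]. *)
Lemma minor_lt_of_BZ (a0 a1 a2 a3 a4 : nat) :
  (0 < BZ (Z.of_nat a0) (Z.of_nat a1) (Z.of_nat a2) (Z.of_nat a3) (Z.of_nat a4))%Z ->
  (a0 * a2 * a4 + 2 * a1 * a2 * a3 < a2 * a2 * a2 + a0 * (a3 * a3) + a1 * a1 * a4)%nat.
Proof. unfold BZ; intros H; apply Nat2Z.inj_lt; rewrite !Nat2Z.inj_add, !Nat2Z.inj_mul; lia. Qed.

Lemma minor_lt_of_BR (a0 a1 a2 a3 a4 : nat) :
  0 < BR (INR a0) (INR a1) (INR a2) (INR a3) (INR a4) ->
  (a0 * a2 * a4 + 2 * a1 * a2 * a3 < a2 * a2 * a2 + a0 * (a3 * a3) + a1 * a1 * a4)%nat.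
Proof.
  unfold BR; intros H; apply INR_lt; rewrite !plus_INR, !mult_INR.
  change (INR 2) with (1 + 1); lra.
Qed.

Local Close Scope R_scope.

Require Import Defs.
From mathcomp Require Import all_boot all_order all_algebra.
From mathcomp Require Import ring zify.
Set Implicit Arguments.
Unset Strict Implicit.
Unset Printing Implicit Defensive.
Import Order.TTheory GRing.Theory Num.Theory.
Local Open Scope ring_scope.

(** * Generating functions of partitions *)

Definition dpoly (K : nat) : {poly int} := \prod_(i < K) (1 + 'X^(i.+1)).

Lemma coef_dpoly_q (n : nat) : (dpoly n)`_n = (q n)%:Z.
Proof.
rewrite /dpoly; under eq_bigr => i _ do rewrite addrC.
rewrite bigA_distr coef_sum /q cardsE -sum1_card -[RHS]natz natr_sum.
rewrite [RHS]big_mkcond /=; apply: eq_bigr => A _.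
rewrite -big_mkcond /= -(big_morph (fun k => 'X^k) (exprD 'X) (expr0 'X)) coefXn eq_sym.
by rewrite unfold_in /= -eqnE mulrb.
Qed.

(** Congruence modulo ['X^M]; it stands in for formal power series, and division by [1 - 'X^l]
    becomes the cancellation [eqX_cancel]. *)
Definition eqX (M : nat) (p r : {poly int}) : Prop := forall m, (m < M)%N -> p`_m = r`_m.

Lemma eqX_refl M p : eqX M p p. Proof. by []. Qed.

Lemma eqX_sym M p r : eqX M p r -> eqX M r p.
Proof. by move=> H m hm; rewrite H. Qed.

Lemma eqX_trans M r p s : eqX M p r -> eqX M r s -> eqX M p s.
Proof. by move=> H1 H2 m hm; rewrite H1 ?H2. Qed.

Lemma eqX_add M p p' r r' : eqX M p p' -> eqX M r r' -> eqX M (p + r) (p' + r').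
Proof. by move=> H1 H2 m hm; rewrite !coefD H1 ?H2. Qed.

Lemma eqX_mul M p p' r r' : eqX M p p' -> eqX M r r' -> eqX M (p * r) (p' * r').
Proof.
move=> H1 H2 m hm; rewrite !coefM; apply: eq_bigr => i _.
by rewrite H1 ?H2 //; [apply: leq_ltn_trans hm; apply: leq_subr | apply: leq_ltn_trans hm; rewrite -ltnS].
Qed.

Lemma eqX_sum M (I : Type) (s : seq I) (F G : I -> {poly int}) :
  (forall i, eqX M (F i) (G i)) -> eqX M (\sum_(i <- s) F i) (\sum_(i <- s) G i).
Proof. by move=> H m hm; rewrite !coef_sum; apply: eq_bigr => i _; apply: H. Qed.

Lemma eqX_cancel M l p r :
  (0 < l)%N -> eqX M ((1 - 'X^l) * p) ((1 - 'X^l) * r) -> eqX M p r.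
Proof.
move=> l0 H m; elim/ltn_ind: m => m IH hm; have := H m hm.
rewrite !mulrBl !mul1r !coefB !coefXnM; case: ltnP => [_|lm]; first by rewrite !subr0.
have E : p`_(m - l) = r`_(m - l) by apply: IH; lia.
by rewrite E => /(congr1 (+%R^~ r`_(m - l))); rewrite !subrK.
Qed.

Lemma eqX_cancel_prod M K (f : nat -> nat) p r :
  (forall i, (0 < f i)%N) ->
  eqX M ((\prod_(i < K) (1 - 'X^(f i))) * p) ((\prod_(i < K) (1 - 'X^(f i))) * r) -> eqX M p r.
Proof.
move=> f0; elim: K p r => [|K IH] p r; first by rewrite big_ord0 !mul1r.
by rewrite big_ord_recr /= -!mulrA => /IH /eqX_cancel; apply.
Qed.

Definition seqp (M : nat) (f : nat -> nat) : {poly int} := \poly_(i < M) (f i)%:Z.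

(* The coefficients of [f / (1 - X^l)]. *)
Definition divseq (l : nat) (f : nat -> nat) (n : nat) : nat :=
  (\sum_(j < (n %/ l).+1) f (n - j * l))%N.

Lemma divseqE l f n : (0 < l)%N ->
  divseq l f n = (f n + if (l <= n)%N then divseq l f (n - l) else 0)%N.
Proof.
move=> l0; rewrite /divseq big_ord_recl /= mul0n subn0; congr (_ + _)%N.
case: leqP => h; last by rewrite divn_small // big_ord0.
have -> : (n %/ l)%N = ((n - l) %/ l).+1.
  by rewrite -{1}(subnK h) divnDr ?dvdnn // divnn l0 addn1.
by apply: eq_bigr => j _; rewrite /bump /= add1n mulSn subnDA.
Qed.

Lemma seqp_divseq M l f : (0 < l)%N -> eqX M ((1 - 'X^l) * seqp M (divseq l f)) (seqp M f).
Proof.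
move=> l0 m hm; rewrite mulrBl mul1r coefB coefXnM !coef_poly hm divseqE //.
case: ltnP => lm; first by rewrite addn0 subr0.
by rewrite (leq_ltn_trans (leq_subr _ _) hm) PoszD addrK.
Qed.

Definition delta0 (n : nat) : nat := (n == 0)%N.

Lemma seqp_delta0 M : eqX M (seqp M delta0) 1.
Proof. by move=> m hm; rewrite coef_poly hm coef1 /delta0; case: (m == 0)%N. Qed.

Fixpoint oddparts (J : nat) : nat -> nat :=
  if J is J'.+1 then divseq (2 * J' + 1) (oddparts J') else delta0.

Lemma oddparts_prod M J :
  eqX M ((\prod_(i < J) (1 - 'X^(2 * i + 1))) * seqp M (oddparts J)) 1.
Proof.
elim: J => [|J IH]; first by rewrite big_ord0 mul1r; apply: seqp_delta0.
rewrite big_ord_recr /= -mulrA.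
apply: eqX_trans IH; apply: eqX_mul; first exact: eqX_refl.
by apply: seqp_divseq; rewrite addn1.
Qed.

Lemma dpoly_mul K :
  dpoly K * \prod_(i < K) (1 - 'X^(i.+1)) = \prod_(i < K) (1 - 'X^(i.+1 * 2)).
Proof.
rewrite /dpoly -big_split /=; apply: eq_bigr => i _.
by rewrite exprM; ring.
Qed.

Lemma prod_even_odd J :
  \prod_(i < J.*2) (1 - 'X^(i.+1) : {poly int}) =
  (\prod_(i < J) (1 - 'X^(i.+1 * 2))) * \prod_(i < J) (1 - 'X^(2 * i + 1)).
Proof.
elim: J => [|J IH]; first by rewrite !big_ord0 mul1r.
rewrite doubleS !big_ord_recr /= IH.
have -> : (2 * J + 1 = J.*2.+1)%N by lia.
have -> : (J.+1 * 2 = J.*2.+2)%N by lia.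
by ring.
Qed.

(* Euler's theorem on distinct and odd parts. *)
Lemma dpoly_oddparts J : eqX J.*2.+1 (dpoly J.*2) (seqp J.*2.+1 (oddparts J)).
Proof.
set M := J.*2.+1; set E := \prod_(i < J) (1 - 'X^(2 * i + 1) : {poly int}).
have H : eqX M (dpoly J.*2 * E) 1.
  apply: (@eqX_cancel_prod M J (fun i => i.+1 * 2)%N) => [i|]; first lia.
  have -> : \prod_(i < J) (1 - 'X^(i.+1 * 2)) * (dpoly J.*2 * E) =
            dpoly J.*2 * \prod_(i < J.*2) (1 - 'X^(i.+1)) by rewrite prod_even_odd -/E mulrCA.
  rewrite dpoly_mul mulr1.
  (* The factors with [J <= i] have exponents of at least [2 J + 2] and are therefore 1 modulo
     ['X^M]; the others are the ones being cancelled. *)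
  have -> : \prod_(i < J.*2) (1 - 'X^(i.+1 * 2) : {poly int}) =
     \prod_(i < J) (1 - 'X^(i.+1 * 2)) * \prod_(J <= i < J.*2) (1 - 'X^(i.+1 * 2)).
    by rewrite -!(big_mkord xpredT (fun i => 1 - 'X^(i.+1 * 2))) -big_cat_nat //; lia.
  rewrite -[X in eqX _ _ X]mulr1; apply: eqX_mul; first exact: eqX_refl.
  rewrite big_nat; apply: (big_ind (fun p => eqX M p 1)); first exact: eqX_refl.
    by move=> p r Hp Hr; rewrite -[1]mulr1; apply: eqX_mul.
  move=> i /andP[hi _] m hm; rewrite coefB coefXn.
  by rewrite (_ : (m == _) = false) ?subr0 //; rewrite /M in hm; lia.
apply: (@eqX_trans _ (dpoly J.*2 * (E * seqp M (oddparts J)))).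
  rewrite -{1}[dpoly _]mulr1; apply: eqX_mul; first exact: eqX_refl.
  by apply: eqX_sym; apply: oddparts_prod.
rewrite mulrA -[X in eqX _ _ X]mul1r; apply: eqX_mul; [exact: H | exact: eqX_refl].
Qed.

Lemma coef_dpoly_stable K n : (n <= K)%N -> (dpoly K)`_n = (dpoly n)`_n.
Proof.
elim: K => [|K IH]; first by rewrite leqn0 => /eqP ->.
rewrite leq_eqVlt => /orP[/eqP -> //|hn].
rewrite /dpoly big_ord_recr /= -/(dpoly K) mulrDr mulr1 coefD mulrC coefXnM hn addr0.
by apply: IH.
Qed.

Lemma q_oddparts J n : (n <= J.*2)%N -> q n = oddparts J n.
Proof.
move=> h; have := dpoly_oddparts (h : (n < J.*2.+1)%N).
by rewrite coef_dpoly_stable // coef_dpoly_q coef_poly ltnS h; case.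
Qed.

(* The part of [dpoly K] counting the partitions with exactly [k] parts. *)
Fixpoint kparts (K k : nat) : {poly int} :=
  if K is K'.+1 then kparts K' k + (if k is k'.+1 then 'X^K * kparts K' k' else 0)
  else (k == 0)%N%:R.

Lemma kparts0 K : kparts K 0 = 1.
Proof. by elim: K => [|K IH] //=; rewrite IH addr0. Qed.

Lemma kpartsS K k : kparts K.+1 k.+1 = kparts K k.+1 + 'X^(K.+1) * kparts K k.
Proof. by []. Qed.

(* Remove 1 from every part. *)
Lemma kparts_shift K k : kparts K.+1 k.+1 = 'X^(k.+1) * (kparts K k.+1 + kparts K k).
Proof.
elim: K k => [|K IH] k.
  by rewrite /= !add0r; case: k => [|k] //=; rewrite !mulr0.
rewrite kpartsS [in LHS]IH; case: k => [|k].
  by rewrite (kpartsS K 0) !kparts0 !exprS; ring.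
rewrite (kpartsS K k.+1) {2}(kpartsS K k) (IH k) !exprS; ring.
Qed.

Lemma sum_kparts K m : (K < m)%N -> \sum_(k < m) kparts K k = dpoly K.
Proof.
elim: K m => [|K IH] [|m] // h.
  by rewrite /dpoly big_ord0 big_ord_recl big1 ?addr0.
rewrite [RHS]/dpoly [RHS]big_ord_recr -/(dpoly K) big_split /= IH; last lia.
rewrite mulrDr mulr1; congr (_ + _).
rewrite big_ord_recl add0r /= -mulr_sumr IH; last lia.
exact: mulrC.
Qed.

Lemma kparts_stable K k : eqX K.+1 (kparts K.+1 k) (kparts K k).
Proof.
move=> m hm; rewrite /= coefD; case: k => [|k]; first by rewrite coef0 addr0.
by rewrite coefXnM hm addr0.
Qed.

(** * Euler's expansion by the number of parts *)

Fixpoint triang (k : nat) : nat := if k is k'.+1 then (k + triang k')%N else 0%N.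

(** Coefficients of [1 / ((1 - X) ... (1 - X^k))], counting partitions into parts of size at most
    [k]. *)
Fixpoint small_parts (k : nat) : nat -> nat :=
  if k is k'.+1 then divseq k (small_parts k') else delta0.

(** Modulo [X^(L+1)] a further admissible part [L + 1] changes nothing, so [kparts_shift] becomes
    [(1 - X^(k+1)) e_(k+1) = X^(k+1) e_k] with [e_k = kparts L k]. *)
Lemma kparts_small L k : eqX L.+1 (kparts L k) ('X^(triang k) * seqp L.+1 (small_parts k)).
Proof.
elim: k => [|k IH].
  by rewrite kparts0 expr0 mul1r; apply: eqX_sym; apply: seqp_delta0.
apply: (@eqX_cancel _ k.+1) => //.
apply: (@eqX_trans _ ('X^(k.+1) * kparts L k)).
  have H : eqX L.+1 (kparts L k.+1) ('X^(k.+1) * (kparts L k.+1 + kparts L k)).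
    by rewrite -kparts_shift; apply: eqX_sym; apply: kparts_stable.
  by move=> m hm; rewrite mulrBl mul1r coefB (H m hm) mulrDr coefD addrC addKr.
apply: (@eqX_trans _ ('X^(k.+1) * ('X^(triang k) * seqp L.+1 (small_parts k)))).
  by apply: eqX_mul; [exact: eqX_refl | exact: IH].
rewrite mulrA -exprD /= mulrCA; apply: eqX_mul; first exact: eqX_refl.
by apply: eqX_sym; apply: seqp_divseq.
Qed.

Lemma triang_mono j k : (j <= k)%N -> (triang j <= triang k)%N.
Proof. by elim: k => [|k IH]; [rewrite leqn0 => /eqP -> | rewrite leq_eqVlt => /orP[/eqP -> //|/IH] /=; lia]. Qed.

(** More than [K] distinct parts have sum at least [triang (K + 1)], so those terms vanish modulo
    [X^(L+1)]. *)
Lemma dpoly_small L K :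
  (L < triang K.+1)%N ->
  eqX L.+1 (dpoly L) (\sum_(0 <= k < K.+1) 'X^(triang k) * seqp L.+1 (small_parts k)).
Proof.
move=> hL; set G := fun k => 'X^(triang k) * seqp L.+1 (small_parts k).
apply: (@eqX_trans _ (\sum_(0 <= k < K.+1 + L.+1) G k)).
  rewrite -(@sum_kparts L (K.+1 + L.+1)); last lia.
  rewrite -(big_mkord xpredT (fun k => kparts L k)).
  by apply: eqX_sum => k; apply: kparts_small.
rewrite (@big_cat_nat _ _ _ K.+1) //=; last lia.
rewrite -[X in eqX _ _ X]addr0; apply: eqX_add; first exact: eqX_refl.
move=> m hm; rewrite coef_sum coef0 big_nat big1 // => k /andP[hk _].
by rewrite /G coefXnM (leq_trans hm) // (leq_trans hL) // triang_mono.
Qed.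

(* [horner_seq K d] is [1 + X^k/(1-X^k) (1 + X^(k+1)/(1-X^(k+1)) (... (1 + X^K/(1-X^K))))]
   with [k = K - d + 1]. *)
Fixpoint horner_seq (K d : nat) : nat -> nat :=
  if d is d'.+1 then
    fun n => (delta0 n + if K - d' <= n then divseq (K - d') (horner_seq K d') (n - (K - d')) else 0)%N
  else delta0.

Lemma seqp_horner M K d :
  eqX M (seqp M (horner_seq K d.+1))
        (1 + 'X^(K - d) * seqp M (divseq (K - d) (horner_seq K d))).
Proof.
move=> m hm; rewrite coefD coefXnM !coef_poly hm coef1 /= PoszD.
rewrite /delta0; congr (_ + _); first by case: (m == 0)%N.
case: ltnP => h //; by rewrite (leq_ltn_trans (leq_subr _ _) hm).
Qed.

(** Induction from the innermost bracket. The step from [k] to [k - 1] uses [small_parts (k - 1) =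
    (1 - X^k) small_parts k] as series and [triang k = k + triang (k - 1)]; keeping the factor
    [small_parts (K - d)] on the right avoids divisions. *)
Lemma horner_seq_sum M K d :
  (d <= K)%N ->
  eqX M (\sum_(K - d <= j < K.+1) 'X^(triang j - triang (K - d)) * seqp M (small_parts j))
        (seqp M (small_parts (K - d)) * seqp M (horner_seq K d)).
Proof.
elim: d => [|d IH] hd.
  rewrite subn0 big_nat1 subnn expr0 mul1r -[X in eqX _ X _]mulr1.
  by apply: eqX_mul; [exact: eqX_refl | apply: eqX_sym; apply: seqp_delta0].
set k := (K - d)%N; have hk : (0 < k)%N by rewrite /k; lia.
have -> : (K - d.+1 = k.-1)%N by rewrite /k; lia.
set r := fun j => seqp M (small_parts j).
have hr : eqX M ((1 - 'X^k) * r k) (r k.-1).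
  by rewrite /r -{2}(prednK hk) /=; rewrite prednK //; apply: seqp_divseq.
rewrite big_nat_recl; last by rewrite /k; lia.
rewrite subnn expr0 mul1r.
apply: (@eqX_trans _ (r k.-1 + 'X^k * (r k * seqp M (horner_seq K d)))).
  apply: eqX_add; first exact: eqX_refl.
  have hS := IH (ltnW hd); rewrite -/k -/(r k) in hS.
  apply: (@eqX_trans _ ('X^k * \sum_(k <= j < K.+1) 'X^(triang j - triang k) * r j)); last first.
    by apply: eqX_mul; [exact: eqX_refl | exact: hS].
  rewrite mulr_sumr.
  have -> : \sum_(k.-1 <= i < K) 'X^(triang i.+1 - triang k.-1) * seqp M (small_parts i.+1) =
            \sum_(k <= j < K.+1) 'X^(triang j - triang k.-1) * r j.
    by rewrite -{3}(prednK hk) big_add1.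
  rewrite big_nat [X in eqX _ _ X]big_nat.
  have -> : \sum_(k <= i < K.+1 | (k <= i < K.+1)%N) 'X^(triang i - triang k.-1) * r i =
            \sum_(k <= i < K.+1 | (k <= i < K.+1)%N) 'X^k * ('X^(triang i - triang k) * r i).
    apply: eq_bigr => j /andP[hj _]; rewrite mulrA -exprD; congr ('X^_ * _).
    have h1 := triang_mono hj.
    have h2 : triang k = (k + triang k.-1)%N by rewrite -{1}(prednK hk) /= prednK.
    by lia.
  exact: eqX_refl.
apply: eqX_sym.
apply: (@eqX_trans _ (r k.-1 * (1 + 'X^k * seqp M (divseq k (horner_seq K d))))).
  by apply: eqX_mul; [exact: eqX_refl | exact: seqp_horner].
rewrite mulrDr mulr1; apply: eqX_add; first exact: eqX_refl.
apply: (@eqX_trans _ (((1 - 'X^k) * r k) * ('X^k * seqp M (divseq k (horner_seq K d))))).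
  by apply: eqX_mul; [exact: eqX_sym | exact: eqX_refl].
have -> : (1 - 'X^k) * r k * ('X^k * seqp M (divseq k (horner_seq K d))) =
  'X^k * (r k * ((1 - 'X^k) * seqp M (divseq k (horner_seq K d)))) by ring.
apply: eqX_mul; first exact: eqX_refl.
apply: eqX_mul; first exact: eqX_refl.
exact: seqp_divseq.
Qed.

Lemma q_horner K n : (n < triang K.+1)%N -> q n = horner_seq K K n.
Proof.
move=> hn; have := dpoly_small hn (ltnSn n); rewrite coef_dpoly_q.
have := @horner_seq_sum n.+1 K K (leqnn K) n (ltnSn n); rewrite subnn.
under eq_bigr => j _ do rewrite subn0.
move=> -> ; rewrite (_ : _`_n = (horner_seq K K n)%:Z); first by case.
have : eqX n.+1 (seqp n.+1 (small_parts 0) * seqp n.+1 (horner_seq K K)) (seqp n.+1 (horner_seq K K)).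
  rewrite -[X in eqX _ _ X]mul1r; apply: eqX_mul; [exact: seqp_delta0 | exact: eqX_refl].
by move=> -> //; rewrite coef_poly ltnSn.
Qed.

Lemma q_pos n : (0 < q n)%N.
Proof.
rewrite card_gt0; apply/set0Pn; case: n => [|n].
  by exists set0; rewrite inE big_set0.
by exists [set ord_max]; rewrite inE big_set1.
Qed.

(* Assembly of the two ranges *)
Delimit Scope Z_scope with coqZ.

Lemma B_pos_of_minor_lt (a0 a1 a2 a3 a4 : nat) :
  (a0 * a2 * a4 + 2 * a1 * a2 * a3 < a2 * a2 * a2 + a0 * (a3 * a3) + a1 * a1 * a4)%coq_nat ->
  0 < B a0%:Z a1%:Z a2%:Z a3%:Z a4%:Z.
Proof.
move=> /ssrnat.ltP H.
have -> : B a0%:Z a1%:Z a2%:Z a3%:Z a4%:Z =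
  (a2 * a2 * a2 + a0 * (a3 * a3) + a1 * a1 * a4)%N%:Z - (a0 * a2 * a4 + 2 * a1 * a2 * a3)%N%:Z.
  by rewrite /B !PoszD !PoszM; ring.
by rewrite subr_gt0 ltz_nat; exact: H.
Qed.

Lemma oddparts_rec (J m : nat) :
  INR (oddparts J.+1 m) = Rplus (INR (oddparts J m))
    (if Nat.leb (2 * J + 1)%coq_nat m
     then INR (oddparts J.+1 (m - (2 * J + 1))%coq_nat) else R0).
Proof.
have l0 : (0 < 2 * J + 1)%N by rewrite addn1.
rewrite ?multE ?plusE ?minusE /= divseqE // plus_INR.
by case: PeanoNat.Nat.leb_spec => [/ssrnat.leP|/ssrnat.ltP] h; [rewrite h | rewrite leqNgt h].
Qed.

Lemma B_q_pos_large (n : nat) :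
  (10000 <= Z.of_nat n)%coqZ ->
  0 < B (q (n - 1))%:Z (q n)%:Z (q (n + 1))%:Z (q (n + 2))%:Z (q (n + 3))%:Z.
Proof.
move=> hn; apply: B_pos_of_minor_lt; apply: minor_lt_of_BR.
have [|J [hJ]] := @BR_odd_partitions_pos (fun J m => INR (oddparts J m)) n _ oddparts_rec hn.
  by case.
have hJ' : (n + 3 <= J.*2)%N by lia.
by rewrite ?plusE ?minusE -!(@q_oddparts J) //; lia.
Qed.

Lemma B_q_pos_small (n : nat) :
  (272 <= n)%N -> (Z.of_nat n < 10000)%coqZ ->
  0 < B (q (n - 1))%:Z (q n)%:Z (q (n + 1))%:Z (q (n + 2))%:Z (q (n + 3))%:Z.
Proof.
move=> hn1 hn2; apply: B_pos_of_minor_lt; apply: minor_lt_of_BZ.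
(* Reindexed by the first part: [T 1] is the whole expression and [T 142] the innermost 1. *)
pose T k := horner_seq 141 (142 - k).
have htri : Z.of_nat (triang 142) = 10153%coqZ by vm_compute.
have hq m : (Z.of_nat m < 10012)%coqZ -> q m = T 1%N m.
  by move=> hm; rewrite (@q_horner 141) //; lia.
(* The window starts at the index [n - 1], which turns [272 <= n] into the bound 271 of the
   table. *)
have := @qtable_window T (fun k => divseq k (T k.+1)) (n - 1)%N.
rewrite ?plusE -!hq; try lia.
have -> : (n - 1 + 1 = n)%N by lia.
have -> : (n - 1 + 2 = n + 1)%N by lia.
have -> : (n - 1 + 3 = n + 2)%N by lia.
have -> : (n - 1 + 4 = n + 3)%N by lia.
apply => //; try lia.
- move=> j m hj; rewrite divseqE //.
  by congr (_ + _)%N; case: PeanoNat.Nat.leb_spec => [/ssrnat.leP|/ssrnat.ltP] h; [rewrite h | rewrite leqNgt h].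
- move=> j m hj; rewrite {1}/T.
  have -> : (142 - j.+1 = (140 - j).+1)%N by lia.
  rewrite [LHS]/=.
  have -> : (141 - (140 - j) = j.+1)%N by lia.
  have -> : horner_seq 141 (140 - j) = T j.+2 by rewrite /T; congr horner_seq; lia.
  congr (_ + _)%N.
  by case: PeanoNat.Nat.leb_spec => [/ssrnat.leP|/ssrnat.ltP] h; [rewrite h | rewrite leqNgt h].
- by move=> m hm; rewrite -hq //; apply/ssrnat.ltP; apply: q_pos.
Qed.

Theorem theorem1p4 (n : nat) (hn : (272 <= n)%N) :
  0 < B (q (n - 1))%:Z (q n)%:Z (q (n + 1))%:Z (q (n + 2))%:Z (q (n + 3))%:Z.
Proof.
have [h|h] := Z_lt_le_dec (Z.of_nat n) 10000%coqZ.
- exact: B_q_pos_small.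
- exact: B_q_pos_large.
Qed.
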